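(* Let $n\ge 3$ and let $a,b$ be real numbers with $a<n$, $b<n$. Let $\mathbf X$ be an i.i.d. sample of size $n$ from the bivariate normal distribution with parameters $(\mu_1,\mu_2,\sigma_1,\sigma_2,\rho)$, use the prior $\pi_{ab}$, and let $\theta_3=|\boldsymbol\Sigma|=\sigma_1^2\sigma_2^2(1-\rho^2)$. (a) The posterior distribution of $\theta_3$ given $\mathbf X$ is the distribution (with the data held fixed) of $\theta_3^*=|\mathbf S|/(\chi^{2*}_{n-a}\chi^{2*}_{n-b})$. (b) For every $\alpha\in(0,1)$, $\boldsymbol\xi=(\mu_1,\mu_2,\sigma_1,\sigma_2)$ and $\rho\in(-1,1)$, $$P(\theta_3<(\theta_3^* )_{1-\alpha}\mid\boldsymbol\xi,\rho)=P\left(\chi^2_{n-1}\chi^2_{n-2}>(\chi^{2*}_{n-a}\chi^{2*}_{n-b})_{\alpha}\right),$$ which does not depend on $\rho$. Furthermore, this quantity equals $1-\alpha$ for all $\alpha\in(0,1)$ if and only if $(a,b)$ is $(1,2)$ or $(2,1)$.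
   Context: Model: $\mathbf x_k=(x_{1k},x_{2k})'$, $k=1,\dots,n$, are i.i.d. bivariate normal with mean $(\mu_1,\mu_2)'\in\mathbb R^2$ and covariance matrix $\boldsymbol\Sigma=\begin{pmatrix}\sigma_1^2&\rho\sigma_1\sigma_2\\ \rho\sigma_1\sigma_2&\sigma_2^2\end{pmatrix}$, $\sigma_1,\sigma_2>0$, $|\rho|<1$. Statistics: $\overline{\mathbf x}=n^{-1}\sum_k\mathbf x_k$ and $\mathbf S=\sum_{k=1}^n(\mathbf x_k-\overline{\mathbf x})(\mathbf x_k-\overline{\mathbf x})'$; $|\cdot|$ of a matrix denotes the determinant. Prior: $\pi_{ab}$ is the (improper) density, with respect to $d\mu_1\,d\mu_2\,d\sigma_1\,d\sigma_2\,d\rho$, $$\pi_{ab}(\mu_1,\mu_2,\sigma_1,\sigma_2,\rho)=\frac{1}{\sigma_1^{3-a}\sigma_2^{2-b}(1-\rho^2)^{2-b/2}},$$ and the posterior given $\mathbf X$ is the normalized product of likelihood and prior (proper when $a<n$, $b<n$). Random variables: $\chi^2_m$ and $\chi^{2*}_m$ denote chi-squared random variables with $m$ (real, positive) degrees of freedom, i.e. Gamma with shape $m/2$ and rate $1/2$; $\chi^2_{n-1},\chi^2_{n-2},\chi^{2*}_{n-a},\chi^{2*}_{n-b}$ are mutually independent (four separate variables, even if $a=b$). Quantiles: $(W)_{\beta}$ denotes the $\beta$ quantile of $W$ with respect to the distribution of the starred variables only, all non-starred quantities (in particular the data) being held fixed; so $(\theta_3^* )_{1-\alpha}$ is a function of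 $\mathbf X$, the posterior $1-\alpha$ quantile of $\theta_3$. Frequentist coverage: $P(\cdot\mid\boldsymbol\xi,\rho)$ is probability under the sampling distribution of $\mathbf X$ with the parameters fixed. *)

(* Defs.v *)
From HB Require Import structures.
From mathcomp Require Import all_boot all_order all_algebra.
From mathcomp Require Import ring.
From mathcomp Require Import all_classical all_reals all_analysis.

Set Implicit Arguments.
Unset Strict Implicit.
Unset Printing Implicit Defensive.

Import Order.TTheory GRing.Theory Num.Theory.
Import numFieldNormedType.Exports.

Local Open Scope classical_set_scope.
Local Open Scope ring_scope.

Section random_variables.
Context d d' (T : measurableType d) (T' : measurableType d') (R : realType)
  (P : probability T R).

(* Taking [A i = setT] gives the product rule for every subfamily. *)
Definition mutually_independent (I : finType) (X : I -> {RV P >-> T'}) : Prop :=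
  forall A : I -> set T', (forall i, measurable (A i)) ->
    P [set w | forall i, A i (X i w)] = (\prod_(i : I) P (X i @^-1` A i))%E.

(* For [0 < beta < 1] the set below is nonempty and bounded from below. *)
Definition quantile (W : T -> R) (beta : R) : R :=
  inf [set q : R | (beta%:E <= P [set w | (W w <= q)%R])%E].

End random_variables.

Section chi_squared.
Context {R : realType}.

Definition Gamma_fun (s : R) : R :=
  \int[lebesgue_measure]_(t in `]0, +oo[) (t `^ (s - 1) * expR (- t)).

Definition gamma_pdf (shape rate x : R) : R :=
  if 0 < x then
    rate `^ shape / Gamma_fun shape * x `^ (shape - 1) * expR (- (rate * x))
  else 0.

Definition chi2_pdf (m : R) : R -> R := gamma_pdf (m / 2) 2^-1.

Definition is_chi2 d (T : measurableType d) (P : probability T R) (m : R)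
    (X : {RV P >-> R}) : Prop :=
  forall A : set R, measurable A ->
    distribution P X A = (\int[lebesgue_measure]_(x in A) (chi2_pdf m x)%:E)%E.

End chi_squared.

Section bivariate_normal.
Context {R : realType}.

Definition vec2 (x : R * R) : 'cV[R]_2 := \col_(i < 2) [:: x.1; x.2]`_i.

Definition Sigma (s1 s2 rho : R) : 'M[R]_2 :=
  \matrix_(i < 2, j < 2)
    (nth [::] [:: [:: s1 ^+ 2;        rho * s1 * s2];
                  [:: rho * s1 * s2;  s2 ^+ 2]] i)`_j.

Lemma det_Sigma s1 s2 rho :
  \det (Sigma s1 s2 rho) = s1 ^+ 2 * s2 ^+ 2 * (1 - rho ^+ 2).
Proof.
rewrite (expand_det_row _ ord0) !big_ord_recl big_ord0 /cofactor !det_mx11 !mxE /=.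
ring.
Qed.

(* [(mu1, mu2, sigma1, sigma2, rho)] *)
Definition param : Type := R * R * R * R * R.

Definition param_space : set param :=
  [set t | let: (_, _, s1, s2, rho) := t in
           [/\ 0 < s1, 0 < s2 & -1 < rho < 1]].

Definition theta3 (t : param) : R :=
  let: (_, _, s1, s2, rho) := t in \det (Sigma s1 s2 rho).

Definition binormal_pdf (t : param) (x : R * R) : R :=
  let: (mu1, mu2, s1, s2, rho) := t in
  let V := Sigma s1 s2 rho in
  let y := vec2 x - vec2 (mu1, mu2) in
  (2 * pi * Num.sqrt (\det V))^-1 *
    expR (- ((y^T *m invmx V *m y) ord0 ord0 / 2)).

Definition lebesgue2 := (@lebesgue_measure R \x @lebesgue_measure R)%E.

Definition is_binormal d (T : measurableType d) (P : probability T R)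
    (t : param) (X : {RV P >-> (R * R)%type}) : Prop :=
  forall A : set (R * R), measurable A ->
    distribution P X A = (\int[lebesgue2]_(x in A) (binormal_pdf t x)%:E)%E.

Definition binormal_sample d (T : measurableType d) (P : probability T R)
    (n : nat) (t : param) (X : 'I_n -> {RV P >-> (R * R)%type}) : Prop :=
  mutually_independent X /\ forall k, is_binormal t (X k).

Definition sample_mean n (x : 'I_n -> R * R) : 'cV[R]_2 :=
  n%:R^-1 *: \sum_(k < n) vec2 (x k).

Definition scatter n (x : 'I_n -> R * R) : 'M[R]_2 :=
  \sum_(k < n) (vec2 (x k) - sample_mean x) *m (vec2 (x k) - sample_mean x)^T.

End bivariate_normal.

Section posterior.
Context {R : realType}.

Definition prior (a b : R) (t : param) : R :=
  let: (_, _, s1, s2, rho) := t in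
  (s1 `^ (3 - a) * s2 `^ (2 - b) * (1 - rho ^+ 2) `^ (2 - b / 2))^-1.

Definition likelihood n (x : 'I_n -> R * R) (t : param) : R :=
  \prod_(k < n) binormal_pdf t (x k).

Definition lebesgue5 :=
  (@lebesgue_measure R \x @lebesgue_measure R \x @lebesgue_measure R
     \x @lebesgue_measure R \x @lebesgue_measure R)%E.

Definition posterior_weight (a b : R) n (x : 'I_n -> R * R) (B : set param) :
    \bar R :=
  (\int[lebesgue5]_(t in param_space `&` B) (likelihood x t * prior a b t)%:E)%E.

Definition posterior_proper (a b : R) n (x : 'I_n -> R * R) : Prop :=
  (0 < posterior_weight a b x setT < +oo)%E.

(* Meaningful when [posterior_proper a b x]. *)
Definition posterior (a b : R) n (x : 'I_n -> R * R) (B : set param) : \bar R :=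
  (posterior_weight a b x B * ((fine (posterior_weight a b x setT))^-1)%:E)%E.

End posterior.

(* Main.v *)
(* In the coordinates x = s11 / sigma1^2, y = (|S| / s11) / (sigma2^2 (1 - rho^2)),
   t = rho / sqrt (1 - rho^2), with S = (s_ij), and after integrating out the
   means, the posterior density under pi_ab factors: given (x, y), t is normal,
   and x, y are independent chi-squared with n - a and n - b degrees of freedom,
   while theta3 = |S| / (x y). On the sampling side |S| / |Sigma| is distributed
   as chi2_(n-1) chi2_(n-2): a rotation in the k-th step (Welford's update) shows
   that S is distributed as the Gram matrix of n - 1 standard normal pairs, whose
   determinant is computed by its Cholesky form. Hence the coverage is
   P(q_alpha < chi2_(n-1) chi2_(n-2)), with q_alpha the alpha quantile of
   Y = chi2_(n-a) chi2_(n-b). If it equals 1 - alpha for all alpha, the two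
   products have the same law, and comparing the first two moments, p q and
   p (p + 2) q (q + 2), yields {n - a, n - b} = {n - 1, n - 2}. *)
Require Import Defs.
From HB Require Import structures.
From mathcomp Require Import all_boot all_order all_algebra.
From mathcomp Require Import all_classical all_reals all_analysis.
From mathcomp Require Import measurable_realfun ring lra.

Set Implicit Arguments.
Unset Strict Implicit.
Unset Printing Implicit Defensive.

Import Order.TTheory GRing.Theory Num.Theory.
Import numFieldNormedType.Exports.

Local Open Scope classical_set_scope.
Local Open Scope ring_scope.

(** * Integration on the real line *)

(** Every integrand is nonnegative with values in [\bar R], so integrals can be exchanged and
    substituted without integrability conditions. Constants are carried along unevaluated and fixed
    at the end by comparing total masses: no value of [Gamma_fun] is ever computed, and properness
    of the posterior is the case of the full parameter space. Changes of variables are made in one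
    variable at a time, the others being fixed; this holds for the rotations of the plane as well as
    for the posterior coordinates, and it dictates the order of integration there. On the posterior
    side the degrees of freedom are real, so densities are used; on the sampling side they are
    integers, so the laws are iterated normal integrals of sums of squares. The two descriptions
    meet in [integral_chi2_sumsq]. The level changes from [1 - alpha] to [alpha] because [D / Y]
    decreases in [Y]: its [1 - alpha] quantile is [D / q] with [q] the [alpha] quantile of [Y], and
    [theta < D / q] means [q < D / theta]. *)

Section density.
Local Open Scope ereal_scope.
Context {d : measure_display} {T : measurableType d} {R : realType}.

Import HBNNSimple.

(** Both sides are limits along the same increasing sequence of simple functions, and for an
    indicator the claim is the hypothesis [nuE]. *)
Lemma ge0_integral_density (nu mu : {measure set T -> \bar R}) (g : T -> R)
    (f : T -> \bar R) :
  measurable_fun setT g -> (forall x, (0 <= g x)%R) ->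
  (forall A, measurable A -> nu A = \int[mu]_(x in A) (g x)%:E) ->
  measurable_fun setT f -> (forall x, 0 <= f x) ->
  \int[nu]_x f x = \int[mu]_x (f x * (g x)%:E).
Proof.
move=> mg g0 nuE mf f0.
pose f_ := nnsfun_approx measurableT mf.
have mh n : measurable_fun setT (fun x => (f_ n x)%:E * (g x)%:E).
  by apply: emeasurable_funM; exact/measurable_EFinP.
transitivity (limn (fun n => \int[nu]_x (f_ n x)%:E)).
  rewrite -monotone_convergence//.
  - by apply: eq_integral => x _; apply/esym/cvg_lim => //; apply: cvg_nnsfun_approx.
  - by move=> n; exact/measurable_EFinP/measurable_funTS.
  - by move=> *; rewrite lee_fin.
  - by move=> x _ m n mn; rewrite lee_fin; exact/lefP/nd_nnsfun_approx.
transitivity (limn (fun n => \int[mu]_x ((f_ n x)%:E * (g x)%:E))); last first.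
  rewrite -monotone_convergence//.
  - apply: eq_integral => x _; apply/cvg_lim => //.
    apply: cvgeZr => //; exact: cvg_nnsfun_approx.
  - by move=> n x _; rewrite mule_ge0// lee_fin.
  - move=> x _ m n mn; apply: lee_wpmul2r; rewrite ?lee_fin//.
    exact/lefP/nd_nnsfun_approx.
congr (limn _); apply/funext => n.
have indich r : measurable_fun setT (fun x => (r * \1_(f_ n @^-1` [set r]) x)%:E).
  by apply/measurable_EFinP; exact: measurable_funM.
under eq_integral do rewrite fimfunE -fsumEFin//.
rewrite ge0_integral_fsum//; last by move=> m y Ey; exact: nnfun_muleindic_ge0.
transitivity (\int[mu]_x (\sum_(y \in range (f_ n))
    (y * \1_(f_ n @^-1` [set y]) x)%:E * (g x)%:E)); last first.
  under [RHS]eq_integral => x xE.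
    rewrite fimfunE -fsumEFin// ge0_mule_fsuml; last first.
      by move=> y; exact: nnfun_muleindic_ge0.
    over.
  by [].
rewrite ge0_integral_fsum//; last 2 first.
  - by move=> y; apply: emeasurable_funM => //; exact/measurable_EFinP.
  - by move=> m y Ey; apply: mule_ge0; [exact: nnfun_muleindic_ge0|rewrite lee_fin].
apply: eq_fsbigr => r rhn.
under [LHS]eq_integral do rewrite EFinM.
rewrite integralZl_indic_nnsfun => //.
under [RHS]eq_integral do rewrite EFinM -muleA.
rewrite ge0_integralZl//.
- congr (_ * _); under [RHS]eq_integral do rewrite muleC.
  rewrite -[RHS]/(\int[mu]_x ((EFin \o g) \* (EFin \o \1_(f_ n @^-1` [set r]))) x).
  by rewrite -epatch_indic -integral_mkcond -nuE// integral_indic// setIT.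
- by apply: emeasurable_funM; apply/measurable_EFinP.
- by move=> t Et; rewrite mule_ge0 ?lee_fin.
- by move: rhn; rewrite inE => -[t _ <-]; rewrite lee_fin.
Qed.
End density.

Section density_measure.
Local Open Scope ereal_scope.
Context {d : measure_display} {T : measurableType d} {R : realType}
  (mu : {measure set T -> \bar R}) (g : T -> R).
Hypotheses (mg : measurable_fun setT g) (g0 : forall x, (0 <= g x)%R).

(** The two proofs are arguments so that the measure instance declared below can recover them from
    the term. *)
Definition density_measure of measurable_fun setT g & (forall x, (0 <= g x)%R) :
    set T -> \bar R :=
  fun A => \int[mu]_(x in A) (g x)%:E.

Local Notation nu := (density_measure mg g0).

Let nu0 : nu set0 = 0. Proof. by rewrite /density_measure integral_set0. Qed.

Let nu_ge0 A : 0 <= nu A.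
Proof. by apply: integral_ge0 => x _; rewrite lee_fin. Qed.

Let nu_sigma_additive : semi_sigma_additive nu.
Proof.
move=> /= F mF tF mUF; rewrite /density_measure ge0_integral_bigcup//.
- apply: is_cvg_ereal_nneg_natsum_cond => n _ _.
  by apply: integral_ge0 => x _; rewrite lee_fin.
- by apply/measurable_EFinP; exact: measurable_funTS.
- by move=> x _; rewrite lee_fin.
Qed.

HB.instance Definition _ := isMeasure.Build _ _ _ nu nu0 nu_ge0 nu_sigma_additive.

End density_measure.

Section substitution.
Context {R : realType}.
Local Notation leb := (@lebesgue_measure R).

(** The image under [psi] of Lebesgue measure on [E] has density [dphi]: by the fundamental theorem
    of calculus both measures give [phi b - phi a] to []a, b]], and these intervals determine a
    measure. *)
Lemma ge0_integral_substitution (phi dphi psi : R -> R) (E : set R)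
    (f : R -> \bar R) :
  (forall x : R, is_derive x (1 : R) phi (dphi x)) ->
  continuous dphi -> (forall x, 0 < dphi x) -> measurable E ->
  measurable_fun setT psi -> cancel phi psi -> {in E, cancel psi phi} ->
  (forall x, E (phi x)) -> measurable_fun setT f -> (forall x, 0 <= f x)%E ->
  (\int[leb]_(y in E) f y = \int[leb]_x (f (phi x) * (dphi x)%:E))%E.
Proof.
move=> dphiP cdphi dphi_gt0 mE mpsi phiK psiK Ephi mf f0.
have dphi0 x : 0 <= dphi x by exact: ltW.
have cphi : continuous phi.
  move=> x; apply: differentiable_continuous; apply/derivable1_diffP.
  by have /@ex_derive := dphiP x.
have incr : {homo phi : x y / x < y}.
  move=> x y xy; apply: (@gtr0_derive1_lt_cc _ phi x y) => //.
  - by move=> z _; rewrite derive1E; have /@derive_val -> := dphiP z.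
  - exact: continuous_subspaceT.
  - by rewrite in_itv/= lexx ltW.
  - by rewrite in_itv/= lexx ltW.
have le_phi : {mono phi : x y / x <= y} by exact: le_mono.
have mdphi : measurable_fun setT dphi by exact: continuous_measurable_fun.
have mphi : measurable_fun setT phi by exact: continuous_measurable_fun.
pose psiR : R -> measurableTypeR R := psi.
pose nu := pushforward (mrestr leb mE) psiR.
have mrestrE A : measurable A ->
    mrestr leb mE A = (\int[leb]_(x in A) (\1_E x)%:E)%E.
  by move=> mA; rewrite integral_indic// setIC.
have nuE A : measurable A -> nu A = (\int[leb]_(x in A) (dphi x)%:E)%E.
  pose g k : set R := `](- k%:R), k%:R]%classic.
  have FTC a b : a < b ->
      (\int[leb]_(x in `]a, b]) (dphi x)%:E)%E = (phi b - phi a)%:E.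
    move=> ab; rewrite integral_itv_obnd_cbnd; last first.
      by apply/measurable_EFinP; exact: measurable_funTS.
    rewrite (@continuous_FTC2 _ dphi phi)//.
    - exact: continuous_subspaceT.
    - split.
      + by move=> x _; have /@ex_derive := dphiP x.
      + exact/cvg_at_right_filter/cphi.
      + exact/cvg_at_left_filter/cphi.
    - by move=> x _; rewrite derive1E; have /@derive_val := dphiP x.
  have nuoc a b : a < b -> nu `]a, b]%classic = (phi b - phi a)%:E.
    move=> ab; rewrite /nu /pushforward /mrestr.
    rewrite (_ : _ `&` _ = `]phi a, phi b]%classic); last first.
      apply/seteqP; split=> y /=; rewrite !in_itv/=.
        move=> [/andP[ay yb] Ey]; have <- := psiK y (mem_set Ey).
        by rewrite le_phi yb andbT incr.
      move=> /andP[ay yb].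
      (* Such a [y] is a value of [phi], hence belongs to [E]. *)
      have [|x _ xy] := @IVT _ phi a b y (ltW ab) (continuous_subspaceT cphi).
        by rewrite minEle maxEle le_phi (ltW ab) (ltW ay) yb.
      split; last by rewrite -xy.
      by rewrite -xy /psiR phiK -(leW_mono le_phi) -(le_phi x) xy ay yb.
    by rewrite lebesgue_measure_itv/= lte_fin incr// EFinB.
  move=> mA; rewrite -[RHS]/(density_measure leb mdphi dphi0 A).
  apply: (@measure_unique _ R (measurableTypeR R) (@ocitv R) g _ _ _ _
    (pushforward (mrestr leb mE) psiR) (density_measure leb mdphi dphi0)) => //.
  - exact: ocitvI.
  - by move=> i; exact: is_ocitv.
  - apply/seteqP; split=> // x _; exists (Num.truncn `|x|).+1 => //=.
    have := truncnS_gt `|x|; rewrite ltr_norml => /andP[x1 x2].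
    by rewrite /g/= in_itv/= x1 ltW.
  - move=> _ [[a b] _ <-] /=; have [ab|ba] := ltP a b.
      by transitivity (phi b - phi a)%:E; [exact: nuoc|exact/esym/FTC].
    by rewrite set_itv_ge ?bnd_simp -?leNgt// !measure0.
  - move=> k; rewrite /g; have [ab|ba] := ltP (- k%:R : R) k%:R.
      by rewrite -[X in (X < _)%E]/(nu _) nuoc// ltry.
    by rewrite set_itv_ge ?bnd_simp -?leNgt// measure0.
have mfphi : measurable_fun [set: R] (f \o phi) by exact: measurableT_comp.
have mfpp : measurable_fun [set: R] (f \o phi \o psi).
  exact: measurableT_comp.
(* On [E] the integrand factors through [psi], which turns the left side into an integral against
   the pushforward [nu]. *)
transitivity (\int[mrestr leb mE]_y f (phi (psi y)))%E.
  rewrite (@ge0_integral_density _ (measurableTypeR R) R (mrestr leb mE) leb \1_E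
      _ _ _ mrestrE) //.
  rewrite [LHS]integral_mkcond; apply: eq_integral => y _.
  rewrite patchE indicE; case: ifPn => yE; last by rewrite mule0.
  by rewrite mule1 psiK.
rewrite -(@ge0_integral_pushforward _ _ (measurableTypeR R)
  (measurableTypeR R) R psiR mpsi (mrestr leb mE) setT (f \o phi)); last 3 first.
- by [].
- exact: mfphi.
- by move=> y _ /=.
apply: (@ge0_integral_density _ (measurableTypeR R) R
  (pushforward (mrestr leb mE) psiR) leb dphi _ mdphi dphi0 nuE mfphi).
  exact: mpsi.
by move=> x; exact: f0.
Qed.
End substitution.

Section substitution_instances.
Context {R : realType}.
Local Notation leb := (@lebesgue_measure R).

Lemma measurable_inv : measurable_fun [set: R] (@GRing.inv R).
Proof.
rewrite -(setvU [set 0 : R]); apply/measurable_funU => //.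
  exact: measurableC.
split; last by apply: measurable_fun_set1.
apply: open_continuous_measurable_fun.
  by apply: closed_openC; exact: closed_eq.
by move=> x /[!inE] x0; apply: inv_continuous; apply/eqP.
Qed.

Lemma measurable_sqrt : measurable_fun [set: R] (@Num.sqrt R).
Proof. by apply: continuous_measurable_fun => x; exact: sqrt_continuous. Qed.

Lemma ge0_integral_opp (f : R -> \bar R) :
  measurable_fun setT f -> (forall x, 0 <= f x)%E ->
  (\int[leb]_x f x = \int[leb]_x f (- x)%R)%E.
Proof.
move=> mf f0; pose oppR : R -> measurableTypeR R := -%R.
have mopp : measurable_fun [set: measurableTypeR R] oppR by exact: oppr_measurable.
rewrite -[RHS](@ge0_integral_pushforward _ _ (measurableTypeR R)
  (measurableTypeR R) R oppR mopp leb setT f) //.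
by apply: eq_measure_integral => A mA _; rewrite [RHS]lebesgue_measureN.
Qed.

Lemma ge0_integral_affine (a b : R) (f : R -> \bar R) : a != 0 ->
  measurable_fun setT f -> (forall x, 0 <= f x)%E ->
  (\int[leb]_x f x = \int[leb]_x (f (a * x + b)%R * `|a|%:E))%E.
Proof.
move=> a0 mf f0.
have pos c (g : R -> \bar R) : 0 < c -> measurable_fun setT g ->
    (forall x, 0 <= g x)%E ->
    (\int[leb]_x g x = \int[leb]_x (g (c * x + b)%R * c%:E))%E.
  move=> c0 mg g0.
  apply: (@ge0_integral_substitution _ (fun x => c * x + b) (fun=> c) (fun y => (y - b) / c)) => //.
  - by move=> x; apply: is_derive_eq; rewrite /= addr0 [_%:A]mulr1.
  - by move=> x; exact: cst_continuous.
  - by apply: measurable_funM => //; exact: measurable_funB.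
  - by move=> x; rewrite addrK mulrC mulKf// gt_eqF.
  - by move=> x _; rewrite mulrC divfK ?subrK// gt_eqF.
have [a_gt0|a_lt0|/eqP] := ltgtP a 0; last by rewrite (negbTE a0).
  rewrite ltr0_norm// (pos (- a) f) ?oppr_gt0//.
  rewrite [LHS]ge0_integral_opp; last 2 first.
  - apply: emeasurable_funM => //; apply: measurableT_comp => //.
    by apply: measurable_funD => //; exact: measurable_funM.
  - by move=> x; rewrite mule_ge0// lee_fin oppr_ge0 ltW.
  by apply: eq_integral => x _; rewrite mulrNN.
by rewrite gtr0_norm// -pos.
Qed.

Lemma ge0_integral_exp (f : R -> \bar R) :
  measurable_fun setT f -> (forall x, 0 <= f x)%E ->
  (\int[leb]_(y in `]0%R, +oo[) f y = \int[leb]_x (f (expR x) * (expR x)%:E))%E.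
Proof.
move=> mf f0; apply: (@ge0_integral_substitution _ expR expR (@ln R)) => //.
- exact: continuous_expR.
- exact: expR_gt0.
- exact: expRK.
- by move=> x; rewrite inE/= in_itv/= andbT => x0; rewrite lnK.
- by move=> x /=; rewrite in_itv/= expR_gt0.
Qed.

(** On the logarithmic scale this is the affine substitution by the factor [p], so negative
    exponents are covered too; [p = - 2^-1] is needed for the posterior. *)
Lemma ge0_integral_powR (p : R) (f : R -> \bar R) : p != 0 ->
  measurable_fun setT f -> (forall x, 0 <= f x)%E ->
  (\int[leb]_(y in `]0%R, +oo[) f y =
   \int[leb]_(x in `]0%R, +oo[) (f (x `^ p)%R * (`|p| * x `^ (p - 1))%:E))%E.
Proof.
move=> p0 mf f0; rewrite !ge0_integral_exp//; last 2 first.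
- apply: emeasurable_funM; first exact: measurableT_comp.
  by apply/measurable_EFinP/measurable_funM.
- by move=> x; rewrite mule_ge0// lee_fin mulr_ge0// powR_ge0.
rewrite (@ge0_integral_affine p 0)//; last 2 first.
- apply: emeasurable_funM; first exact: measurableT_comp.
  by apply/measurable_EFinP; exact: measurable_expR.
- by move=> x; rewrite mule_ge0// lee_fin expR_ge0.
apply: eq_integral => x _; rewrite addr0.
rewrite /powR gt_eqF ?expR_gt0// expRK -!muleA -!EFinM; congr (_ * _%:E)%E.
rewrite mulrC -mulrA -expRD; congr (_ * expR _); ring.
Qed.

(** Meant for the correlation: the inverse substitution is [rho / sqrt (1 - rho ^+ 2)], and
    [1 - y ^+ 2] becomes [(1 + x ^+ 2)^-1]. *)
Lemma ge0_integral_div_sqrt (f : R -> \bar R) :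
  measurable_fun setT f -> (forall x, 0 <= f x)%E ->
  (\int[leb]_(y in `](-1)%R, 1%R[) f y =
   \int[leb]_x (f (x / Num.sqrt (1 + x ^+ 2))%R *
     (Num.sqrt (1 + x ^+ 2) ^- 3)%:E))%E.
Proof.
move=> mf f0.
have h x : 0 < 1 + x ^+ 2 :> R by rewrite ltr_wpDr// sqr_ge0.
have s0 x : 0 < Num.sqrt (1 + x ^+ 2) :> R by rewrite sqrtr_gt0.
have s2 x : Num.sqrt (1 + x ^+ 2) ^+ 2 = 1 + x ^+ 2 :> R by rewrite sqr_sqrtr// ltW.
have D x : is_derive (x : R) (1 : R) (fun x : R => x / Num.sqrt (1 + x ^+ 2))
    (Num.sqrt (1 + x ^+ 2) ^- 3).
  have sD : is_derive (x : R) (1 : R) (fun x : R => Num.sqrt (1 + x ^+ 2))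
      ((2 * Num.sqrt (1 + x ^+ 2))^-1 * (2 * x)).
    apply: (@is_derive1_comp _ Num.sqrt (fun x => 1 + x ^+ 2)).
      exact: is_derive1_sqrt.
    by apply: is_derive_eq; rewrite /= add0r mul1r [_%:A]mulr1 mulr_natl.
  have iD : is_derive (x : R) (1 : R) (fun x : R => (Num.sqrt (1 + x ^+ 2))^-1)
      (- (Num.sqrt (1 + x ^+ 2)) ^- 2 *
        ((2 * Num.sqrt (1 + x ^+ 2))^-1 * (2 * x))).
    by apply: is_deriveV; rewrite gt_eqF.
  apply: is_derive_eq.
  set s : R := Num.sqrt _; have ss : s ^+ 2 = 1 + x ^+ 2 := s2 x.
  have sN0 : s != 0 by rewrite gt_eqF ?s0.
  transitivity ((s ^+ 2 - x ^+ 2) / s ^+ 3); last by rewrite ss addrK div1r.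
  by rewrite /GRing.scale /=; field.
pose phi x : R := x / Num.sqrt (1 + x ^+ 2).
pose dphi x : R := Num.sqrt (1 + x ^+ 2) ^- 3.
pose psi y : R := y / Num.sqrt (1 - y ^+ 2).
have sq x : phi x ^+ 2 = x ^+ 2 / (1 + x ^+ 2) by rewrite /phi expr_div_n s2.
apply: (@ge0_integral_substitution _ phi dphi psi) => //.
- move=> x; apply: cvgV; first by rewrite gt_eqF// exprn_gt0.
  have c1 : {for x, continuous (@Num.sqrt R \o (fun x => 1 + x ^+ 2))}.
    apply: continuous_comp; last exact: sqrt_continuous.
    by apply: cvgD; [exact: cvg_cst|exact: exprn_continuous].
  exact: (continuous_comp c1 (@exprn_continuous _ 3 _)).
- by move=> x; rewrite invr_gt0 exprn_gt0.
- apply: measurable_funM => //; apply: measurableT_comp; first exact: measurable_inv.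
  apply: measurableT_comp; first exact: measurable_sqrt.
  by apply: measurable_funB => //; exact: exprn_measurable.
- move=> x; rewrite /psi sq.
  have -> : 1 - x ^+ 2 / (1 + x ^+ 2) = (1 + x ^+ 2)^-1.
    by field; rewrite gt_eqF.
  rewrite sqrtrV ?(ltW (h x))// /phi invrK divfK// gt_eqF//.
- move=> y; rewrite inE/= in_itv/= => /andP[y1 y2].
  have y0 : 0 < 1 - y ^+ 2 by nra.
  have e : 1 + psi y ^+ 2 = (1 - y ^+ 2)^-1.
    by rewrite /psi expr_div_n sqr_sqrtr ?ltW//; field; rewrite gt_eqF.
  by rewrite /phi e sqrtrV ?ltW// invrK /psi divfK// gt_eqF// sqrtr_gt0.
- move=> x /=; rewrite in_itv/= -ltr_norml.
  rewrite -(@ltr_pXn2r _ 2)// ?nnegrE// real_normK ?num_real// sq expr1n.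
  by rewrite ltr_pdivrMr// mul1r ltrDr.
Qed.
End substitution_instances.

Section iterated_integrals.
Context {R : realType}.

(* [lebesgue_measure] and [normal_prob] live on [measurableTypeR R], while
   the measurability of their integrands is naturally stated on [R]: the two
   structures have the same measurable sets but distinct displays. *)
Lemma measurable_integral {d} {X : measurableType d}
    (m : {sigma_finite_measure set (measurableTypeR R) -> \bar R})
    (F : X -> R -> \bar R) :
  measurable_fun [set: X * R] (fun p => F p.1 p.2) ->
  (forall x y, 0 <= F x y)%E ->
  measurable_fun [set: X] (fun x => \int[m]_y F x y)%E.
Proof.
move=> mF F0.
exact: (measurable_fun_fubini_tonelli_F (m2 := m) _ mF (fun p : X * R => F0 p.1 p.2)).
Qed.

Lemma integral_swap
    (m1 m2 : {sigma_finite_measure set (measurableTypeR R) -> \bar R})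
    (F : R -> R -> \bar R) :
  measurable_fun [set: R * R] (fun p => F p.1 p.2) ->
  (forall x y, 0 <= F x y)%E ->
  (\int[m1]_x \int[m2]_y F x y = \int[m2]_y \int[m1]_x F x y)%E.
Proof.
move=> mF F0.
exact: (fubini_tonelli (m1 := m1) (m2 := m2) _ mF (fun p : R * R => F0 p.1 p.2)).
Qed.
End iterated_integrals.

(* Hypotheses of the context are tried first: this is how measurability facts
   that are never cited by name get used. *)
Ltac meas := cbn beta; first [assumption |
  match goal with
  | H : measurable_fun _ ?h |- measurable_fun _ (fun x => ?h (@?f x)) =>
      apply: (@measurableT_comp _ _ _ _ _ _ _ _ f H); meas
  | H : measurable_fun _ (fun p => ?h p.1 p.2)
      |- measurable_fun _ (fun x => ?h (@?f x) (@?g x)) =>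
      refine (measurableT_comp H (@measurable_fun_pair _ _ _ _ _ _ f g _ _)); meas
  | H : measurable_fun _ (fun p => ?h p.1.1 p.1.2 p.2)
      |- measurable_fun _ (fun x => ?h (@?f x) (@?g x) (@?k x)) =>
      refine (measurableT_comp H (@measurable_fun_pair _ _ _ _ _ _ _ k
        (@measurable_fun_pair _ _ _ _ _ _ f g _ _) _)); meas
  | H : measurable_fun _ (fun p => ?h p.1.1.1 p.1.1.2 p.1.2 p.2)
      |- measurable_fun _ (fun x => ?h (@?f x) (@?g x) (@?k x) (@?l x)) =>
      refine (measurableT_comp H (@measurable_fun_pair _ _ _ _ _ _ _ l
        (@measurable_fun_pair _ _ _ _ _ _ _ k
          (@measurable_fun_pair _ _ _ _ _ _ f g _ _) _) _)); meas
  end |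
  lazymatch goal with
  | |- measurable_fun _ (fun x => (@?f x, @?g x)) =>
      apply: (@measurable_fun_pair _ _ _ _ _ _ f g); meas
  | |- measurable_fun _ (fun x => (@?f x + @?g x)%R) =>
      apply: (@measurable_funD _ _ _ _ f g); meas
  | |- measurable_fun _ (fun x => (@?f x * @?g x)%R) =>
      apply: (@measurable_funM _ _ _ _ f g); meas
  | |- measurable_fun _ (fun x => (@?f x * @?g x)%E) =>
      apply: (@emeasurable_funM _ _ _ _ f g); meas
  | |- measurable_fun _ (fun x => (- (@?f x))%R) =>
      apply: (@measurable_funN _ _ _ _ f); meas
  | |- measurable_fun _ (fun x => ((@?f x) ^+ _)%R) =>
      apply: (@measurable_funX _ _ _ _ f); meas
  | |- measurable_fun _ (fun x => ((@?f x)^-1)%R) =>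
      apply: (@measurableT_comp _ _ _ _ _ _ _ _ f measurable_inv); meas
  | |- measurable_fun _ (fun x => (Num.sqrt (@?f x))%R) =>
      apply: (@measurableT_comp _ _ _ _ _ _ _ _ f measurable_sqrt); meas
  | |- measurable_fun _ (fun x => expR (@?f x)) =>
      apply: (@measurableT_comp _ _ _ _ _ _ _ _ f (@measurable_expR _)); meas
  | |- measurable_fun _ (fun x => (@?f x `^ _)%R) =>
      apply: (@measurableT_comp _ _ _ _ _ _ _ _ f (@measurable_powR _ _)); meas
  | |- measurable_fun _ (fun x => (@?f x)%:E) =>
      apply/(@measurable_EFinP _ _ _ _ f); meas
  | |- measurable_fun _ (fun x => (@?f x).1) =>
      first [exact: measurable_fst
            |apply: (@measurableT_comp _ _ _ _ _ _ _ _ f measurable_fst); meas]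
  | |- measurable_fun _ (fun x => (@?f x).2) =>
      first [exact: measurable_snd
            |apply: (@measurableT_comp _ _ _ _ _ _ _ _ f measurable_snd); meas]
  | |- measurable_fun _ (fun x => (@?f x < @?g x)%R) =>
      apply: (@measurable_fun_ltr _ _ _ _ f g); meas
  | |- measurable_fun _ (fun x => x) => exact: measurable_id
  | |- measurable_fun _ (fun x => normal_pdf _ _ (@?f x)) =>
      apply: (@measurableT_comp _ _ _ _ _ _ _ _ f (measurable_normal_pdf _ _)); meas
  | |- _ => first [exact: measurable_cst | done
      | apply: measurable_fun_ltr; meas | apply: measurable_fun_ifT; meas | idtac]
  end].

(** * Normal and chi-squared distributions *)

Section standard_normal.
Context {R : realType}.
Local Notation leb := (@lebesgue_measure R).
Local Notation N := (normal_prob (0 : R) 1).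

Lemma ge0_integral_normal (g : R -> \bar R) :
  measurable_fun setT g -> (forall x, 0 <= g x)%E ->
  (\int[N]_x g x = \int[leb]_x (g x * (normal_pdf 0 1 x)%:E))%E.
Proof.
move=> mg g0; apply: (@ge0_integral_density _ (measurableTypeR R)) => //.
- exact: measurable_normal_pdf.
- by move=> x; exact: normal_pdf_ge0.
Qed.

Lemma normal_pdf01E (x : R) :
  normal_pdf 0 1 x = normal_peak 1 * expR (- (x ^+ 2 / 2)).
Proof.
rewrite /normal_pdf oner_eq0 /normal_fun subr0 expr1n.
by rewrite mulNr.
Qed.

Lemma integral_normal_opp (g : R -> \bar R) :
  measurable_fun setT g -> (forall x, 0 <= g x)%E ->
  (\int[N]_x g (- x)%R = \int[N]_x g x)%E.
Proof.
move=> mg g0.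
have mN : measurable_fun [set: R] (fun x => g (- x)%R) by apply: measurableT_comp.
have mp := measurable_normal_pdf (0 : R) 1.
rewrite !ge0_integral_normal// [RHS]ge0_integral_opp.
- by apply: eq_integral => x _; rewrite !normal_pdf01E sqrrN.
- by meas.
- by move=> x; rewrite mule_ge0// lee_fin normal_pdf_ge0.
Qed.

Lemma integral_normal2 (h : R -> R -> \bar R) :
  measurable_fun [set: R * R] (fun p => h p.1 p.2) ->
  (forall x y, 0 <= h x y)%E ->
  (\int[N]_x \int[N]_y h x y = \int[leb]_x \int[leb]_y
     (h x y * (normal_pdf 0 1 x * normal_pdf 0 1 y)%:E))%E.
Proof.
move=> mh h0; have mp := measurable_normal_pdf (0 : R) 1.
have p0 (x : R) := normal_pdf_ge0 0 1 x.
rewrite ge0_integral_normal; last 2 first.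
- exact: measurable_integral.
- by move=> x; exact: integral_ge0.
apply: eq_integral => x _; rewrite ge0_integral_normal//; last first.
  exact: (measurableT_comp mh (pair1_measurable x)).
rewrite -ge0_integralZr//; last 3 first.
- apply: emeasurable_funM; last exact/measurable_EFinP.
  exact: (measurableT_comp mh (pair1_measurable x)).
- by move=> y _; rewrite mule_ge0// lee_fin.
- by rewrite lee_fin.
by apply: eq_integral => y _; rewrite -muleA -EFinM [X in (_ * X%:E)%E]mulrC.
Qed.

(** The rotation is factored into two affine substitutions, one per variable, whose Jacobians
    [|c|^-1] and [|c|] cancel; the product density depends on [x ^+ 2 + y ^+ 2] only. *)
Lemma integral_normal_rotation (c s : R) (h : R -> R -> \bar R) :
  c ^+ 2 + s ^+ 2 = 1 -> measurable_fun [set: R * R] (fun p => h p.1 p.2) ->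
  (forall x y, 0 <= h x y)%E ->
  (\int[N]_x \int[N]_y h (c * x + s * y)%R (c * y - s * x)%R
   = \int[N]_x \int[N]_y h x y)%E.
Proof.
move=> cs1 mh h0; have mp := measurable_normal_pdf (0 : R) 1.
have p0 (x : R) := normal_pdf_ge0 0 1 x.
(* The factorization divides by [c]. A quarter turn is instead an exchange of the variables followed
   by a sign change. *)
have [c0|cN0] := eqVneq c 0.
  rewrite integral_swap; last 2 first.
  - by meas.
  - by [].
  have s2 : s = 1 \/ s = - 1.
    have : s ^+ 2 == 1 by rewrite -cs1 c0 expr0n add0r.
    by rewrite sqrf_eq1 => /orP[]/eqP->; [left|right].
  have opp2 (k : R -> R -> \bar R) : measurable_fun [set: R * R] (fun p => k p.1 p.2) ->
      (forall x y, 0 <= k x y)%E ->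
      (\int[N]_x \int[N]_y k x (- y)%R = \int[N]_x \int[N]_y k x y)%E.
    move=> mk k0; apply: eq_integral => x _; apply: (@integral_normal_opp (k x)) => //.
    exact: (measurableT_comp mk (pair1_measurable x)).
  transitivity (\int[N]_y \int[N]_x h (s * y)%R (- (s * x))%R)%E.
    apply: eq_integral => y _; apply: eq_integral => x _.
    by rewrite c0 !mul0r add0r sub0r.
  case: s2 => ->.
    rewrite -(opp2 h mh h0); apply: eq_integral => y _.
    by apply: eq_integral => x _; rewrite !mul1r.
  transitivity (\int[N]_y \int[N]_x h (- y)%R x)%E.
    apply: eq_integral => y _; apply: eq_integral => x _.
    by rewrite !mulN1r opprK.
  rewrite (@integral_normal_opp (fun x => \int[N]_y h x y)%E)//.
  - exact: measurable_integral.
  - by move=> x; exact: integral_ge0.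
have mh' : measurable_fun [set: R * R]
    (fun p => h (c * p.1 + s * p.2) (c * p.2 - s * p.1)) by meas.
rewrite (integral_normal2 mh h0).
rewrite (@integral_normal2 (fun x y => h (c * x + s * y) (c * y - s * x)) mh');
  last by [].
rewrite integral_swap; last 2 first.
- by meas.
- by move=> x y; rewrite mule_ge0// lee_fin mulr_ge0.
transitivity (\int[leb]_y \int[leb]_x (h x ((y - s * x) / c)%R *
    (normal_pdf 0 1 ((x - s * y) / c) * normal_pdf 0 1 y * `|c|^-1)%:E))%E.
  apply: eq_integral => y _.
  rewrite [LHS](@ge0_integral_affine _ c^-1 (- (s * y / c))); last 3 first.
  - by rewrite invr_eq0.
  - by meas.
  - by move=> x; rewrite mule_ge0// lee_fin mulr_ge0.
  apply: eq_integral => x _; rewrite -muleA -EFinM normfV.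
  have -> : c^-1 * x - s * y / c = (x - s * y) / c by field.
  have -> : c * ((x - s * y) / c) + s * y = x by field.
  congr (h x _ * _)%E.
  transitivity (((c ^+ 2 + s ^+ 2) * y - s * x) / c); first by field.
  by rewrite cs1 mul1r.
rewrite integral_swap; last 2 first.
- by meas.
- by move=> x y; rewrite mule_ge0// lee_fin !mulr_ge0 ?invr_ge0.
apply: eq_integral => x _.
rewrite [LHS](@ge0_integral_affine _ c (s * x)); last 3 first.
- by [].
- by meas.
- by move=> y; rewrite mule_ge0// lee_fin !mulr_ge0 ?invr_ge0.
apply: eq_integral => y _; rewrite -muleA -EFinM.
have -> : (c * y + s * x - s * x) / c = y by field.
congr (_ * _%:E)%E; rewrite mulfVK ?normr_eq0//.
have -> : (x - s * (c * y + s * x)) / c = c * x - s * y.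
  transitivity (((c ^+ 2 + s ^+ 2) * x - s * (c * y + s * x)) / c).
    by rewrite cs1 mul1r.
  by field.
rewrite !normal_pdf01E; set k := normal_peak 1.
rewrite mulrACA [RHS]mulrACA -!expRD; congr (_ * expR _).
transitivity (- ((c ^+ 2 + s ^+ 2) * (x ^+ 2 + y ^+ 2) / 2)); first by field.
by rewrite cs1; field.
Qed.

Lemma integral_normal_cst (r : \bar R) : (0 <= r)%E -> (\int[N]_x r = r)%E.
Proof. move=> r0; rewrite integral_cst//.
by rewrite [X in (_ * X)%E](@probability_setT _ (measurableTypeR R) R N) mule1. Qed.

(* [int_sumsq m g] is the expectation of [g (Z_1 ^+ 2 + ... + Z_m ^+ 2)] and
   [int_gram m f] that of [f (\sum Z_j ^+ 2) (\sum Z_j * Z'_j) (\sum Z'_j ^+ 2)]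
   for independent standard normal variables [Z_j], [Z'_j], [1 <= j <= m]. *)
Fixpoint int_sumsq (m : nat) (g : R -> \bar R) : \bar R :=
  if m is m'.+1 then \int[N]_w int_sumsq m' (fun s => g (s + w ^+ 2)%R) else g 0.

Fixpoint int_gram (m : nat) (f : R -> R -> R -> \bar R) : \bar R :=
  if m is m'.+1 then
    \int[N]_w \int[N]_z
      int_gram m' (fun a b c => f (a + w ^+ 2) (b + w * z) (c + z ^+ 2))%R
  else f 0 0 0.

Lemma int_sumsq_ge0 m (g : R -> \bar R) :
  (forall x, 0 <= g x)%E -> (0 <= int_sumsq m g)%E.
Proof.
by elim: m g => [|m IH] g g0 //=; apply: integral_ge0 => w _; exact: IH.
Qed.

Lemma int_gram_ge0 m (f : R -> R -> R -> \bar R) :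
  (forall x y z, 0 <= f x y z)%E -> (0 <= int_gram m f)%E.
Proof.
elim: m f => [|m IH] f f0 //=.
by do 2 (apply: integral_ge0 => ? _); exact: IH.
Qed.

(** Sums of squares are nonnegative, so agreement there is enough; this permits
    [Num.sqrt s ^+ 2 = s] under the integral. *)
Lemma eq_int_sumsq m (g1 g2 : R -> \bar R) :
  (forall s, 0 <= s -> g1 s = g2 s) -> int_sumsq m g1 = int_sumsq m g2.
Proof.
elim: m g1 g2 => [|m IH] g1 g2 g12 /=; first exact: g12.
apply: eq_integral => w _; apply: IH => s s0.
by apply: g12; rewrite addr_ge0 ?sqr_ge0.
Qed.

Lemma eq_int_gram m (f1 f2 : R -> R -> R -> \bar R) :
  (forall a b c, f1 a b c = f2 a b c) -> int_gram m f1 = int_gram m f2.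
Proof.
move=> f12; congr int_gram; do 3 (apply/funext => ?); exact: f12.
Qed.

(** The parameter space is arbitrary because the induction adjoins each bound variable to it. *)
Lemma measurable_int_sumsq m {d} {X : measurableType d} (F : X -> R -> \bar R) :
  measurable_fun [set: X * R] (fun p => F p.1 p.2) ->
  (forall x y, 0 <= F x y)%E ->
  measurable_fun [set: X] (fun x => int_sumsq m (F x)).
Proof.
elim: m d X F => [|m IH] d X F mF F0 /=; first by meas.
apply: (@measurable_integral R _ X N
  (fun x w => int_sumsq m (fun s => F x (s + w ^+ 2)))).
  apply: (IH _ (X * R)%type (fun p s => F p.1 (s + p.2 ^+ 2))) => //.
  by meas.
by move=> x w; exact: int_sumsq_ge0.
Qed.

Lemma int_sumsq_swap m
    (mu : {sigma_finite_measure set (measurableTypeR R) -> \bar R})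
    (F : R -> R -> \bar R) :
  measurable_fun [set: R * R] (fun p => F p.1 p.2) ->
  (forall x y, 0 <= F x y)%E ->
  (\int[mu]_x int_sumsq m (F x) = int_sumsq m (fun s => \int[mu]_x F x s))%E.
Proof.
elim: m F => [|m IH] F mF F0 //=.
rewrite integral_swap; last 2 first.
- apply: (@measurable_int_sumsq m _ (R * R)%type (fun p s => F p.1 (s + p.2 ^+ 2))) => //.
  by meas.
- by move=> x w; exact: int_sumsq_ge0.
apply: eq_integral => w _; rewrite IH//.
by meas.
Qed.

Lemma int_sumsq_cst m (r : \bar R) : (0 <= r)%E -> int_sumsq m (fun=> r) = r.
Proof.
move=> r0; elim: m => [|m IH] //=.
by under eq_integral do rewrite IH; exact: integral_normal_cst.
Qed.
End standard_normal.

(** * Cholesky form of the Gram matrix of normal pairs *)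

Section gram.
Context {R : realType}.
Local Notation N := (normal_prob (0 : R) 1).
Local Notation int_sumsq := (@int_sumsq R).
Local Notation int_gram := (@int_gram R).

(** Polar coordinates; at [r = 0] any unit vector serves, so the rotation in [int_gramE] exists even
    when the vector to be rotated vanishes. *)
Lemma unit_vector (a b r : R) : 0 <= r -> a ^+ 2 + b ^+ 2 = r ^+ 2 ->
  exists c s, [/\ c ^+ 2 + s ^+ 2 = 1, a = r * c & b = r * s].
Proof.
rewrite le_eqVlt => /predU1P[<-|r0 abr].
  rewrite expr0n => /eqP; rewrite paddr_eq0 ?sqr_ge0// !sqrf_eq0.
  move=> /andP[/eqP-> /eqP->]; exists 1, 0.
  by rewrite expr1n expr0n addr0 !mul0r.
have rN0 : r != 0 by rewrite gt_eqF.
exists (a / r), (b / r); split; last 2 first.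
- by field.
- by field.
by rewrite !expr_div_n -mulrDl abr divff// expf_neq0.
Qed.

(** Given the vector of the first coordinates, of squared length [x], rotation invariance lets the
    second vector be written in an orthonormal basis starting along the first: [v] is its coordinate
    in that direction and [s] the squared length of the rest. The induction builds this basis one
    plane rotation at a time. *)
Lemma int_gramE m (f : R -> R -> R -> \bar R) :
  measurable_fun [set: R * R * R] (fun p => f p.1.1 p.1.2 p.2) ->
  (forall x y z, 0 <= f x y z)%E ->
  int_gram m.+1 f = int_sumsq m.+1 (fun x =>
    \int[N]_v int_sumsq m (fun s => f x (v * Num.sqrt x) (v ^+ 2 + s))%R)%E.
Proof.
elim: m f => [|m IH] f mf f0.
  rewrite /=; apply: eq_integral => w _; rewrite !add0r sqrtr_sqr.
  (* [Num.sqrt (w ^+ 2)] is the absolute value of [w]; a negative sign is absorbed by reflecting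
     [z]. *)
  have [w0|w0] := leP 0 w.
    apply: eq_integral => z _; rewrite add0r addr0 add0r ger0_norm//.
    by rewrite mulrC.
  rewrite -(@integral_normal_opp _ (fun z => f (w ^+ 2) (0 + w * z) (0 + z ^+ 2))).
  - apply: eq_integral => z _.
    by rewrite !add0r sqrrN addr0 ltr0_norm//; congr (f _ _ _); ring.
  - by meas.
  - by [].
pose G y := (\int[N]_v int_sumsq m.+1 (fun s => f y (v * Num.sqrt y) (v ^+ 2 + s))%R)%E.
rewrite -[RHS]/(\int[N]_w int_sumsq m.+1 (fun s => G (s + w ^+ 2)%R))%E.
rewrite -[LHS]/(\int[N]_w \int[N]_z
      int_gram m.+1 (fun a b c => f (a + w ^+ 2) (b + w * z) (c + z ^+ 2))%R)%E.
apply: eq_integral => w _.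
pose K z x := (\int[N]_v int_sumsq m (fun s =>
  f (x + w ^+ 2) (v * Num.sqrt x + w * z) (v ^+ 2 + s + z ^+ 2))%R)%E.
transitivity (\int[N]_z int_sumsq m.+1 (K z))%E.
  apply: eq_integral => z _; rewrite IH//.
  by meas.
rewrite int_sumsq_swap; last 2 first.
- apply: (@measurable_integral R _ (R * R)%type N (fun p v => int_sumsq m (fun s =>
    f (p.2 + w ^+ 2) (v * Num.sqrt p.2 + w * p.1) (v ^+ 2 + s + p.1 ^+ 2)))).
    apply: (@measurable_int_sumsq R m _ (R * R * R)%type (fun p s =>
      f (p.1.2 + w ^+ 2) (p.2 * Num.sqrt p.1.2 + w * p.1.1)
        (p.2 ^+ 2 + s + p.1.1 ^+ 2))) => //.
    by meas.
  by move=> p v; exact: int_sumsq_ge0.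
- by move=> z x; apply: integral_ge0 => v _; exact: int_sumsq_ge0.
apply: eq_int_sumsq => x x0; rewrite /K /G.
set y := x + w ^+ 2; have y0 : 0 <= y by rewrite addr_ge0 ?sqr_ge0.
(* The rotation takes [(sqrt x, w)] to [(sqrt y, 0)], so that [v * sqrt x + w * z] becomes [sqrt y]
   times the first rotated coordinate of [(v, z)]. *)
have [|c [s [cs1 xE wE]]] := @unit_vector (Num.sqrt x) w (Num.sqrt y) (sqrtr_ge0 _).
  by rewrite !sqr_sqrtr.
pose H p r := int_sumsq m (fun s => f y (Num.sqrt y * p) (p ^+ 2 + r ^+ 2 + s)).
have mH : measurable_fun [set: R * R] (fun p => H p.1 p.2).
  apply: (@measurable_int_sumsq R m _ (R * R)%type (fun p s =>
    f y (Num.sqrt y * p.1) (p.1 ^+ 2 + p.2 ^+ 2 + s))) => //.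
  by meas.
have H0 p r : (0 <= H p r)%E by exact: int_sumsq_ge0.
transitivity (\int[N]_z \int[N]_v H (c * v + s * z)%R (c * z - s * v)%R)%E.
  apply: eq_integral => z _; apply: eq_integral => v _.
  apply: eq_int_sumsq => t _; congr (f y _ _).
    by rewrite xE wE; ring.
  transitivity ((c ^+ 2 + s ^+ 2) * (v ^+ 2 + z ^+ 2) + t); last by ring.
  by rewrite cs1; ring.
rewrite integral_swap; last 2 first.
- by meas.
- by [].
rewrite (integral_normal_rotation cs1 mH H0).
apply: eq_integral => v _; apply: eq_integral => r _.
apply: eq_int_sumsq => t _; congr (f y _ _); first by rewrite mulrC.
by rewrite -addrA [_ + t]addrC.
Qed.

End gram.

(** * Chi-squared kernels and sums of squares *)

Section chi2_law.
Context {R : realType}.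
Local Notation leb := (@lebesgue_measure R).
Local Notation N := (normal_prob (0 : R) 1).

Lemma powR_expR (x a : R) : 0 < x -> x `^ a = expR (a * ln x).
Proof. by move=> x0; rewrite /powR gt_eqF. Qed.

(** The chi-squared density without its normalizing constant, which is always recovered from a total
    mass. *)
Definition chi2_ker (m x : R) : R :=
  if 0 < x then x `^ (m / 2 - 1) * expR (- (2^-1 * x)) else 0.

Lemma chi2_ker_ge0 m x : 0 <= chi2_ker m x.
Proof.
by rewrite /chi2_ker; case: ifP => // _; rewrite mulr_ge0 ?powR_ge0 ?expR_ge0.
Qed.

Lemma measurable_chi2_ker m : measurable_fun [set: R] (chi2_ker m).
Proof. by rewrite /chi2_ker; meas. Qed.

Lemma integral_chi2_ker (m : R) (g : R -> \bar R) :
  (\int[leb]_x (g x * (chi2_ker m x)%:E) =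
   \int[leb]_(x in `]0%R, +oo[)
     (g x * (x `^ (m / 2 - 1) * expR (- (2^-1 * x)))%:E))%E.
Proof.
rewrite [RHS]integral_mkcond; apply: eq_integral => x _.
rewrite patchE /chi2_ker mem_setE in_itv/= andbT.
by case: ifP => // _; rewrite mule0.
Qed.

Lemma ge0_integral_even (f : R -> \bar R) :
  measurable_fun setT f -> (forall x, 0 <= f x)%E -> (forall x, f (- x) = f x) ->
  (\int[leb]_x f x = 2%:E * \int[leb]_(x in `]0%R, +oo[) f x)%E.
Proof.
move=> mf f0 fN.
have -> : [set: measurableTypeR R] = `]-oo, 0%R] `|` `]0%R, +oo[.
  apply/seteqP; split=> // x _ /=; rewrite !in_itv/= andbT.
  by have [x0|x0] := leP x 0; [left|right].
rewrite ge0_integral_setU; last 5 first.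
- exact: measurable_itv.
- exact: measurable_itv.
- exact: measurable_funTS.
- by [].
- apply/disj_set2P; rewrite -subset0 => x []/=; rewrite !in_itv/= andbT.
  by rewrite leNgt => /negP.
rewrite -[2]/(1 + 1 :> R) EFinD ge0_muleDl// !mul1e; congr (_ + _)%E.
transitivity (\int[leb]_(x in `]-oo, 0%R]) f (- x)%R)%E.
  by apply: eq_integral => x _; rewrite fN.
rewrite -ge0_integration_by_substitution0// -integral_itv_obnd_cbnd//.
exact: measurable_funTS.
Qed.

(** Substitution [x = w ^+ 2]: the Jacobian [2 * w] against [x ^ (- 1/2)] leaves the factor [2] that
    evenness contributes on the other side. *)
Lemma int_sumsq1 (g : R -> \bar R) :
  measurable_fun setT g -> (forall x, 0 <= g x)%E ->
  (int_sumsq 1 g = (normal_peak 1)%:E * \int[leb]_x (g x * (chi2_ker 1 x)%:E))%E.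
Proof.
move=> mg g0; rewrite integral_chi2_ker.
have peak0 : 0 <= normal_peak 1 :> R by exact: normal_peak_ge0.
pose k (x : R) : R := x `^ (1 / 2 - 1) * expR (- (2^-1 * x)).
have mk : measurable_fun [set: R] k by rewrite /k; meas.
have k0 x : 0 <= k x by rewrite mulr_ge0 ?powR_ge0 ?expR_ge0.
rewrite (@ge0_integral_powR _ 2 (fun x => g x * (k x)%:E)%E); last 3 first.
- by [].
- by meas.
- by move=> x; rewrite mule_ge0// lee_fin.
transitivity (\int[leb]_w (g (w ^+ 2)%R * (normal_pdf 0 1 w)%:E))%E.
  rewrite /= ge0_integral_normal; last 2 first.
  - by meas.
  - by [].
  by apply: eq_integral => w _; rewrite add0r.
rewrite ge0_integral_even; last 3 first.
- by have mp := measurable_normal_pdf (0 : R) 1; meas.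
- by move=> x; rewrite mule_ge0// lee_fin normal_pdf_ge0.
- by move=> x; rewrite !normal_pdf01E sqrrN.
have mp := measurable_normal_pdf (0 : R) 1.
have m1 : measurable_fun [set: R]
  (fun w => g (w ^+ 2)%R * (normal_pdf 0 1 w)%:E)%E by meas.
have m2 : measurable_fun [set: R]
  (fun w => g (w `^ 2)%R * (k (w `^ 2))%:E * (`|2| * w `^ (2 - 1))%:E)%E by meas.
rewrite -!ge0_integralZl//; last 4 first.
- exact: measurable_funTS m2.
- by move=> x _; rewrite !mule_ge0// lee_fin// mulr_ge0 ?powR_ge0.
- exact: measurable_funTS m1.
- by move=> x _; rewrite mule_ge0// lee_fin normal_pdf_ge0.
apply: eq_integral => w; rewrite inE/= in_itv/= andbT => w0.
rewrite /k powR_mulrn ?(ltW w0)// normal_pdf01E muleCA -EFinM.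
rewrite -[X in _ = (_ * X)%E]muleA [RHS]muleCA -!EFinM; congr (_ * _%:E)%E.
have w20 : 0 < w ^+ 2 by rewrite exprn_gt0.
rewrite !powR_expR// lnXn// ger0_norm// mulrCA; congr (_ * _).
rewrite [RHS]mulrCA -!expRD; congr (_ * expR _).
by rewrite -mulr_natl; field.
Qed.

(** The scaling [w = sqrt t * v] separates the variables in the convolution of [chi2_ker m] with the
    law of a squared normal; what depends on [v] is a beta integrand. *)
Lemma chi2_ker_scale (m t v : R) : 0 < t ->
  Num.sqrt t * (chi2_ker m (t - (Num.sqrt t * v) ^+ 2) *
    normal_pdf 0 1 (Num.sqrt t * v)) =
  normal_peak 1 * (if 0 < 1 - v ^+ 2 then (1 - v ^+ 2) `^ (m / 2 - 1) else 0) *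
    chi2_ker (m + 1) t.
Proof.
move=> t0; rewrite exprMn sqr_sqrtr ?(ltW t0)//.
have -> : t - t * v ^+ 2 = t * (1 - v ^+ 2) by ring.
rewrite /chi2_ker pmulr_rgt0// t0; case: ifPn => [v1|_]; last first.
  by rewrite mul0r !mulr0 mul0r.
rewrite normal_pdf01E exprMn sqr_sqrtr ?(ltW t0)//.
have -> : Num.sqrt t = expR (ln t / 2).
  by rewrite -powR12_sqrt ?(ltW t0)// powR_expR// mulrC.
rewrite !powR_expR ?mulr_gt0// lnM ?posrE//.
set P := normal_peak 1; set u := ln (1 - _); set w := ln t.
transitivity (P * (expR (w / 2) * expR ((m / 2 - 1) * (w + u)) *
  expR (- (2^-1 * (t * (1 - v ^+ 2)))) * expR (- (t * v ^+ 2 / 2)))); first by ring.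
rewrite -[RHS]mulrA -!expRD; congr (_ * expR _); by field.
Qed.

(** [K] is a product of unevaluated beta integrals. It is left in [\bar R], and its finiteness comes
    out only in [integral_chi2_sumsq]. *)
Lemma int_sumsqE m : exists2 K : \bar R, (0 <= K)%E &
  forall g : R -> \bar R, measurable_fun setT g -> (forall x, 0 <= g x)%E ->
  (int_sumsq m.+1 g = K * \int[leb]_x (g x * (chi2_ker m.+1%:R x)%:E))%E.
Proof.
elim: m => [|m [K K0 IH]].
  exists (normal_peak 1)%:E; first by rewrite lee_fin normal_peak_ge0.
  by move=> g mg g0; rewrite int_sumsq1.
pose b (v : R) : R := normal_peak 1 *
  (if 0 < 1 - v ^+ 2 then (1 - v ^+ 2) `^ (m.+1%:R / 2 - 1) else 0).
have b0 v : 0 <= b v.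
  rewrite mulr_ge0 ?normal_peak_ge0//; case: ifP => // _; exact: powR_ge0.
have mb : measurable_fun [set: R] b by rewrite /b; meas.
have mk : measurable_fun [set: R] (chi2_ker m.+1%:R) by exact: measurable_chi2_ker.
have mk2 : measurable_fun [set: R] (chi2_ker m.+2%:R) by exact: measurable_chi2_ker.
have mp := measurable_normal_pdf (0 : R) 1.
have k0 := chi2_ker_ge0.
have p0 (x : R) := normal_pdf_ge0 0 1 x.
exists (K * \int[leb]_v (b v)%:E)%E.
  by rewrite mule_ge0// integral_ge0// => v _; rewrite lee_fin.
move=> g mg g0.
have mgk : measurable_fun [set: R * R]
   (fun p => g p.2 * (chi2_ker m.+1%:R (p.2 - p.1 ^+ 2))%:E)%E by meas.
(* The last coordinate [w] is held fixed, and [t] is the whole sum of squares including [w ^+ 2]. *)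
transitivity (\int[N]_w (K * \int[leb]_t
    (g t * (chi2_ker m.+1%:R (t - w ^+ 2)%R)%:E)))%E.
  rewrite -[LHS]/(\int[N]_w int_sumsq m.+1 (fun s => g (s + w ^+ 2)%R))%E.
  apply: eq_integral => w _; rewrite (IH (fun s => g (s + w ^+ 2)%R)); last 2 first.
  - by meas.
  - by move=> s; exact: g0.
  congr (_ * _)%E.
  rewrite [LHS](@ge0_integral_affine _ 1 (- w ^+ 2)); last 3 first.
  - exact: oner_neq0.
  - by meas.
  - by move=> x; rewrite mule_ge0// lee_fin.
  by apply: eq_integral => t _; rewrite normr1 mule1 mul1r subrK.
rewrite [LHS]ge0_integralZl; last 4 first.
- by [].
- apply: (@measurable_integral R _ R leb
    (fun w t => g t * (chi2_ker m.+1%:R (t - w ^+ 2)%R)%:E)%E) => // w t.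
  by rewrite mule_ge0// lee_fin.
- by move=> w _; apply: integral_ge0 => t _; rewrite mule_ge0// lee_fin.
- by [].
rewrite -[RHS]muleA; congr (_ * _)%E.
rewrite integral_swap; last 2 first.
- exact: mgk.
- by move=> w t; rewrite mule_ge0// lee_fin.
rewrite -[RHS]ge0_integralZl; last 4 first.
- by [].
- by meas.
- by move=> x _; rewrite mule_ge0// lee_fin.
- by apply: integral_ge0 => v _; rewrite lee_fin.
apply: eq_integral => t _.
rewrite ge0_integralZl; last 4 first.
- by [].
- by meas.
- by move=> w _; rewrite lee_fin.
- by [].
rewrite [RHS]muleCA; congr (_ * _)%E.
rewrite ge0_integral_normal; last 2 first.
- by meas.
- by move=> w; rewrite lee_fin.
have [t0|t0] := ltP 0 t; last first.
  rewrite [in RHS]/chi2_ker ltNge t0 mule0 integral0_eq// => w _.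
  by rewrite /chi2_ker ltNge subr_le0 (le_trans t0) ?sqr_ge0// mul0e.
rewrite [LHS](@ge0_integral_affine _ (Num.sqrt t) 0); last 3 first.
- by rewrite gt_eqF// sqrtr_gt0.
- by meas.
- by move=> w; rewrite mule_ge0// lee_fin.
rewrite -ge0_integralZr; last 4 first.
- by [].
- by meas.
- by move=> v _; rewrite lee_fin.
- by rewrite lee_fin.
apply: eq_integral => v _; rewrite addr0 ger0_norm ?sqrtr_ge0// -!EFinM.
congr (_%:E); rewrite mulrC chi2_ker_scale//.
by rewrite natr1.
Qed.
End chi2_law.

(** * Recurrence for the kernel integrals *)

Section chi2_moments.
Context {R : realType}.
Local Notation leb := (@lebesgue_measure R).

(** With [y = expR (- t / 2)] the tail becomes twice the length of []0, expR (- x / 2)[], so no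
    improper limit is taken. *)
Lemma integral_exp_tail (x : R) :
  (\int[leb]_t ((if x < t then expR (- (2^-1 * t)) else 0)%:E) =
   (2 * expR (- (2^-1 * x)))%:E)%E.
Proof.
pose c := expR (- (2^-1 * x)); have c0 : 0 < c by exact: expR_gt0.
have mif (a : R) : measurable_fun [set: R] (fun t : R => if t < a then 1 else 0 : R).
  by meas.
have -> : (2 * c)%:E = (2%:E * \int[leb]_(y in `]0%R, +oo[) (if y < c then 1 else 0)%:E)%E.
  rewrite EFinM; congr (_ * _)%E.
  rewrite [RHS]integral_mkcond.
  transitivity (\int[leb]_y (\1_(`]0%R, c[%classic : set R) y)%:E)%E.
    rewrite integral_indic// setIT.
    by have := lebesgue_measure_itv `]0%R, c[; rewrite /= lte_fin c0 oppr0 adde0.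
  apply: eq_integral => y _; rewrite patchE indicE !mem_setE !in_itv/= andbT.
  by case: (0 < y) => //=; case: (y < c).
rewrite ge0_integral_exp; last 2 first.
- exact/measurable_EFinP.
- by move=> y; rewrite lee_fin; case: ifP.
rewrite [X in (_ * X)%E](@ge0_integral_affine _ (- 2^-1) 0); last 3 first.
- by rewrite oppr_eq0 invr_eq0.
- by apply: emeasurable_funM; meas.
- by move=> y; rewrite mule_ge0// lee_fin ?expR_ge0//; case: ifP.
rewrite -ge0_integralZl//; last 2 first.
- by apply: emeasurable_funM; meas.
- by move=> y _; rewrite !mule_ge0// lee_fin ?expR_ge0//; case: ifP.
apply: eq_integral => t _; rewrite addr0 mulNr /c ltr_expR ltrN2 ltr_pM2l//.
case: ifP => _; last by rewrite !mul0e mule0.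
by rewrite mul1e normrN ger0_norm// -!EFinM; congr (_%:E); field.
Qed.

(** With [y = x ^ s] this is the length of []0, t ^ s[] divided by [s]. *)
Lemma integral_powR_lt (s t : R) : 0 < s -> 0 < t ->
  (\int[leb]_x ((if 0 < x < t then x `^ (s - 1) else 0)%:E) = (t `^ s / s)%:E)%E.
Proof.
move=> s0 t0.
have mif (a : R) : measurable_fun [set: R] (fun t : R => if t < a then 1 else 0 : R).
  by meas.
have -> : (t `^ s / s)%:E =
    (s^-1%:E * \int[leb]_(y in `]0%R, +oo[) (if y < t `^ s then 1 else 0)%:E)%E.
  rewrite mulrC EFinM; congr (_ * _)%E.
  rewrite [RHS]integral_mkcond.
  transitivity (\int[leb]_y (\1_(`]0%R, t `^ s[%classic : set R) y)%:E)%E.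
    rewrite integral_indic// setIT.
    have := lebesgue_measure_itv `]0%R, t `^ s[.
    by rewrite /= lte_fin powR_gt0// oppr0 adde0.
  apply: eq_integral => y _; rewrite patchE indicE !mem_setE !in_itv/= andbT.
  by case: (0 < y) => //=; case: (y < _).
rewrite (@ge0_integral_powR _ s); last 3 first.
- by rewrite gt_eqF.
- exact/measurable_EFinP.
- by move=> y; rewrite lee_fin; case: ifP.
have mF : measurable_fun [set: R] (fun x => (if x `^ s < t `^ s then 1 else 0)%:E *
    (`|s| * x `^ (s - 1))%:E)%E by meas.
rewrite -ge0_integralZl//; last 3 first.
- exact: measurable_funTS mF.
- by move=> y _; rewrite mule_ge0// lee_fin ?mulr_ge0 ?powR_ge0//; case: ifP.
- by rewrite lee_fin invr_ge0 ltW.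
rewrite [RHS]integral_mkcond; apply: eq_integral => x _.
rewrite patchE mem_setE in_itv/= andbT; case: ifPn => [/andP[x0 xt]|xt].
  rewrite x0 gt0_ltr_powR ?nnegrE ?ltW// mul1e -EFinM gtr0_norm//.
  by rewrite mulKf// gt_eqF.
case: ifPn => // x0; have tx : t <= x by move: xt; rewrite x0 /= -leNgt.
have st : t `^ s <= x `^ s.
  by apply: ge0_ler_powR; rewrite ?nnegrE ?(ltW s0) ?(ltW t0) ?(ltW x0).
by rewrite ltNge st /= mul0e mule0.
Qed.

(* The recurrence [Gamma (s + 1) = s * Gamma s]: integrate
   [x `^ (s - 1) * expR (- t / 2)] over [0 < x < t] in both orders. *)
Lemma integral_chi2_ker_addr2 (m : R) : 0 < m ->
  (\int[leb]_x (chi2_ker (m + 2) x)%:E = m%:E * \int[leb]_x (chi2_ker m x)%:E)%E.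
Proof.
move=> m0; have s0 : 0 < m / 2 by rewrite divr_gt0.
pose F (x t : R) : R := (if 0 < x then x `^ (m / 2 - 1) else 0) *
  (if x < t then expR (- (2^-1 * t)) else 0).
have mF : measurable_fun [set: R * R] (fun p => (F p.1 p.2)%:E).
  by rewrite /F; meas.
have F0 x t : (0 <= (F x t)%:E)%E.
  by rewrite lee_fin mulr_ge0//; case: ifP => // _; rewrite ?powR_ge0 ?expR_ge0.
have mk := measurable_chi2_ker m; have mk2 := measurable_chi2_ker (m + 2).
have k0 := @chi2_ker_ge0 R.
have xt : (\int[leb]_x \int[leb]_t (F x t)%:E =
    2%:E * \int[leb]_x (chi2_ker m x)%:E)%E.
  rewrite -ge0_integralZl; last 4 first.
  - by [].
  - exact/measurable_EFinP.
  - by move=> x _; rewrite lee_fin.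
  - by [].
  apply: eq_integral => x _; rewrite /F.
  under eq_integral do rewrite EFinM.
  rewrite ge0_integralZl; last 4 first.
  - by [].
  - by meas.
  - by move=> t _; rewrite lee_fin; case: ifP => // _; rewrite expR_ge0.
  - by rewrite lee_fin; case: ifP => // _; rewrite powR_ge0.
  rewrite integral_exp_tail -!EFinM /chi2_ker; case: ifP => _.
    by rewrite mulrCA.
  by rewrite mul0r mulr0.
have tx : (\int[leb]_t \int[leb]_x (F x t)%:E =
    (2 / m)%:E * \int[leb]_t (chi2_ker (m + 2) t)%:E)%E.
  rewrite -ge0_integralZl; last 4 first.
  - by [].
  - exact/measurable_EFinP.
  - by move=> x _; rewrite lee_fin.
  - by rewrite lee_fin divr_ge0// ltW.
  apply: eq_integral => t _; have [t0|t0] := ltP 0 t; last first.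
    rewrite [in RHS]/chi2_ker ltNge t0 mule0 integral0_eq// => x _.
    rewrite /F; case: ltP => x0; last by rewrite mul0r.
    by rewrite ltNge (le_trans t0 (ltW x0)) mulr0.
  transitivity (\int[leb]_x ((if 0 < x < t then x `^ (m / 2 - 1) else 0)%:E *
      (expR (- (2^-1 * t)))%:E))%E.
    apply: eq_integral => x _; rewrite -EFinM /F.
    by case: (0 < x); case: (x < t); rewrite /= ?(mul0r, mulr0).
  rewrite ge0_integralZr; last 4 first.
  - by [].
  - have -> : (fun x => (if 0 < x < t then x `^ (m / 2 - 1) else 0)%:E) =
        (fun x => (if 0 < x then if x < t then x `^ (m / 2 - 1) else 0 else 0)%:E).
      by apply/funext => x; case: (0 < x).
    by meas.
  - by move=> x _; rewrite lee_fin; case: ifP => // _; rewrite powR_ge0.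
  - by rewrite lee_fin expR_ge0.
  rewrite integral_powR_lt// -!EFinM /chi2_ker t0 mulrA; congr (_ * _)%:E.
  have -> : (m + 2) / 2 - 1 = m / 2 by field.
  by rewrite mulrC invf_div.
have := integral_swap leb leb mF F0; rewrite [LHS]xt [RHS]tx => E.
have {E} := congr1 (fun y => (m / 2)%:E * y)%E E.
rewrite !muleA -!EFinM divfK// mulrA divfK// divff ?gt_eqF//.
by rewrite mul1e => <-.
Qed.
End chi2_moments.

Section chi2_variables.
Context {R : realType} {d : measure_display} {T : measurableType d}
  (P : probability T R).
Local Notation leb := (@lebesgue_measure R).

(** Of [Gamma_fun (m / 2)] only nonnegativity is known; [k] cannot be 0 because the law of [X] has
    mass 1. *)
Lemma integral_chi2 (m : R) (X : {RV P >-> R}) : is_chi2 m X ->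
  exists2 k : R, (0 < k) /\ (k%:E * \int[leb]_x (chi2_ker m x)%:E = 1)%E &
  forall g : R -> \bar R, measurable_fun setT g -> (forall x, 0 <= g x)%E ->
  (\int[P]_w g (X w) = k%:E * \int[leb]_x (g x * (chi2_ker m x)%:E))%E.
Proof.
move=> hX; pose k := (2^-1 : R) `^ (m / 2) / Gamma_fun (m / 2).
have pdfE x : chi2_pdf m x = k * chi2_ker m x.
  rewrite /chi2_pdf /gamma_pdf /chi2_ker /k; case: ifP => _; first by rewrite mulrA.
  by rewrite mulr0.
have k0 : 0 <= k.
  rewrite divr_ge0 ?powR_ge0// Rintegral_ge0// => t _.
  by rewrite mulr_ge0 ?powR_ge0 ?expR_ge0.
have mk := measurable_chi2_ker m; have ker0 := @chi2_ker_ge0 R m.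
have E (g : R -> \bar R) : measurable_fun setT g -> (forall x, 0 <= g x)%E ->
    (\int[P]_w g (X w) = k%:E * \int[leb]_x (g x * (chi2_ker m x)%:E))%E.
  move=> mg g0; pose X' : T -> measurableTypeR R := X.
  have mX' : measurable_fun setT X' by exact: (measurable_funP X).
  rewrite -[LHS](@ge0_integral_pushforward _ _ T (measurableTypeR R) R X' mX' P
    setT g)//.
  rewrite -ge0_integralZl; last 4 first.
  - by [].
  - by meas.
  - by move=> x _; rewrite mule_ge0// lee_fin.
  - by rewrite lee_fin.
  transitivity (\int[leb]_x (g x * (k * chi2_ker m x)%:E))%E; last first.
    by apply: eq_integral => x _; rewrite EFinM muleCA.
  apply: (@ge0_integral_density _ (measurableTypeR R) R (pushforward P X') leb).
  - by meas.
  - by move=> x; rewrite mulr_ge0.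
  - move=> A mA; rewrite [LHS]hX//; apply: eq_integral => x _; by rewrite pdfE.
  - exact: mg.
  - exact: g0.
have tot : (k%:E * \int[leb]_x (chi2_ker m x)%:E = 1)%E.
  rewrite -(@probability_setT _ _ _ P) -[RHS]mul1e -[RHS]integral_cst//.
  rewrite (E (cst 1%E))//; congr (_ * _)%E.
  by apply: eq_integral => x _; rewrite mul1e.
exists k => //; split => //; rewrite lt_neqAle k0 andbT; apply/eqP => k00.
by move: tot; rewrite -k00 mul0e => /eqP; rewrite eq_sym onee_eq0.
Qed.

(** Both sides integrate [g] against a multiple of one kernel, and [g = 1] forces the multiples to
    agree. *)
Lemma integral_chi2_sumsq (m : nat) (X : {RV P >-> R}) (g : R -> \bar R) :
  is_chi2 m.+1%:R X -> measurable_fun setT g -> (forall x, 0 <= g x)%E ->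
  (\int[P]_w g (X w) = int_sumsq m.+1 g)%E.
Proof.
move=> /integral_chi2[k [k0 tot] E] mg g0; rewrite E//.
have [K K0 EK] := @int_sumsqE R m; rewrite EK//; congr (_ * _)%E.
have tot' : (K * \int[leb]_x (chi2_ker m.+1%:R x)%:E = 1)%E.
  have := EK (cst 1%E) (measurable_cst _) (fun=> lee01).
  rewrite [LHS]int_sumsq_cst// => ->; congr (_ * _)%E.
  by apply: eq_integral => x _; rewrite mul1e.
(* Since [k] is positive and the total mass is 1, the kernel integral is finite and positive; then
   [K] is finite as well. *)
move: tot tot'; case: (\int[_]_x _)%E => [r| |].
- move=> /eqP; rewrite -EFinM eqe => /eqP kr1.
  have r0 : 0 < r by rewrite -(pmulr_rgt0 _ k0) kr1.
  case: K K0 {EK} => [K| |] // _; last by rewrite gt0_mulye.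
  move=> /eqP; rewrite -EFinM eqe => /eqP Kr1; congr (_%:E).
  by apply: (@mulIf _ r); rewrite ?gt_eqF// kr1.
- by rewrite gt0_muley.
- by rewrite gt0_muleNy.
Qed.

Lemma normM_chi2_ker (m x : R) : `|x| * chi2_ker m x = chi2_ker (m + 2) x.
Proof.
rewrite /chi2_ker; case: ifP => x0; last by rewrite mulr0.
rewrite gtr0_norm// !powR_expR// mulrA; congr (_ * _).
rewrite -{1}[x]lnK ?posrE// -expRD; congr expR; by field.
Qed.

(** The absolute value keeps the integrand nonnegative everywhere, whereas [X] is positive only
    almost surely. *)
Lemma moment1_chi2 (m : R) (X : {RV P >-> R}) : 0 < m -> is_chi2 m X ->
  (\int[P]_w `|X w|%:E = m%:E)%E.
Proof.
move=> m0 /integral_chi2[k [k0 tot] E].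
rewrite (E (fun x => `|x|%:E)); last 2 first.
- by apply/measurable_EFinP; exact: normr_measurable.
- by move=> x; rewrite lee_fin.
under eq_integral do rewrite -EFinM normM_chi2_ker.
by rewrite integral_chi2_ker_addr2// muleCA tot mule1.
Qed.

Lemma moment2_chi2 (m : R) (X : {RV P >-> R}) : 0 < m -> is_chi2 m X ->
  (\int[P]_w (`|X w| ^+ 2)%:E = (m * (m + 2))%:E)%E.
Proof.
move=> m0 /integral_chi2[k [k0 tot] E].
rewrite (E (fun x => (`|x| ^+ 2)%:E)); last 2 first.
- apply/measurable_EFinP/measurable_funX; exact: normr_measurable.
- by move=> x; rewrite lee_fin exprn_ge0.
under eq_integral do rewrite -EFinM expr2 -mulrA !normM_chi2_ker.
rewrite (@integral_chi2_ker_addr2 _ (m + 2)) ?addr_gt0//.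
rewrite (@integral_chi2_ker_addr2 _ m)// !muleA -!EFinM.
have -> : k * (m + 2) * m = (m * (m + 2)) * k by ring.
by rewrite EFinM -muleA tot mule1.
Qed.

End chi2_variables.

(** * Joint laws from independence *)

Section independence.
Local Open Scope ereal_scope.
Context {R : realType} {d : measure_display} {T : measurableType d}
  (P : probability T R).
Context {d1 : measure_display} {T1 : measurableType d1}
  {d2 : measure_display} {T2 : measurableType d2}
  (X : {RV P >-> T1}) (Y : {RV P >-> T2}).

(** In [C] both sides are finite measures that agree on rectangles. The event [E] stands for later
    observations, so that independence can be propagated along a sample. *)
Lemma rectangle_independence (E : set T) : measurable E ->
  (forall A B, measurable A -> measurable B ->
    P (X @^-1` A `&` Y @^-1` B `&` E) = P (X @^-1` A) * P (Y @^-1` B) * P E) ->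
  forall C, measurable C -> P ((fun w => (X w, Y w)) @^-1` C `&` E) =
    (distribution P X \x distribution P Y) C * P E.
Proof.
move=> mE XYE C mC.
have mXY : measurable_fun setT (fun w => (X w, Y w)).
  exact: measurable_fun_pair.
pose p := NngNum (fine_ge0 (measure_ge0 P E)).
have pE : p%:num%:E = P E by rewrite /= fineK// fin_num_measure.
pose m1 := pushforward (mrestr P mE) (fun w => (X w, Y w)).
pose m2 := mscale p (distribution P X \x distribution P Y).
have m1m2 A B : measurable A -> measurable B -> m1 (A `*` B) = m2 (A `*` B).
  move=> mA mB; rewrite /m1 /m2 /mscale /pushforward /mrestr.
  rewrite [X in _ = _ * X]product_measure1E// pE muleC -XYE//.
transitivity (m2 C); last by rewrite /m2 /mscale pE muleC.
apply: (measure_unique [set A `*` B | A in measurable & B in measurable]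
  (fun=> setT) _ _ _ _ m1 m2) => //.
- exact: measurable_prod_measurableType.
- move=> _ _ [A mA [B mB <-]] [A' mA' [B' mB' <-]]; rewrite -setXI.
  by exists (A `&` A'); [exact: measurableI|exists (B `&` B') => //; exact: measurableI].
- by move=> _; exists setT => //; exists setT => //; rewrite setXTT.
- by apply/seteqP; split => // x _; exists 0%N.
- by move=> _ [A mA [B mB <-]]; exact: m1m2.
- move=> _; apply: (@le_lt_trans _ _ 1); last exact: ltry.
  by apply: probability_le1; rewrite preimage_setT setTI.
Qed.

Lemma integral_independence (f : T1 * T2 -> \bar R) :
  (forall A B, measurable A -> measurable B ->
    P (X @^-1` A `&` Y @^-1` B) = P (X @^-1` A) * P (Y @^-1` B)) ->
  measurable_fun setT f -> (forall x, 0 <= f x) ->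
  \int[P]_w f (X w, Y w) = \int[P]_w \int[P]_v f (X w, Y v).
Proof.
move=> XY mf f0.
have mXY : measurable_fun setT (fun w => (X w, Y w)) by exact: measurable_fun_pair.
transitivity (\int[distribution P X \x distribution P Y]_p f p).
  rewrite -(@ge0_integral_pushforward _ _ _ _ R _ mXY P setT f)//.
  apply: eq_measure_integral => // A mA _.
  have := @rectangle_independence setT measurableT _ A mA.
  rewrite probability_setT !mule1 setIT; apply => B C mB mC.
  by rewrite setIT mule1 XY.
rewrite fubini_tonelli1// ge0_integral_distribution; last 2 first.
- exact: measurable_fun_fubini_tonelli_F.
- by move=> x; exact: integral_ge0.
apply: eq_integral => w _ /=; rewrite /fubini_F ge0_integral_distribution//.
exact: (measurableT_comp mf (pair1_measurable (X w))).
Qed.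
End independence.

(** * The determinant of the scatter matrix *)

Section binormal.
Context {R : realType}.
Local Notation leb := (@lebesgue_measure R).
Local Notation N := (normal_prob (0 : R) 1).

Lemma quadratic_form_invmx2 (V : 'M[R]_2) (y : 'cV[R]_2) : \det V != 0 ->
  (y^T *m invmx V *m y) ord0 ord0 =
  (V ord_max ord_max * y ord0 ord0 ^+ 2
   - (V ord0 ord_max + V ord_max ord0) * y ord0 ord0 * y ord_max ord0
   + V ord0 ord0 * y ord_max ord0 ^+ 2) / \det V.
Proof.
move=> V0; rewrite /invmx unitmxE unitfE V0.
rewrite !mxE !big_ord_recl !big_ord0 !mxE !big_ord_recl !big_ord0 !mxE.
rewrite /cofactor !det_mx11 !mxE /=.
have e1 : lift ord0 ord0 = ord_max :> 'I_2 by apply/val_inj.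
have e2 : lift ord_max ord0 = ord0 :> 'I_2 by apply/val_inj.
rewrite !e1 !e2 (_ : bump 0 0 = 1%N)// !add0n addn0 expr0 expr1 (_ : 1 + 1 = 2)%N//.
by rewrite sqrrN expr1n; ring.
Qed.

(** [std1] and [std2] are the coordinates of [x - mu] after applying the inverse Cholesky factor of
    [Sigma]: independent standard normals under the model. *)
Definition std1 (mu1 s1 x1 : R) : R := (x1 - mu1) / s1.

Definition std2 (mu1 mu2 s1 s2 rho x1 x2 : R) : R :=
  ((x2 - mu2) / s2 - rho * std1 mu1 s1 x1) / Num.sqrt (1 - rho ^+ 2).

Lemma binormal_pdfE (mu1 mu2 s1 s2 rho x1 x2 : R) :
  0 < s1 -> 0 < s2 -> -1 < rho < 1 ->
  binormal_pdf (mu1, mu2, s1, s2, rho) (x1, x2) =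
  (2 * pi * (s1 * s2 * Num.sqrt (1 - rho ^+ 2)))^-1 *
  expR (- ((std1 mu1 s1 x1 ^+ 2 + std2 mu1 mu2 s1 s2 rho x1 x2 ^+ 2) / 2)).
Proof.
move=> s10 s20 /andP[r1 r2].
have r0 : 0 < 1 - rho ^+ 2 by nra.
have sr0 : Num.sqrt (1 - rho ^+ 2) != 0 by rewrite gt_eqF// sqrtr_gt0.
have srE : Num.sqrt (1 - rho ^+ 2) ^+ 2 = 1 - rho ^+ 2 by rewrite sqr_sqrtr// ltW.
have dE : \det (Sigma s1 s2 rho) = (s1 * s2 * Num.sqrt (1 - rho ^+ 2)) ^+ 2.
  by rewrite det_Sigma !exprMn srE.
rewrite /binormal_pdf dE sqrtr_sqr ger0_norm; last first.
  by rewrite !mulr_ge0 ?sqrtr_ge0 ?ltW.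
congr (_ * expR (- (_ / 2))).
rewrite quadratic_form_invmx2; last first.
  by rewrite dE expf_neq0// !mulf_neq0// gt_eqF.
rewrite dE !mxE /=.
rewrite /std2 /std1; move: sr0 srE; set r := Num.sqrt _ => sr0 srE.
have s1N : s1 != 0 by rewrite gt_eqF. have s2N : s2 != 0 by rewrite gt_eqF.
set y1 := x1 - mu1; set y2 := x2 - mu2.
(* The factor [r ^+ 2 + rho ^+ 2] equals 1; it is inserted because [field] treats [r] and [rho] as
   unrelated. *)
transitivity ((s2 ^+ 2 * y1 ^+ 2 * (r ^+ 2 + rho ^+ 2)
  - (rho * s1 * s2 + rho * s1 * s2) * y1 * y2 + s1 ^+ 2 * y2 ^+ 2) /
  (s1 * s2 * r) ^+ 2); first by rewrite srE subrK mulr1.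
by field; rewrite sr0 s1N s2N.
Qed.

Lemma integral_normal_location_scale (a b : R) (g : R -> \bar R) : 0 < a ->
  measurable_fun setT g -> (forall x, 0 <= g x)%E ->
  (\int[leb]_x (g ((x - b) / a)%R *
      ((normal_peak 1 / a) * expR (- (((x - b) / a) ^+ 2 / 2)))%:E)
   = \int[N]_x g x)%E.
Proof.
move=> a0 mg g0; have aN : a != 0 by rewrite gt_eqF.
have p0 : 0 <= normal_peak 1 :> R by exact: normal_peak_ge0.
rewrite ge0_integral_normal// [LHS](@ge0_integral_affine _ a b)//; last 2 first.
- by meas.
- by move=> x; rewrite mule_ge0// lee_fin mulr_ge0 ?expR_ge0// divr_ge0// ltW.
apply: eq_integral => x _; rewrite normal_pdf01E gtr0_norm// -muleA -EFinM.
have -> : (a * x + b - b) / a = x by field.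
by congr (_ * _%:E)%E; field.
Qed.

Lemma integral_binormal (mu1 mu2 s1 s2 rho : R) d (T : measurableType d)
    (P : probability T R) (X : {RV P >-> (R * R)%type}) (f : R -> R -> \bar R) :
  0 < s1 -> 0 < s2 -> -1 < rho < 1 -> is_binormal (mu1, mu2, s1, s2, rho) X ->
  measurable_fun [set: R * R] (fun p => f p.1 p.2) -> (forall x y, 0 <= f x y)%E ->
  (\int[P]_w f (std1 mu1 s1 (X w).1) (std2 mu1 mu2 s1 s2 rho (X w).1 (X w).2)
   = \int[N]_x \int[N]_y f x y)%E.
Proof.
move=> s10 s20 rho1 hX mf f0.
have r0 : 0 < 1 - rho ^+ 2 by case/andP: rho1; nra.
set r := Num.sqrt (1 - rho ^+ 2); have sr0 : 0 < r by rewrite sqrtr_gt0.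
have rN : r != 0 by rewrite gt_eqF.
have s2N : s2 != 0 by rewrite gt_eqF.
have p0 : 0 <= normal_peak 1 :> R by exact: normal_peak_ge0.
have peak2 : normal_peak 1 ^+ 2 = (2 * pi)^-1 :> R.
  rewrite /normal_peak exprVn sqr_sqrtr; first by rewrite expr1n mul1r -mulr_natl.
  by rewrite mulrn_wge0// mulr_ge0 ?sqr_ge0 ?pi_ge0.
pose X' : T -> (measurableTypeR R * measurableTypeR R)%type := X.
have mX' : measurable_fun setT X' by exact: (measurable_funP X).
pose g x := f (std1 mu1 s1 x.1) (std2 mu1 mu2 s1 s2 rho x.1 x.2).
pose q (x : R * R) := ((normal_peak 1 / s1) * expR (- (std1 mu1 s1 x.1 ^+ 2 / 2))) *
  ((normal_peak 1 / (s2 * r)) *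
    expR (- (std2 mu1 mu2 s1 s2 rho x.1 x.2 ^+ 2 / 2))).
have qE x : binormal_pdf (mu1, mu2, s1, s2, rho) x = q x.
  case: x => x1 x2; rewrite binormal_pdfE// /q /= -/r.
  rewrite [RHS]mulrACA -expRD; congr (_ * expR _); last by field.
  rewrite invfM -peak2; field.
  by rewrite rN s2N gt_eqF.
have mg : measurable_fun [set: R * R] g by rewrite /g /std2 /std1; meas.
have mq : measurable_fun [set: R * R] q by rewrite /q /std2 /std1; meas.
have q0 x : 0 <= q x.
  by rewrite /q !mulr_ge0 ?expR_ge0// invr_ge0 ?ltW// mulr_gt0.
rewrite -[LHS](@ge0_integral_pushforward _ _ T
  (measurableTypeR R * measurableTypeR R)%type R X' mX' P setT g)//;
  last by move=> x _; exact: f0.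
transitivity (\int[lebesgue2]_x (g x * (q x)%:E))%E.
  apply: (@ge0_integral_density _ (measurableTypeR R * measurableTypeR R)%type R
    (pushforward P X') lebesgue2).
  - exact: mq.
  - exact: q0.
  - by move=> A mA; rewrite [LHS]hX//; apply: eq_integral => x _; rewrite qE.
  - exact: mg.
  - by move=> x; exact: f0.
have mgq : measurable_fun [set: R * R] (fun x => g x * (q x)%:E)%E by meas.
rewrite (@fubini_tonelli1 _ _ (measurableTypeR R) (measurableTypeR R) R leb leb _ mgq); last first.
  by move=> x; apply: mule_ge0; [exact: f0|rewrite lee_fin].
rewrite -(@integral_normal_location_scale s1 mu1 (fun x => \int[N]_y f x y)%E)//; last 2 first.
- exact: measurable_integral.
- by move=> x; exact: integral_ge0.
apply: eq_integral => x _; rewrite /fubini_F /=.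
(* Given the first coordinate, the second is normal with standard deviation [s2 * r] about the
   regression line. *)
rewrite -(@integral_normal_location_scale (s2 * r)
  (mu2 + s2 * (rho * std1 mu1 s1 x)) (f (std1 mu1 s1 x))); last 3 first.
- by rewrite mulr_gt0.
- exact: (measurableT_comp mf (pair1_measurable _)).
- by [].
rewrite -ge0_integralZr; last 4 first.
- by [].
- by meas.
- move=> y _; rewrite mule_ge0// lee_fin mulr_ge0 ?expR_ge0// divr_ge0//.
  by rewrite ltW// mulr_gt0.
- by rewrite lee_fin mulr_ge0 ?expR_ge0// divr_ge0// ltW.
apply: eq_integral => y _; rewrite /g /q /= -muleA -EFinM.
have -> : (y - (mu2 + s2 * (rho * std1 mu1 s1 x))) / (s2 * r) =
    std2 mu1 mu2 s1 s2 rho x y by rewrite /std2 -/r; field; rewrite rN s2N.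
by congr (_ * _%:E)%E; rewrite mulrC.
Qed.
End binormal.

Section rotation2.
Context {R : realType}.
Local Notation N := (normal_prob (0 : R) 1).

(** The pairs [(u1, z1)] and [(u2, z2)] are rotated separately; the exchanges bring the two
    variables of a pair next to each other. *)
Lemma integral_normal_rotation2 (c s : R) (h : R -> R -> R -> R -> \bar R) :
  c ^+ 2 + s ^+ 2 = 1 ->
  measurable_fun [set: R * R * R * R] (fun p => h p.1.1.1 p.1.1.2 p.1.2 p.2) ->
  (forall x y z t, 0 <= h x y z t)%E ->
  (\int[N]_z1 \int[N]_z2 \int[N]_u1 \int[N]_u2
     h (c * u1 + s * z1)%R (c * z1 - s * u1)%R
       (c * u2 + s * z2)%R (c * z2 - s * u2)%R =
   \int[N]_u1 \int[N]_u2 \int[N]_w1 \int[N]_w2 h u1 w1 u2 w2)%E.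
Proof.
move=> cs1 mh h0.
pose D x y := (\int[N]_u2 \int[N]_w2 h x y u2 w2)%E.
have D0 x y : (0 <= D x y)%E by do 2 (apply: integral_ge0 => ? _).
have mD : measurable_fun [set: R * R] (fun p => D p.1 p.2).
  apply: (@measurable_integral R _ (R * R)%type N
    (fun p u => \int[N]_w h p.1 p.2 u w)%E); last by move=> *; exact: integral_ge0.
  apply: (@measurable_integral R _ (R * R * R)%type N
    (fun p w => h p.1.1 p.1.2 p.2 w)) => //.
transitivity (\int[N]_z1 \int[N]_u1 D (c * u1 + s * z1)%R (c * z1 - s * u1)%R)%E.
  apply: eq_integral => z1 _; rewrite integral_swap; last 2 first.
  - apply: (@measurable_integral R _ (R * R)%type N
      (fun p u2 => h (c * p.2 + s * z1)%R (c * z1 - s * p.2)%R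
         (c * u2 + s * p.1)%R (c * p.1 - s * u2)%R)) => //.
    by meas.
  - by move=> z2 u1; exact: integral_ge0.
  apply: eq_integral => u1 _; rewrite integral_swap; last 2 first.
  - by meas.
  - by [].
  apply: (@integral_normal_rotation R c s
    (h (c * u1 + s * z1)%R (c * z1 - s * u1)%R) cs1) => //.
  by meas.
have mDr : measurable_fun [set: R * R]
    (fun p => D (c * p.2 + s * p.1) (c * p.1 - s * p.2)) by meas.
transitivity (\int[N]_u1 \int[N]_z1 D (c * u1 + s * z1)%R (c * z1 - s * u1)%R)%E.
  exact: (@integral_swap R N N
    (fun z1 u1 => D (c * u1 + s * z1) (c * z1 - s * u1)) mDr).
transitivity (\int[N]_u1 \int[N]_w1 D u1 w1)%E.
  exact: (integral_normal_rotation cs1 mD D0).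
apply: eq_integral => u1 _.
apply: (@integral_swap R N N (fun w1 u2 => \int[N]_w2 h u1 w1 u2 w2)%E).
  apply: (@measurable_integral R _ (R * R)%type N
    (fun p w => h u1 p.1 p.2 w)) => //.
  by meas.
by move=> w1 u2; exact: integral_ge0.
Qed.

Lemma measurable_int_gram m {d} {X : measurableType d}
    (F : X -> R -> R -> R -> \bar R) :
  measurable_fun [set: X * R * R * R] (fun p => F p.1.1.1 p.1.1.2 p.1.2 p.2) ->
  (forall x a b c, 0 <= F x a b c)%E ->
  measurable_fun [set: X] (fun x => int_gram m (F x)).
Proof.
elim: m d X F => [|m IH] d X F mF F0 /=; first by meas.
apply: (@measurable_integral R _ X N (fun x w => \int[N]_z
  int_gram m (fun a b c => F x (a + w ^+ 2) (b + w * z) (c + z ^+ 2))%R)%E); last first.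
  by move=> x w; apply: integral_ge0 => z _; exact: int_gram_ge0.
apply: (@measurable_integral R _ (X * R)%type N (fun p z =>
  int_gram m (fun a b c => F p.1 (a + p.2 ^+ 2) (b + p.2 * z) (c + z ^+ 2))%R)%E);
  last by move=> x w; exact: int_gram_ge0.
apply: (IH _ (X * R * R)%type (fun p a b c => F p.1.1 (a + p.1.2 ^+ 2)
  (b + p.1.2 * p.2) (c + p.2 ^+ 2))) => //.
by meas.
Qed.
End rotation2.

(** * Sequential update of means and second moments *)

Section gram_state.
Context {R : realType} {n : nat}.
Implicit Types (F : 'I_n -> R) (k : nat).

Definition sum_lt k F : R := \sum_(j < n | (j < k)%N) F j.

Lemma sum_lt0 F : sum_lt 0 F = 0.
Proof. by rewrite /sum_lt big_pred0. Qed.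

Lemma sum_ltS (k : 'I_n) F : sum_lt k.+1 F = sum_lt k F + F k.
Proof.
rewrite /sum_lt (bigD1 k)//= addrC; congr (_ + _); apply: eq_bigl => j.
by rewrite ltnS ltn_neqAle andbC.
Qed.

Lemma sum_lt_all F : sum_lt n F = \sum_(j < n) F j.
Proof. by apply: eq_bigl => j; rewrite ltn_ord. Qed.

(* Scaled means and centered second moments of the first [k] observations. *)
Definition gram_state k (z1 z2 : 'I_n -> R) : R * R * R * R * R :=
  let u1 := sum_lt k z1 / Num.sqrt k%:R in
  let u2 := sum_lt k z2 / Num.sqrt k%:R in
  (u1, u2, sum_lt k (fun j => z1 j ^+ 2) - u1 ^+ 2,
   sum_lt k (fun j => z1 j * z2 j) - u1 * u2,
   sum_lt k (fun j => z2 j ^+ 2) - u2 ^+ 2).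

(** The angle of the rotation that sends the old scaled mean and the new observation to the new
    scaled mean and the innovation; composing these rotations gives the Helmert transformation. *)
Definition rot_cos k : R := Num.sqrt k%:R / Num.sqrt k.+1%:R.
Definition rot_sin k : R := (Num.sqrt k.+1%:R)^-1.

Lemma rot_cos_sin k : rot_cos k ^+ 2 + rot_sin k ^+ 2 = 1.
Proof.
rewrite /rot_cos /rot_sin expr_div_n exprVn !sqr_sqrtr ?ler0n//.
by rewrite -[X in _ + X]div1r -mulrDl natr1 divff// pnatr_eq0.
Qed.

Definition gram_step k (s : R * R * R * R * R) (x y : R) : R * R * R * R * R :=
  let u1 := s.1.1.1.1 in let u2 := s.1.1.1.2 in
  let w1 := rot_cos k * x - rot_sin k * u1 in
  let w2 := rot_cos k * y - rot_sin k * u2 in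
  (rot_cos k * u1 + rot_sin k * x, rot_cos k * u2 + rot_sin k * y,
   s.1.1.2 + w1 ^+ 2, s.1.2 + w1 * w2, s.2 + w2 ^+ 2).

(* Welford's update. *)
Lemma gram_stateS (k : 'I_n) z1 z2 :
  gram_state k.+1 z1 z2 = gram_step k (gram_state k z1 z2) (z1 k) (z2 k).
Proof.
rewrite /gram_state /gram_step /rot_cos /rot_sin !sum_ltS /=.
set p := Num.sqrt k%:R; set q := Num.sqrt k.+1%:R.
have qN : q != 0 by rewrite gt_eqF// sqrtr_gt0 ltr0n.
have q2 : q ^+ 2 = p ^+ 2 + 1 by rewrite !sqr_sqrtr ?ler0n// natr1.
(* For [k = 0] the sum and [p] both vanish, and division by 0 yields 0. *)
have sumE z : sum_lt k z = p * (sum_lt k z / p).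
  have [k0|k0] := posnP k.
    by rewrite k0 sum_lt0 mul0r mulr0.
  by rewrite mulrCA divff ?mulr1// gt_eqF// sqrtr_gt0 ltr0n.
set u1 := _ / p; set u2 := sum_lt k z2 / p.
rewrite [sum_lt k z1]sumE [sum_lt k z2]sumE -/u1 -/u2.
(* A rotation preserves the inner product of [(u, x)] and [(v, y)]; all three second moments are
   instances. *)
have cross (x y u v : R) : x * y - (p * u + x) / q * ((p * v + y) / q) =
    - (u * v) + (p / q * x - q^-1 * u) * (p / q * y - q^-1 * v).
  apply: (mulfI (expf_neq0 2 qN)).
  transitivity (q ^+ 2 * (x * y) - (p * u + x) * (p * v + y)); first by field.
  transitivity (- (q ^+ 2 * (u * v)) + (p * x - u) * (p * y - v)); last by field.
  by rewrite q2; ring.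
congr (_, _, _, _, _).
- by field.
- by field.
- by rewrite -!addrA; congr (_ + _); rewrite !expr2; exact: cross.
- by rewrite -!addrA; congr (_ + _); exact: cross.
- by rewrite -!addrA; congr (_ + _); rewrite !expr2; exact: cross.
Qed.

End gram_state.

Section det_scatter.
Context {R : realType} {n : nat}.
Implicit Types (y z : 'I_n -> R) (x : 'I_n -> R * R).

Definition mean y : R := n%:R^-1 * \sum_(j < n) y j.

Definition codev y z : R := \sum_(j < n) (y j - mean y) * (z j - mean z).

Lemma det_scatterE x :
  \det (scatter x) = codev (fun j => (x j).1) (fun j => (x j).1) *
    codev (fun j => (x j).2) (fun j => (x j).2) -
    codev (fun j => (x j).1) (fun j => (x j).2) ^+ 2.
Proof.
have m0 : sample_mean x ord0 ord0 = mean (fun j => (x j).1).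
  by rewrite /sample_mean mxE summxE /mean; congr (_ * _); apply: eq_bigr => j _; rewrite mxE.
have m1 : sample_mean x ord_max ord0 = mean (fun j => (x j).2).
  by rewrite /sample_mean mxE summxE /mean; congr (_ * _); apply: eq_bigr => j _; rewrite mxE.
have e1 : lift ord0 ord0 = ord_max :> 'I_2 by apply/val_inj.
have e2 : lift ord_max ord0 = ord0 :> 'I_2 by apply/val_inj.
have entry i j : scatter x i j = \sum_(k < n)
    (vec2 (x k) i ord0 - sample_mean x i ord0) *
    (vec2 (x k) j ord0 - sample_mean x j ord0).
  rewrite /scatter summxE; apply: eq_bigr => k _.
  by rewrite mxE big_ord1 !mxE.
have S00 : scatter x ord0 ord0 = codev (fun j => (x j).1) (fun j => (x j).1).
  by rewrite entry m0; apply: eq_bigr => k _; rewrite mxE.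
have S01 : scatter x ord0 ord_max = codev (fun j => (x j).1) (fun j => (x j).2).
  by rewrite entry m0 m1; apply: eq_bigr => k _; rewrite !mxE.
have S10 : scatter x ord_max ord0 = codev (fun j => (x j).1) (fun j => (x j).2).
  by rewrite entry m0 m1; apply: eq_bigr => k _; rewrite !mxE mulrC.
have S11 : scatter x ord_max ord_max = codev (fun j => (x j).2) (fun j => (x j).2).
  by rewrite entry m1; apply: eq_bigr => k _; rewrite mxE.
rewrite (expand_det_row _ ord0) !big_ord_recl big_ord0 /cofactor !det_mx11 !mxE.
by rewrite !e1 !e2 S00 S01 S10 S11 /=; ring.
Qed.

Hypothesis n0 : (0 < n)%N.

Lemma sum_cst (c : R) : n%:R^-1 * (\sum_(j < n) c) = c.
Proof. by rewrite sumr_const card_ord -[c *+ n]mulr_natl mulKf// pnatr_eq0 -lt0n. Qed.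

Lemma codevE y z :
  codev y z = \sum_(j < n) y j * z j - (\sum_(j < n) y j) * (\sum_(j < n) z j) / n%:R.
Proof.
have nN : n%:R != 0 :> R by rewrite pnatr_eq0 -lt0n.
rewrite /codev (eq_bigr (fun j => y j * z j + (- (mean z) * y j +
  (- (mean y) * z j + mean y * mean z)))); last by move=> j _; ring.
rewrite !big_split/= -!mulr_sumr sumr_const card_ord
  -[_ *+ n]mulr_natl /mean.
set A := \sum_(j < n) y j; set B := \sum_(j < n) z j; set C := \sum_(j < n) _.
by field.
Qed.

Lemma codev_affine (a a' b b' c c' : R) y z :
  codev (fun j => a + b * y j + c * z j) (fun j => a' + b' * y j + c' * z j) =
  b * b' * codev y y + (b * c' + c * b') * codev y z + c * c' * codev z z.
Proof.
have meanE a1 b1 c1 : mean (fun j => a1 + b1 * y j + c1 * z j) =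
    a1 + b1 * mean y + c1 * mean z.
  by rewrite /mean !big_split/= !mulrDr sum_cst -!mulr_sumr; ring.
rewrite /codev !meanE !mulr_sumr -!big_split/=.
by apply: eq_bigr => j _; ring.
Qed.

(** The data are an affine image of the standardized pairs, with a triangular linear part whose
    squared determinant is [det Sigma]; at [k = n] the state holds the centered second moments of
    these pairs. *)
Lemma det_scatter_standardized (mu1 mu2 s1 s2 rho : R) x :
  0 < s1 -> 0 < s2 -> -1 < rho < 1 ->
  let s := gram_state n (fun j => std1 mu1 s1 (x j).1)
    (fun j => std2 mu1 mu2 s1 s2 rho (x j).1 (x j).2) in
  \det (scatter x) = \det (Sigma s1 s2 rho) * (s.1.1.2 * s.2 - s.1.2 ^+ 2).
Proof.
move=> s10 s20 /andP[r1 r2].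
have r0 : 0 < 1 - rho ^+ 2 by nra.
have nN : n%:R != 0 :> R by rewrite pnatr_eq0 -lt0n.
set z1 := fun j => std1 mu1 s1 (x j).1.
set z2 := fun j => std2 mu1 mu2 s1 s2 rho (x j).1 (x j).2.
have r2E : Num.sqrt (1 - rho ^+ 2) ^+ 2 = 1 - rho ^+ 2 by rewrite sqr_sqrtr// ltW.
have rN : Num.sqrt (1 - rho ^+ 2) != 0 by rewrite gt_eqF// sqrtr_gt0.
have x1E : (fun j => (x j).1) = (fun j => mu1 + s1 * z1 j + 0 * z2 j).
  by apply/funext => j; rewrite /z1 /std1; field; rewrite gt_eqF.
have x2E : (fun j => (x j).2) =
    (fun j => mu2 + s2 * rho * z1 j + s2 * Num.sqrt (1 - rho ^+ 2) * z2 j).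
  apply/funext => j; rewrite /z2 /std2 -/(z1 j).
  by field; rewrite rN gt_eqF.
rewrite det_scatterE x1E x2E !codev_affine det_Sigma /= !sum_lt_all.
have gE y z : codev y z = \sum_(j < n) y j * z j -
    (\sum_(j < n) y j) / Num.sqrt n%:R * ((\sum_(j < n) z j) / Num.sqrt n%:R).
  rewrite codevE -{1}(@sqr_sqrtr _ n%:R) ?ler0n//; congr (_ - _); field.
  by rewrite gt_eqF// sqrtr_gt0 ltr0n.
have gE2 y : codev y y = \sum_(j < n) y j ^+ 2 -
    ((\sum_(j < n) y j) / Num.sqrt n%:R) ^+ 2.
  by rewrite gE expr2; congr (_ - _); apply: eq_bigr => j _; rewrite expr2.
rewrite -!gE2 -gE; move: r2E; set r := Num.sqrt (1 - _) => r2E.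
by rewrite -r2E; ring.
Qed.

End det_scatter.

(** * Law of the scatter determinant under sampling *)

Section sampling.
Context {R : realType} {n : nat} {d : measure_display} {T : measurableType d}
  (P : probability T R).
Context (mu1 mu2 s1 s2 rho : R) (X : 'I_n -> {RV P >-> (R * R)%type}).
Hypotheses (s10 : 0 < s1) (s20 : 0 < s2) (rho1 : -1 < rho < 1).
Hypothesis sample : binormal_sample (mu1, mu2, s1, s2, rho) X.
Local Notation N := (normal_prob (0 : R) 1).

Let z1 (x : R * R) : R := std1 mu1 s1 x.1.
Let z2 (x : R * R) : R := std2 mu1 mu2 s1 s2 rho x.1 x.2.

Let mz1 : measurable_fun [set: R * R] z1.
Proof. by rewrite /z1 /std1; meas. Qed.

Let mz2 : measurable_fun [set: R * R] z2.
Proof. by rewrite /z2 /std2 /std1; meas. Qed.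

Let st k w : R * R * R * R * R :=
  gram_state k (fun j => z1 (X j w)) (fun j => z2 (X j w)).

Let st0 w : st 0 w = (0, 0, 0, 0, 0).
Proof. by rewrite /st /gram_state !sum_lt0 !mul0r expr0n subrr. Qed.

Let stS (k : 'I_n) w : st k.+1 w = gram_step k (st k w) (z1 (X k w)) (z2 (X k w)).
Proof. by rewrite /st gram_stateS. Qed.

Let mstep k : measurable_fun [set: (R * R * R * R * R) * (R * R)]
  (fun p => gram_step k p.1 (z1 p.2) (z2 p.2)).
Proof. by rewrite /gram_step; meas. Qed.

Let mst k : (k <= n)%N -> measurable_fun [set: T] (st k).
Proof.
elim: k => [_|k IH kn].
  by rewrite (_ : st 0 = cst (0, 0, 0, 0, 0)) //; apply/funext => w; exact: st0.
rewrite (_ : st k.+1 = (fun p => gram_step k p.1 (z1 p.2) (z2 p.2)) \o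
    (fun w => (st k w, X (Ordinal kn) w))); last first.
  by apply/funext => w /=; rewrite (stS (Ordinal kn)).
apply: measurableT_comp; first exact: mstep.
by apply: measurable_fun_pair; [exact/IH/ltnW|exact: measurable_funP].
Qed.

Let stRV k (kn : (k <= n)%N) : {RV P >-> (R * R * R * R * R)%type} :=
  HB.pack (st k) (isMeasurableFun.Build _ _ _ _ (st k) (mst kn)).

Let event (A : 'I_n -> set (R * R)) : set T := [set w | forall i, A i (X i w)].

Let mevent A : (forall i, measurable (A i)) -> measurable (event A).
Proof.
move=> mA; rewrite (_ : event A = \bigcap_(i in [set: 'I_n]) X i @^-1` A i).
  apply: fin_bigcap_measurable => // i _.
  by rewrite -[X in measurable X]setTI; exact: measurable_funP.
by apply/seteqP; split => w /= h => [i _|i]; exact: h.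
Qed.

Let event_split (k : 'I_n) (A : 'I_n -> set (R * R)) (B : set (R * R)) :
  (forall i, measurable (A i)) -> measurable B -> A k = setT ->
  P (X k @^-1` B `&` event A) = (P (X k @^-1` B) * P (event A))%E.
Proof.
move=> mA mB Ak; have [indep _] := sample.
pose A' i := if i == k then B else A i.
have mA' i : measurable (A' i) by rewrite /A'; case: ifP.
rewrite (_ : _ `&` _ = event A'); last first.
  apply/seteqP; split => [w [/= Bw Aw] i|w /= h].
    by rewrite /A'; case: eqP => [->|_].
  split => /= [|i]; first by have := h k; rewrite /A' eqxx.
  by have := h i; rewrite /A'; case: eqP => // ->; rewrite Ak.
rewrite (indep A' mA') (indep A mA) (bigD1 k)//= [in RHS](bigD1 k)//= Ak.
rewrite preimage_setT probability_setT mul1e {1}/A' eqxx; congr (_ * _)%E.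
by apply: eq_bigr => i /negbTE ik; rewrite /A' ik.
Qed.

(** The state after [k] observations is independent of every event about the observations from [k]
    on. *)
Let st_independent k : (k <= n)%N -> forall A : 'I_n -> set (R * R),
  (forall i, measurable (A i)) -> (forall i : 'I_n, (i < k)%N -> A i = setT) ->
  forall B, measurable B ->
  P (st k @^-1` B `&` event A) = (P (st k @^-1` B) * P (event A))%E.
Proof.
elim: k => [_ A mA _ B mB|k IH kn A mA Ak B mB].
  have [B0|B0] := pselect (B (0, 0, 0, 0, 0)).
    rewrite (_ : _ @^-1` B = setT) ?setTI ?probability_setT ?mul1e//.
    by apply/seteqP; split => // w _; rewrite /preimage/= st0.
  rewrite (_ : _ @^-1` B = set0) ?set0I ?measure0 ?mul0e//.
  by apply/seteqP; split => // w; rewrite /preimage/= st0.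
pose K := Ordinal kn; pose Y := stRV (ltnW kn).
pose C := (fun p => gram_step k p.1 (z1 p.2) (z2 p.2)) @^-1` B.
have mC : measurable C.
  by rewrite -[C]setTI; exact: (mstep k measurableT mB).
have -> : st k.+1 @^-1` B = (fun w => (Y w, X K w)) @^-1` C.
  by apply/funext => w; rewrite /C /preimage /= (stS K).
have rect (A' : 'I_n -> set (R * R)) : (forall i, measurable (A' i)) ->
    (forall i : 'I_n, (i < k.+1)%N -> A' i = setT) ->
    P ((fun w => (Y w, X K w)) @^-1` C `&` event A') =
    ((distribution P Y \x distribution P (X K)) C * P (event A'))%E.
  move=> mA' A'k; apply: rectangle_independence => //; first exact: mevent.
  (* The constraint on [X K] is absorbed into the family, so that the induction hypothesis at [k]
     applies to it. *)
  move=> A1 A2 mA1 mA2; pose A2' i := if i == K then A2 else A' i.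
  have A2'E : event A2' = X K @^-1` A2 `&` event A'.
    apply/seteqP; split => [w /= h|w [/= A2w A'w] i].
      split => /= [|i]; first by have := h K; rewrite /A2' eqxx.
      by have := h i; rewrite /A2'; case: eqP => // ->; rewrite A'k.
    by rewrite /A2'; case: eqP => [->|_].
  rewrite -setIA -A2'E IH//; last 3 first.
  - exact: ltnW.
  - by move=> i; rewrite /A2'; case: ifP.
  - move=> i ik; rewrite /A2' ifF ?A'k// ?ltnS ?(ltnW ik)//.
    by apply/negbTE; rewrite -val_eqE /= neq_ltn ik.
  by rewrite A2'E event_split// ?muleA// A'k.
(* [rect] serves twice: with the given family, and with the trivial one to recognize the joint law
   of [Y] and [X K]. *)
rewrite rect// (_ : P (_ @^-1` C) = (distribution P Y \x distribution P (X K))%E C)//.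
have := rect (fun=> setT) (fun=> measurableT) (fun _ _ => erefl).
rewrite (_ : event _ = setT) ?setIT ?probability_setT ?mule1//.
by apply/seteqP; split.
Qed.

Let integral_st k (kn : (k < n)%N) (f : R * R * R * R * R -> \bar R) :
  measurable_fun setT f -> (forall x, 0 <= f x)%E ->
  (\int[P]_w f (st k.+1 w) =
   \int[N]_x \int[N]_y \int[P]_w f (gram_step k (st k w) x y))%E.
Proof.
move=> mf f0; pose K := Ordinal kn; pose Y := stRV (ltnW kn).
pose g (p : (R * R) * (R * R * R * R * R)) := f (gram_step k p.2 (z1 p.1) (z2 p.1)).
have mg : measurable_fun setT g.
  apply: measurableT_comp => //; rewrite /gram_step; meas.
transitivity (\int[P]_w g (X K w, Y w))%E.
  by apply: eq_integral => w _; rewrite /g /= (stS K).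
rewrite (integral_independence _ mg); last 2 first.
- move=> A B mA mB; rewrite setIC.
  pose A' i := if i == K then A else setT.
  have A'E : event A' = X K @^-1` A.
    apply/seteqP; split => [w /= /(_ K)|w /= Aw i]; rewrite /A' ?eqxx//.
    by case: eqP => [->|].
  rewrite -A'E [LHS]st_independent//; last 3 first.
  - exact: ltnW.
  - by move=> i; rewrite /A'; case: ifP.
  - move=> i ik; rewrite /A' ifF//.
    by apply/negbTE; rewrite -val_eqE /= neq_ltn ik.
  by rewrite muleC.
- by move=> p; exact: f0.
have [_ hX] := sample.
apply: (integral_binormal s10 s20 rho1 (hX K)
  (f := fun x y => \int[P]_w f (gram_step k (st k w) x y))%E).
- have mF : measurable_fun [set: (R * R) * T]
      (fun p => f (gram_step k (st k p.2) p.1.1 p.1.2)).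
    have mY := mst (ltnW kn).
    by apply: measurableT_comp => //; rewrite /gram_step; meas.
  apply: (measurable_fun_fubini_tonelli_F (m2 := P) _ mF) => p; exact: f0.
- by move=> x y; exact: integral_ge0.
Qed.

(** Each new pair is rotated against the current scaled means. Rotation invariance makes the new
    means and the innovations independent standard normals again, so the Gram matrix gains one pair
    per observation after the first. *)
Lemma integral_gram_state k (kn : (k < n)%N) (f : R * R * R * R * R -> \bar R) :
  measurable_fun setT f -> (forall x, 0 <= f x)%E ->
  (\int[P]_w f (st k.+1 w) =
   \int[N]_x \int[N]_y int_gram k (fun a b c => f (x, y, a, b, c)))%E.
Proof.
elim: k kn f => [|k IH] kn f mf f0; rewrite (integral_st kn mf f0).
  apply: eq_integral => x _; apply: eq_integral => y _ /=.
  (* Here [rot_cos 0 = 0] and [rot_sin 0 = 1]: the first observation becomes the mean and leaves no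
     innovation, whence [n - 1] pairs for [n] observations. *)
  have step0 w : gram_step 0 (st 0 w) x y = (x, y, 0, 0, 0).
    rewrite st0 /gram_step /rot_cos /rot_sin sqrtr0 sqrtr1 invr1 /=.
    by rewrite !(mul0r, mulr0, mul1r, add0r, oppr0, expr0n)/=.
  transitivity (\int[P]_w cst (f (x, y, 0, 0, 0)%R) w)%E.
    by apply: eq_integral => w _; rewrite step0.
  by rewrite integral_cst//
  [X in (_ * X)%E](@probability_setT _ T R P) mule1.
pose h u1 w1 u2 w2 := int_gram k (fun a b c =>
  f (u1, u2, a + w1 ^+ 2, b + w1 * w2, c + w2 ^+ 2)).
have mh : measurable_fun [set: R * R * R * R]
    (fun p => h p.1.1.1 p.1.1.2 p.1.2 p.2).
  apply: (@measurable_int_gram R k _ (R * R * R * R)%type (fun p a b c =>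
    f (p.1.1.1, p.1.2, a + p.1.1.2 ^+ 2, b + p.1.1.2 * p.2, c + p.2 ^+ 2))) => //.
  by meas.
have h0 x y z t : (0 <= h x y z t)%E by exact: int_gram_ge0.
transitivity (\int[N]_x \int[N]_y \int[N]_u \int[N]_v
    h (rot_cos k.+1 * u + rot_sin k.+1 * x)%R (rot_cos k.+1 * x - rot_sin k.+1 * u)%R
      (rot_cos k.+1 * v + rot_sin k.+1 * y)%R (rot_cos k.+1 * y - rot_sin k.+1 * v)%R)%E.
  apply: eq_integral => x _; apply: eq_integral => y _.
  apply: (IH (ltnW kn) (fun s => f (gram_step k.+1 s x y))) => //.
  by rewrite /gram_step; meas.
exact: (integral_normal_rotation2 (rot_cos_sin k.+1) mh h0).
Qed.

(* By the Cholesky form of the Gram matrix, see [int_gramE]. *)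
Lemma integral_det_scatter m (g : R -> \bar R) : n = m.+3 ->
  measurable_fun setT g -> (forall x, 0 <= g x)%E ->
  (\int[P]_w g (\det (scatter (X ^~ w)) / \det (Sigma s1 s2 rho))%R =
   int_sumsq m.+2 (fun x => int_sumsq m.+1 (fun s => g (x * s)%R)))%E.
Proof.
move=> nE mg g0.
have dS : \det (Sigma s1 s2 rho) != 0.
  rewrite det_Sigma !mulf_neq0 ?expf_neq0 ?gt_eqF//.
  by case/andP: rho1 => r1 r2; nra.
have n0 : (0 < n)%N by rewrite nE.
have kn : (m.+2 < n)%N by rewrite nE.
pose f (s : R * R * R * R * R) := g (s.1.1.2 * s.2 - s.1.2 ^+ 2).
have mf : measurable_fun setT f by rewrite /f; meas.
transitivity (\int[P]_w f (st m.+3 w))%E.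
  apply: eq_integral => w _; rewrite /f /st -nE.
  by rewrite (det_scatter_standardized n0 mu1 mu2 (fun j => X j w) s10 s20 rho1) mulrC
    mulKf.
rewrite (integral_gram_state kn mf); last by move=> x; exact: g0.
have G0 : (0 <= int_gram m.+2 (fun a b c => g (a * c - b ^+ 2)%R))%E.
  exact: int_gram_ge0.
transitivity (\int[N]_x (\int[N]_y int_gram m.+2
    (fun a b c => g (a * c - b ^+ 2)%R)))%E.
  apply: eq_integral => x _; apply: eq_integral => y _.
  by apply: eq_int_gram => a b c; rewrite /f /=.
rewrite (integral_normal_cst (integral_ge0 _ (fun _ _ => G0))).
rewrite (integral_normal_cst G0).
rewrite (@int_gramE R m.+1 (fun a b c => g (a * c - b ^+ 2))); last 2 first.
- by meas.
- by move=> a b c; exact: g0.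
apply: eq_int_sumsq => x x0.
(* With [a = x], [b = v * sqrt x] and [c = v ^+ 2 + s], the determinant [a * c - b ^+ 2] is [x * s],
   free of [v]. *)
transitivity (\int[N]_v int_sumsq m.+1 (fun s => g (x * s)%R))%E.
  apply: eq_integral => v _; apply: eq_int_sumsq => s _; congr g.
  by rewrite exprMn sqr_sqrtr//; ring.
by rewrite integral_normal_cst//; exact: int_sumsq_ge0.
Qed.
End sampling.

(** * Products of two chi-squared variables and their quantiles *)

Section chi2_distribution.
Context {R : realType} {d : measure_display} {T : measurableType d}
  (P : probability T R).
Local Notation leb := (@lebesgue_measure R).

Lemma chi2_le0 (m : R) (X : {RV P >-> R}) : is_chi2 m X ->
  P [set w | X w <= 0] = 0%E.
Proof.
move=> hX; rewrite -[LHS]/(distribution P X `]-oo, 0]%classic) hX//.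
apply: integral0_eq => x /=; rewrite in_itv/= => x0.
by rewrite /chi2_pdf /gamma_pdf ltNge x0.
Qed.

Lemma chi2_eq (m x : R) (X : {RV P >-> R}) : is_chi2 m X ->
  P [set w | X w = x] = 0%E.
Proof.
move=> hX; rewrite -[LHS]/(distribution P X [set x]) hX//.
exact: integral_set1.
Qed.

Lemma chi2_itv_gt0 (m u v : R) (X : {RV P >-> R}) : is_chi2 m X ->
  0 < u -> u < v -> (0 < P [set w | (u < X w < v)%R])%E.
Proof.
move=> hX u0 uv; have [k [k0 _] E] := integral_chi2 hX.
pose g x : \bar R := (\1_(`]u, v[%classic : set R) x)%:E.
have mI : measurable (`]u, v[%classic : set R) by exact: measurable_itv.
have mg : measurable_fun setT g by apply/measurable_EFinP; exact: measurable_indic.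
have g0 x : (0 <= g x)%E by rewrite lee_fin.
have mk := measurable_chi2_ker m; have ker0 := @chi2_ker_ge0 R m.
have gE w : g (X w) = (\1_(X @^-1` `]u, v[%classic) w)%:E by [].
have -> : P [set w | u < X w < v] = (k%:E * \int[leb]_x (g x * (chi2_ker m x)%:E))%E.
  have mXI : measurable (X @^-1` `]u, v[%classic).
    by rewrite -[X in measurable X]setTI; exact: measurable_funP.
  rewrite -E//; under eq_integral do rewrite gE.
  rewrite integral_indic// setIT; congr (P _).
rewrite mule_gt0//.
(* A lower bound of the kernel on []u, v[], where the absolute value of [ln x] is at most
   [|ln u| + |ln v|]. *)
pose c := expR (- (`|m / 2 - 1| * (`|ln u| + `|ln v|)) - v / 2).
have c0 : 0 < c by exact: expR_gt0.
apply: (@lt_le_trans _ _ (\int[leb]_x (g x * c%:E))%E); last first.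
  have m1 : measurable_fun [set: R] (fun x => g x * c%:E)%E by meas.
  have m2 : measurable_fun [set: R] (fun x => g x * (chi2_ker m x)%:E)%E by meas.
  have m0 (x : R) : setT x -> (0 <= g x * c%:E)%E.
    by move=> _; apply: mule_ge0; rewrite ?g0// lee_fin ltW.
  apply: (@ge0_le_integral _ (measurableTypeR R) R leb setT measurableT _ _ m0 m1 m2).
  move=> x _; rewrite /g -!EFinM lee_fin indicE mem_setE in_itv/=.
  have [/andP[ux xv]|_] := boolP (u < x < v); last by rewrite !mul0r.
  have x0 : 0 < x by exact: lt_trans ux.
  rewrite !mul1r /chi2_ker x0 powR_expR// -expRD ler_expR lerD//; last first.
    by rewrite lerN2 mulrC ler_pM2r ?invr_gt0// ltW.
  rewrite lerNl -mulNr (le_trans (ler_norm _))// normrM normrN ler_wpM2l//.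
  have lx1 : ln u <= ln x by rewrite ler_ln ?posrE// ltW.
  have lx2 : ln x <= ln v by rewrite ler_ln ?posrE ?x0 ?(lt_trans x0 xv) ?(ltW xv).
  have := ler_norm (ln v); have := ler_norm (- ln u); rewrite normrN => h1 h2.
  have := normr_ge0 (ln u); have := normr_ge0 (ln v) => h3 h4.
  by rewrite ler_norml; apply/andP; split; lra.
rewrite ge0_integralZr; last 4 first.
- by [].
- exact: mg.
- by move=> x _; exact: g0.
- by rewrite lee_fin ltW.
rewrite mule_gt0// ?lte_fin// /g integral_indic// setIT.
have := lebesgue_measure_itv `]u, v[; rewrite /= lte_fin uv => ->.
by rewrite -EFinB lte_fin subr_gt0.
Qed.

Lemma distribution_eq (Y Z : {RV P >-> R}) (g : R -> \bar R) :
  (forall y, P [set w | y < Y w] = P [set w | y < Z w]) ->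
  measurable_fun setT g -> (forall x, 0 <= g x)%E ->
  (\int[P]_w g (Y w) = \int[P]_w g (Z w))%E.
Proof.
move=> YZ mg g0.
pose Y' : T -> measurableTypeR R := Y; pose Z' : T -> measurableTypeR R := Z.
have mY' : measurable_fun setT Y' by exact: (measurable_funP Y).
have mZ' : measurable_fun setT Z' by exact: (measurable_funP Z).
rewrite -[LHS](@ge0_integral_pushforward _ _ T (measurableTypeR R) R Y' mY' P setT g)//.
rewrite -[RHS](@ge0_integral_pushforward _ _ T (measurableTypeR R) R Z' mZ' P setT g)//.
apply: eq_measure_integral => A mA _.
apply: (@measure_unique _ R (measurableTypeR R) (@RGenOInfty.G R)
  (fun n => `](- n%:R), +oo[%classic) _ _ _ _ (pushforward P Y') (pushforward P Z')) => //.
- exact: RGenOInfty.measurableE.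
- move=> _ _ [x ->] [y ->]; exists (Num.max x y).
  by apply/seteqP; split => z /=; rewrite !in_itv/= !andbT gt_max => /andP.
- by move=> n; exists (- n%:R).
- apply/seteqP; split => // x _; exists (Num.truncn `|x|).+1 => //=.
  have := truncnS_gt `|x|; rewrite ltr_norml => /andP[x1 _].
  by rewrite in_itv/= x1.
- move=> _ [x ->].
  have e (U : T -> R) : U @^-1` `]x, +oo[%classic = [set w | x < U w].
    by apply: eq_set => w; rewrite /= in_itv/= andbT.
  rewrite -[LHS]/(P (Y @^-1` `]x, +oo[%classic)).
  by rewrite -[RHS]/(P (Z @^-1` `]x, +oo[%classic)) !e YZ.
- move=> n; apply: (@le_lt_trans _ _ 1%E); last exact: ltry.
  apply: probability_le1; rewrite -[X in measurable X]setTI.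
  by apply: mY' => //; exact: measurable_itv.
Qed.

End chi2_distribution.

Section chi2_product.
Context {R : realType} {d : measure_display} {T : measurableType d}
  (P : probability T R).
Context (p q : R) (X Y : {RV P >-> R}).
Hypotheses (hX : is_chi2 p X) (hY : is_chi2 q Y).
Hypothesis XY : forall A B : set R, measurable A -> measurable B ->
  P (X @^-1` A `&` Y @^-1` B) = (P (X @^-1` A) * P (Y @^-1` B))%E.

Lemma integral_product (g : R -> R -> \bar R) :
  measurable_fun [set: R * R] (fun p => g p.1 p.2) -> (forall x y, 0 <= g x y)%E ->
  (\int[P]_w g (X w) (Y w) = \int[P]_w \int[P]_v g (X w) (Y v))%E.
Proof.
move=> mg g0.
exact: (@integral_independence _ _ _ P _ _ _ _ X Y (fun p => g p.1 p.2) XY mg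
  (fun p => g0 _ _)).
Qed.

Let mle0 (Z : {RV P >-> R}) : measurable [set w | Z w <= 0].
Proof.
rewrite -[X in measurable X]setTI.
have mZ : measurable_fun setT Z by exact: measurable_funP.
exact: (mZ measurableT _ (measurable_itv `]-oo, 0])).
Qed.

Let mXY : measurable_fun setT (fun w => X w * Y w).
Proof. exact: measurable_funM. Qed.

Lemma measurable_product (S : set R) : measurable S ->
  measurable [set w | S (X w * Y w)].
Proof. by move=> mS; rewrite -[X in measurable X]setTI; exact: mXY. Qed.

Lemma integral_indic_preimage (Z : T -> R) (S : set R) : measurable_fun setT Z ->
  measurable S -> P [set w | S (Z w)] = (\int[P]_w (\1_S (Z w))%:E)%E.
Proof.
move=> mZ mS; have mZS : measurable (Z @^-1` S).
  by rewrite -[X in measurable X]setTI; exact: mZ.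
transitivity (\int[P]_w (\1_(Z @^-1` S) w)%:E)%E; last by [].
by rewrite integral_indic// setIT.
Qed.

Lemma product_chi2_le0 : P [set w | X w * Y w <= 0] = 0%E.
Proof.
apply/eqP; rewrite eq_le measure_ge0 andbT.
have U0 : (P ([set w | (X w <= 0)%R] `|` [set w | (Y w <= 0)%R]) <= 0)%E.
  apply: le_trans (measureU2 P (mle0 X) (mle0 Y)) _.
  rewrite [X in (X + _ <= _)%E](chi2_le0 hX).
  by rewrite [X in (_ + X <= _)%E](chi2_le0 hY) adde0.
apply: le_trans U0; apply: le_measure; rewrite ?inE.
- exact: (@measurable_product `]-oo, 0]%classic (measurable_itv `]-oo, 0])).
- exact: measurableU.
move=> w /= XY0; have [X0|X0] := leP (X w) 0; first by left.
by right; rewrite -(pmulr_rle0 _ X0).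
Qed.

(** For a fixed nonzero value of [X] the event is an atom of the law of [Y]; for [y = 0] the product
    is almost surely positive. *)
Lemma product_chi2_eq y : P [set w | X w * Y w = y] = 0%E.
Proof.
have [->|y0] := eqVneq y 0.
  apply/eqP; rewrite eq_le measure_ge0 andbT -product_chi2_le0.
  apply: le_measure; rewrite ?inE.
  - exact: (@measurable_product [set 0] (measurable_set1 0)).
  - exact: (@measurable_product `]-oo, 0]%classic (measurable_itv `]-oo, 0])).
  by move=> w /= ->.
have mi : measurable_fun setT (\1_[set y] : R -> R) by exact: measurable_indic.
rewrite (@integral_indic_preimage _ [set y])//.
rewrite (@integral_product (fun x z => (\1_[set y] (x * z)%R)%:E)); last 2 first.
- by meas.
- by move=> x z; rewrite lee_fin.
apply: integral0_eq => w _; have [Xw0|Xw0] := eqVneq (X w) 0.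
  apply: integral0_eq => v _; rewrite Xw0 mul0r indicE memNset//= => y0'.
  by rewrite y0' eqxx in y0.
rewrite -[RHS](chi2_eq (y / X w) hY) (@integral_indic_preimage Y [set y / X w])//.
apply: eq_integral => v _; rewrite !indicE; congr (_%:R%:E).
congr (nat_of_bool _).
apply/idP/idP; rewrite !inE /=.
- by move=> <-; rewrite [X w * _]mulrC mulfK.
- by move=> ->; rewrite mulrC divfK.
Qed.

Lemma product_chi2_itv_gt0 y1 y2 : 0 < y1 -> y1 < y2 ->
  (0 < P [set w | (y1 < X w * Y w <= y2)%R])%E.
Proof.
(* [y2 / c] is the harmonic mean of [y1] and [y2]; hence [c > 1] and [y1 < y2 / c], so [X] in []1,
   c[] and [Y] in []y1, y2 / c[] put the product between [y1] and [y2]. *)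
move=> y10 y12; pose c := (y1 + y2) / (2 * y1).
have c1 : 1 < c by rewrite /c ltr_pdivlMr ?mulr_gt0// mul1r; lra.
have c0 : 0 < c by rewrite (lt_trans ltr01).
have yc : y1 < y2 / c.
  rewrite /c invf_div mulrA ltr_pdivlMr ?addr_gt0 ?(lt_trans y10 y12)//; nra.
apply: (@lt_le_trans _ _ (P (X @^-1` `]1, c[%classic `&` Y @^-1` `]y1, y2 / c[%classic))).
  rewrite (XY (measurable_itv _) (measurable_itv _)).
  have hx := chi2_itv_gt0 hX ltr01 c1; have hy := chi2_itv_gt0 hY y10 yc.
  by rewrite mule_gt0.
apply: le_measure; rewrite ?inE.
- apply: measurableI; rewrite -[X in measurable X]setTI; apply: measurable_funP => //;
    exact: measurable_itv.
- exact: (@measurable_product `]y1, y2]%classic (measurable_itv `]y1, y2])).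
move=> w /=; rewrite !in_itv/= => -[/andP[x1 x2] /andP[z1 z2]].
have w0 : 0 < Y w by exact: lt_trans z1.
apply/andP; split.
  by rewrite (lt_trans z1)// -[ltLHS]mul1r ltr_pM2r.
move: z2; rewrite ltr_pdivlMr// => z2; rewrite (le_trans _ (ltW z2))//.
by rewrite mulrC ler_pM2l// ltW.
Qed.

Lemma moment1_product : 0 < p -> 0 < q ->
  (\int[P]_w `|X w * Y w|%:E = (p * q)%:E)%E.
Proof.
move=> p0 q0; have mn := @normr_measurable R setT.
rewrite (@integral_product (fun x y => `|x * y|%:E)); last 2 first.
- by meas.
- by move=> x y; rewrite lee_fin.
have mX : measurable_fun setT X by exact: measurable_funP.
have mY : measurable_fun setT Y by exact: measurable_funP.
rewrite EFinM -(moment1_chi2 p0 hX) -(moment1_chi2 q0 hY).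
rewrite -ge0_integralZr; last 4 first.
- by [].
- by meas.
- by move=> w _; rewrite lee_fin.
- by apply: integral_ge0 => w _; rewrite lee_fin.
apply: eq_integral => w _; rewrite -ge0_integralZl; last 4 first.
- by [].
- by meas.
- by move=> v _; rewrite lee_fin.
- by rewrite lee_fin.
by apply: eq_integral => v _; rewrite -EFinM normrM.
Qed.

Lemma moment2_product : 0 < p -> 0 < q ->
  (\int[P]_w (`|X w * Y w| ^+ 2)%:E = (p * (p + 2) * (q * (q + 2)))%:E)%E.
Proof.
move=> p0 q0; have mn := @normr_measurable R setT.
rewrite (@integral_product (fun x y => (`|x * y| ^+ 2)%:E)); last 2 first.
- by meas.
- by move=> x y; rewrite lee_fin sqr_ge0.
have mX : measurable_fun setT X by exact: measurable_funP.
have mY : measurable_fun setT Y by exact: measurable_funP.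
rewrite [in RHS]EFinM -(moment2_chi2 p0 hX) -(moment2_chi2 q0 hY).
rewrite -ge0_integralZr; last 4 first.
- by [].
- by meas.
- by move=> w _; rewrite lee_fin sqr_ge0.
- by apply: integral_ge0 => w _; rewrite lee_fin sqr_ge0.
apply: eq_integral => w _; rewrite -ge0_integralZl; last 4 first.
- by [].
- by meas.
- by move=> v _; rewrite lee_fin sqr_ge0.
- by rewrite lee_fin sqr_ge0.
by apply: eq_integral => v _; rewrite -EFinM normrM exprMn.
Qed.

Lemma integral_product_sumsq i j (g : R -> \bar R) :
  p = i.+1%:R -> q = j.+1%:R -> measurable_fun setT g -> (forall x, 0 <= g x)%E ->
  (\int[P]_w g (X w * Y w)%R =
   int_sumsq i.+1 (fun x => int_sumsq j.+1 (fun s => g (x * s)%R)))%E.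
Proof.
move=> pE qE mg g0; move: hX hY; rewrite pE qE => hX' hY'.
rewrite (@integral_product (fun x y => g (x * y)%R)); last 2 first.
- by meas.
- by move=> x y; exact: g0.
rewrite -(integral_chi2_sumsq hX'); last 2 first.
- apply: (@measurable_int_sumsq R j.+1 _ R (fun x s => g (x * s))) => //.
  by meas.
- by move=> x; exact: int_sumsq_ge0.
apply: eq_integral => w _; rewrite -(integral_chi2_sumsq hY')//.
by meas.
Qed.

End chi2_product.

(** * Quantiles of a positive atomless variable charging every interval *)

Section quantile_theory.
Context {R : realType} {d : measure_display} {T : measurableType d}
  (P : probability T R) (Y : {RV P >-> R}).
Hypothesis Y_le0 : P [set w | Y w <= 0] = 0%E.
Hypothesis Y_eq : forall y, P [set w | Y w = y] = 0%E.
Hypothesis Y_itv : forall y1 y2, 0 < y1 -> y1 < y2 ->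
  (0 < P [set w | (y1 < Y w <= y2)%R])%E.

Let F y : \bar R := P [set w | Y w <= y].

Let FE y : F y = cdf Y y.
Proof. by []. Qed.

Let mle y : measurable [set w | Y w <= y].
Proof.
rewrite -[X in measurable X]setTI; have mY : measurable_fun setT Y by exact: measurable_funP.
exact: (mY measurableT _ (measurable_itv `]-oo, y])).
Qed.

Let mlt y : measurable [set w | Y w < y].
Proof.
rewrite -[X in measurable X]setTI; have mY : measurable_fun setT Y by exact: measurable_funP.
exact: (mY measurableT _ (measurable_itv `]-oo, y[)).
Qed.

Let F_mono x y : x <= y -> (F x <= F y)%E.
Proof. exact: cdf_nondecreasing. Qed.

Let F_lt x y : 0 < x -> x < y -> (F x < F y)%E.
Proof.
move=> x0 xy; have mI : measurable [set w | x < Y w <= y].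
  rewrite -[X in measurable X]setTI.
  have mY : measurable_fun setT Y by exact: measurable_funP.
  exact: (mY measurableT _ (measurable_itv `]x, y])).
have -> : F y = (F x + P [set w | (x < Y w <= y)%R])%E.
  rewrite /F -measureU//.
    congr (P _); apply/seteqP; split => w /=.
      by move=> wy; case: (leP (Y w) x) => h; [left|right].
    by move=> [wx|/andP[_]//]; exact: le_trans (ltW xy).
  by apply/seteqP; split => // w /= [wx /andP[]]; rewrite ltNge wx.
by rewrite lteDl ?fin_num_measure// Y_itv.
Qed.

Let P_lt y : P [set w | Y w < y] = F y.
Proof.
rewrite /F; have -> : [set w | Y w <= y] = [set w | Y w < y] `|` [set w | Y w = y].
  apply/seteqP; split => w /=; rewrite le_eqVlt.
    by move=> /orP[/eqP|]; [right|left].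
  by move=> [->|->]; rewrite ?eqxx ?orbT.
have meq : measurable [set w | Y w = y].
  rewrite -[X in measurable X]setTI.
  have mY : measurable_fun setT Y by exact: measurable_funP.
  exact: (mY measurableT _ (measurable_set1 y)).
rewrite measureU//; first by rewrite [X in (_ + X)%E]Y_eq adde0.
by apply/seteqP; split => // w /= [+ wy]; rewrite wy ltxx.
Qed.

Section fixed_level.
Context (alpha : R) (alpha01 : 0 < alpha < 1).
Local Notation q := (quantile P Y alpha).
Let S := [set x : R | (alpha%:E <= F x)%E].

Let S_gt0 x : S x -> 0 < x.
Proof.
move=> Sx; rewrite ltNge; apply/negP => x0; case/andP: alpha01 => a0 _.
have := le_trans Sx (F_mono x0); rewrite /F Y_le0 lee_fin.
by rewrite leNgt a0.
Qed.

Let S_neq0 : S !=set0.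
Proof.
apply/set0P/eqP => S0; case/andP: alpha01 => _; rewrite ltNge => /negP; apply.
have /cvge_to_le : cdf Y x @[x --> +oo%R] --> 1%E by exact: cvg_cdfy1.
rewrite -lee_fin; apply; apply: nearW => x.
have : ~ S x by rewrite S0.
by rewrite /S /= -FE => /negP; rewrite -ltNge => /ltW.
Qed.

Let S_inf : has_inf S.
Proof. by split => //; exists 0 => x /S_gt0/ltW. Qed.

Let S_gt_quantile x : q < x -> S x.
Proof.
move=> qx; have xq : 0 < x - q by rewrite subr_gt0.
have [s Ss sx] := inf_adherent xq S_inf.
apply: (le_trans Ss); apply: F_mono; apply: ltW; move: sx.
by rewrite -[inf S]/q addrC subrK.
Qed.

(** Right continuity of the distribution function gives [>=]. For [<=], the absence of atoms
    replaces the event by [Y < q], the increasing union of the events at [q - k.+1^-1], which lie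
    below the infimum. *)
Lemma quantile_cdf : P [set w | Y w <= q] = alpha%:E.
Proof.
apply/eqP; rewrite eq_le; apply/andP; split; last first.
  have := @cdf_right_continuous _ _ _ P Y q.
  move=> /cvge_to_ge; apply; near=> x; rewrite -FE.
  by apply: S_gt_quantile; near: x; exact: nbhs_right_gt.
rewrite -[leLHS]P_lt.
have -> : [set w | Y w < q] = \bigcup_n [set w | Y w <= q - n.+1%:R^-1].
  apply/seteqP; split => w /=.
    move=> wq; have [k kq] := ltr_add_invr wq; exists k => //=.
    by rewrite lerBrDr ltW.
  move=> [k _ /= wk]; apply: (le_lt_trans wk).
  by rewrite ltrBlDr ltrDl invr_gt0 ltr0n.
have nd : nondecreasing_seq (fun n => [set w | Y w <= q - n.+1%:R^-1]).
  move=> i j ij; apply/subsetPset => w /= /le_trans; apply.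
  by rewrite lerD2l lerN2 lef_pV2 ?posrE ?ltr0n// ler_nat ltnS.
have cv := @nondecreasing_cvg_mu _ _ _ P
  (fun n => [set w | Y w <= q - n.+1%:R^-1]) (fun n => mle _)
  (bigcupT_measurable _ (fun n => mle _)) nd.
apply: (cvge_to_le cv).
apply: nearW => k /=; rewrite leNgt; apply/negP => /ltW Sk.
have := ge_inf (proj2 S_inf) (Sk : S (q - k.+1%:R^-1)).
by rewrite -[inf S]/q leNgt ltrBlDr ltrDl invr_gt0 ltr0n.
Unshelve. all: by end_near. Qed.

Lemma quantile_gt0 : 0 < q.
Proof. by apply: S_gt0; rewrite /S /= /F quantile_cdf. Qed.

(** A flat piece of the distribution function to the right of [q] is excluded, since [Y] charges
    every interval of positive reals. *)
Lemma cdf_le_quantile x : (P [set w | (Y w <= x)%R] <= alpha%:E)%E = (x <= q).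
Proof.
apply/idP/idP => [h|xq]; last by rewrite -quantile_cdf; exact: F_mono.
rewrite leNgt; apply/negP => qx; have := F_lt quantile_gt0 qx.
by rewrite {1}/F quantile_cdf ltNge h.
Qed.

Lemma quantile_unique x : 0 < x -> P [set w | Y w <= x] = alpha%:E -> x = q.
Proof.
move=> x0 Fx; apply/eqP; rewrite eq_le -cdf_le_quantile Fx lexx/=.
rewrite leNgt; apply/negP => /(F_lt x0).
by rewrite {2}/F quantile_cdf {1}/F Fx ltxx.
Qed.

Lemma quantile_inv (D : R) : 0 <= D ->
  quantile P (fun w => D / Y w) (1 - alpha) = D / q.
Proof.
move=> D0; have q0 := quantile_gt0; case/andP: alpha01 => a0 a1.
suff SE : [set x | ((1 - alpha)%:E <= P [set w | (D / Y w <= x)%R])%E] =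
    `[D / q, +oo[%classic by rewrite /quantile SE inf_itv// bnd_simp.
have PltY x : P [set w | x <= Y w] = (1 - F x)%E.
  rewrite -P_lt -(probability_setC P (mlt x)); congr (P _).
  by apply/seteqP; split => w /=; rewrite leNgt => /negP.
have mge x : measurable [set w | x <= Y w].
  rewrite (_ : [set w | x <= Y w] = ~` [set w | Y w < x]); first exact: measurableC.
  by apply/seteqP; split => w /=; rewrite leNgt => /negP.
have mD x : measurable [set w | D / Y w <= x].
  have mDY : measurable_fun setT (fun w => D / Y w).
    have mY : measurable_fun setT Y by exact: measurable_funP.
    by meas.
  rewrite -[X in measurable X]setTI.
  exact: (mDY measurableT _ (measurable_itv `]-oo, x])).
(* A singular scatter matrix makes the variable constantly 0, and [0 / q] is its quantile. *)
have [->|DN0] := eqVneq D 0.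
  apply/seteqP; split => x /=; rewrite mul0r in_itv/= andbT.
    rewrite leNgt => h; rewrite leNgt; apply/negP => x0; move: h.
    rewrite (_ : [set _ | _] = set0) ?measure0; last first.
      by apply/seteqP; split => // w /=; rewrite mul0r leNgt x0.
    by rewrite lte_fin subr_gt0 a1.
  move=> x0; rewrite (_ : [set _ | _] = setT) ?probability_setT ?lee_fin ?gerBl ?ltW//.
  by apply/seteqP; split => // w _ /=; rewrite mul0r.
have Dp : 0 < D by rewrite lt_neqAle eq_sym DN0.
apply/seteqP; split => x /=; rewrite in_itv/= andbT.
  move=> h; have x0 : 0 < x.
    rewrite ltNge; apply/negP => x0.
    have : (P [set w | (D / Y w <= x)%R] <= 0)%E.
      rewrite -Y_le0; apply: le_measure; rewrite ?inE;
        [exact: mD|exact: mle|].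
      move=> w /= Dx; rewrite leNgt; apply/negP => w0.
      by have := divr_gt0 Dp w0; rewrite ltNge (le_trans Dx x0).
    move=> /(le_trans h); rewrite lee_fin subr_le0.
    by rewrite leNgt a1.
  rewrite ler_pdivrMr// mulrC -ler_pdivrMr// -cdf_le_quantile.
  (* Where [Y w <= 0] the quotient is not positive either, [Y w = 0] included, so dividing through
     by [Y] costs only this null event. *)
  have : (P [set w | (D / Y w <= x)%R] <=
      P [set w | (D / x <= Y w)%R] + P [set w | (Y w <= 0)%R])%E.
    apply: le_trans (measureU2 P (mge _) (mle _)).
    apply: le_measure; rewrite ?inE; [exact: mD|exact: measurableU|].
    move=> w /=; have [w0|w0] := leP (Y w) 0; first by right.
    by rewrite ler_pdivrMr// => Dx; left; rewrite ler_pdivrMr// mulrC.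
  rewrite [X in (_ + X)%E]Y_le0 adde0 PltY => /(le_trans h).
  rewrite -/(F _); have : F (D / x) \is a fin_num by rewrite fin_num_measure.
  by case: (F (D / x)) => // r _; rewrite -EFinB !lee_fin lerD2l lerN2.
move=> qx; have x0 : 0 < x by apply: lt_le_trans qx; rewrite divr_gt0.
have : D / x <= q by rewrite ler_pdivrMr// mulrC -ler_pdivrMr.
rewrite -cdf_le_quantile => h.
apply: (@le_trans _ _ (P [set w | (D / x <= Y w)%R])).
  rewrite PltY; move: h; rewrite -/(F _).
  have : F (D / x) \is a fin_num by rewrite fin_num_measure.
  by case: (F (D / x)) => // r _; rewrite -EFinB !lee_fin lerD2l lerN2.
apply: le_measure; rewrite ?inE; [exact: mge|exact: mD|] => w /= Dx.
have w0 : 0 < Y w by apply: lt_le_trans Dx; rewrite divr_gt0.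
by rewrite ler_pdivrMr// mulrC -ler_pdivrMr.
Qed.
End fixed_level.
End quantile_theory.

(** * The posterior distribution *)

Section likelihood.
Context {R : realType} {n : nat} (x : 'I_n -> R * R).
Hypothesis n0 : (0 < n)%N.

Local Notation x1 := (fun j => (x j).1).
Local Notation x2 := (fun j => (x j).2).
Local Notation s11 := (codev x1 x1).
Local Notation s12 := (codev x1 x2).
Local Notation s22 := (codev x2 x2).

Lemma sum_sqr_affine (c0 b c : R) (y z : 'I_n -> R) :
  \sum_(j < n) (c0 + b * y j + c * z j) ^+ 2 =
  b ^+ 2 * codev y y + 2 * b * c * codev y z + c ^+ 2 * codev z z +
  n%:R * (c0 + b * mean y + c * mean z) ^+ 2.
Proof.
have nN : n%:R != 0 :> R by rewrite pnatr_eq0 -lt0n.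
pose u j := c0 + b * y j + c * z j.
have meanE : mean u = c0 + b * mean y + c * mean z.
  by rewrite /mean /u !big_split/= !mulrDr (sum_cst n0) -!mulr_sumr; ring.
have := codev_affine n0 c0 c0 b b c c y z; rewrite -/u (codevE n0).
have -> : \sum_(j < n) u j * u j = \sum_(j < n) u j ^+ 2.
  by apply: eq_bigr => j _; rewrite expr2.
have -> : \sum_(j < n) u j = n%:R * mean u by rewrite /mean mulrA divff// mul1r.
rewrite meanE => /(canRL (subrK _)) ->.
by field.
Qed.

(** For [r = sqrt (1 - rho ^+ 2)] this is the trace of [Sigma^-1 S], arranged as a marginal plus a
    conditional term. *)
Definition quad_exponent (s1 s2 rho r : R) : R :=
  s11 / s1 ^+ 2 +
  (s22 / s2 ^+ 2 - 2 * rho * s12 / (s1 * s2) + rho ^+ 2 * s11 / s1 ^+ 2) / r ^+ 2.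

(** In the means the likelihood is a product of two Gaussian factors; the second is centered at a
    value depending on [mu1], so [mu2] is to be integrated first. *)
Lemma likelihoodE (mu1 mu2 s1 s2 rho : R) :
  0 < s1 -> 0 < s2 -> -1 < rho < 1 ->
  let r := Num.sqrt (1 - rho ^+ 2) in
  likelihood x (mu1, mu2, s1, s2, rho) =
  (2 * pi * (s1 * s2 * r)) ^- n * expR (- (quad_exponent s1 s2 rho r / 2)) *
  (expR (- (((mu1 - mean x1) / (s1 / Num.sqrt n%:R)) ^+ 2 / 2)) *
   expR (- (((mu2 - (mean x2 - rho * s2 / s1 * (mean x1 - mu1))) /
     (s2 * r / Num.sqrt n%:R)) ^+ 2 / 2))).
Proof.
move=> s10 s20 rho1 r.
have r0 : 0 < 1 - rho ^+ 2 by case/andP: rho1; nra.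
have sr0 : 0 < r by rewrite sqrtr_gt0.
have rN : r != 0 by rewrite gt_eqF.
have s1N : s1 != 0 by rewrite gt_eqF.
have s2N : s2 != 0 by rewrite gt_eqF.
have sn0 : 0 < Num.sqrt n%:R :> R by rewrite sqrtr_gt0 ltr0n.
have snN : Num.sqrt n%:R != 0 :> R by rewrite gt_eqF.
have sn2 : Num.sqrt n%:R ^+ 2 = n%:R :> R by rewrite sqr_sqrtr// ler0n.
rewrite /likelihood (eq_bigr (fun k => (2 * pi * (s1 * s2 * r))^-1 *
  expR (- ((std1 mu1 s1 (x k).1 ^+ 2 +
    std2 mu1 mu2 s1 s2 rho (x k).1 (x k).2 ^+ 2) / 2)))); last first.
  by move=> k _; rewrite [x k]surjective_pairing binormal_pdfE.
rewrite big_split/= prodr_const card_ord -exprVn -[RHS]mulrA; congr (_ * _).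
rewrite -(big_morph expR (@expRD R) (@expR0 R)) -!expRD; congr expR.
rewrite sumrN -mulr_suml big_split/=.
rewrite (eq_bigr (fun j => (- (mu1 / s1) + s1^-1 * (x j).1 + 0 * (x j).2) ^+ 2)); last first.
  by move=> j _; rewrite /std1; congr (_ ^+ 2); field.
rewrite (sum_sqr_affine _ _ _ x1 x2).
rewrite (eq_bigr (fun j => ((- (mu2 / s2) + rho * mu1 / s1) / r +
  (- (rho / (s1 * r))) * (x j).1 + (s2 * r)^-1 * (x j).2) ^+ 2)); last first.
  by move=> j _; rewrite /std2 /std1 -/r; congr (_ ^+ 2); field; rewrite rN s1N s2N.
rewrite (sum_sqr_affine _ _ _ x1 x2) /quad_exponent.
move: snN sn2; set q := Num.sqrt _ => snN <-.
by field; rewrite rN s1N s2N snN.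
Qed.

End likelihood.

Section scatter_positivity.
Context {R : realType} {n : nat} (x : 'I_n -> R * R).

Local Notation x1 := (fun j => (x j).1).
Local Notation x2 := (fun j => (x j).2).

Lemma codev_ge0 (y : 'I_n -> R) : 0 <= codev y y.
Proof. by apply: sumr_ge0 => j _; rewrite -expr2 sqr_ge0. Qed.

(** Writes [s11 * |S|] as the centered sum of squares of [s11 * x2 - s12 * x1], which shows that the
    determinant is nonnegative. *)
Lemma codev_det : (0 < n)%N -> codev x1 x1 * \det (scatter x) =
  codev (fun j => 0 + - codev x1 x2 * x1 j + codev x1 x1 * x2 j)
        (fun j => 0 + - codev x1 x2 * x1 j + codev x1 x1 * x2 j).
Proof. by move=> n0; rewrite codev_affine// det_scatterE; ring. Qed.

Lemma codev_eq0 : codev x1 x1 = 0 -> codev x1 x2 = 0.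
Proof.
move=> /eqP; rewrite psumr_eq0; last by move=> j _; rewrite -expr2 sqr_ge0.
move=> /allP h; rewrite /codev big1// => j _.
by have /implyP/(_ isT) := h j (mem_index_enum _); rewrite mulf_eq0 orbb => /eqP ->; rewrite mul0r.
Qed.

Lemma det_scatter_ge0 : (0 < n)%N -> 0 <= \det (scatter x).
Proof.
move=> n0; have := codev_ge0 x1; rewrite le_eqVlt => /orP[/eqP/esym s0|s0].
  by rewrite det_scatterE codev_eq0// s0 mul0r expr0n subr0.
by rewrite -(pmulr_rge0 _ s0) codev_det// codev_ge0.
Qed.

Lemma codev_gt0 : \det (scatter x) != 0 -> 0 < codev x1 x1.
Proof.
move=> D0; rewrite lt_neqAle codev_ge0 andbT; apply: contraNneq D0 => /esym s0.
by rewrite det_scatterE codev_eq0// s0 mul0r expr0n subr0.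
Qed.

End scatter_positivity.

(** * Substitutions and iterated integrals for the posterior *)

Section posterior_substitutions.
Context {R : realType}.
Local Notation leb := (@lebesgue_measure R).

Lemma integral_gauss (c b : R) : 0 < c ->
  (\int[leb]_x (expR (- (((x - b) / c) ^+ 2 / 2)))%:E =
   (c / normal_peak 1)%:E)%E.
Proof.
move=> c0; have pk0 : 0 < normal_peak 1 :> R by rewrite normal_peak_gt0.
have h : (0 < normal_peak 1 / c :> R) by rewrite divr_gt0.
have := @integral_normal_location_scale R c b (fun=> 1)%E c0 (measurable_cst _) (fun=> lee01).
rewrite integral_cst//
  [X in (_ * X)%E](@probability_setT _ (measurableTypeR R) R (normal_prob 0 1)) mule1.
move=> e; rewrite -[LHS]mul1e.
rewrite -[X in (X%:E * _)%E](@divff _ (normal_peak 1 / c)) ?gt_eqF// mulrC EFinM -muleA.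
rewrite -ge0_integralZl; last 4 first.
- by [].
- meas.
- by move=> *; rewrite lee_fin expR_ge0.
- by rewrite lee_fin ltW.
have -> : (\int[leb]_y ((normal_peak 1 / c)%:E * (expR (- (((y - b) / c) ^+ 2 / 2)))%:E) = 1)%E.
  by rewrite -e; apply: eq_integral => y _; rewrite mul1e EFinM.
by rewrite mule1 invf_div.
Qed.

Lemma integral_ltr0 (f : R -> \bar R) :
  (\int[leb]_x (if (0 < x)%R then f x else 0) = \int[leb]_(x in `]0%R, +oo[) f x)%E.
Proof.
rewrite [RHS]integral_mkcond; apply: eq_integral => x _; rewrite patchE.
by have -> : (x \in `]0, +oo[%classic) = (0 < x) by rewrite mem_setE in_itv/= andbT.
Qed.

(** Passes from a standard deviation [x] to the chi-squared coordinate [y = c ^+ 2 / x ^+ 2]. *)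
Lemma ge0_integral_inv_sqrt (c : R) (f : R -> \bar R) : 0 < c ->
  measurable_fun setT f -> (forall x, 0 <= f x)%E ->
  (\int[leb]_x (if (0 < x)%R then f x else 0) =
   \int[leb]_y (if (0 < y)%R then
      f (c * y `^ (- 2^-1))%R * (c / 2 * y `^ (- 2^-1 - 1))%:E else 0))%E.
Proof.
move=> c0 mf f0.
have mif (h : R -> \bar R) : measurable_fun setT h ->
    measurable_fun setT (fun x : R => if (0 < x)%R then h x else 0)%E.
  by move=> mh; meas.
rewrite [LHS](@ge0_integral_affine _ c 0 _ _ (mif _ mf)); last 2 first.
- by rewrite gt_eqF.
- by move=> x; case: ifP.
transitivity (\int[leb]_x (if (0 < x)%R then f (c * x)%R * c%:E else 0))%E.
  apply: eq_integral => x _; rewrite addr0 pmulr_rgt0// gtr0_norm//.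
  by case: ifP => // _; rewrite mul0e.
rewrite [LHS]integral_ltr0 [LHS](@ge0_integral_powR _ (- 2^-1)); last 3 first.
- by rewrite oppr_eq0 invr_eq0 pnatr_eq0.
- meas.
- by move=> x; rewrite mule_ge0// lee_fin ltW.
rewrite [RHS]integral_ltr0; apply: eq_integral => y _.
rewrite -muleA -EFinM normrN ger0_norm ?invr_ge0//.
by congr (_ * _%:E)%E; rewrite mulrA.
Qed.

End posterior_substitutions.
Section lebesgue5.
Context {R : realType}.
Local Notation leb := (@lebesgue_measure R).
Local Notation mR := (measurableTypeR R).

Lemma sigma_finite_product_measure {d1 d2} {T1 : measurableType d1}
    {T2 : measurableType d2} (m1 : {sigma_finite_measure set T1 -> \bar R})
    (m2 : {sigma_finite_measure set T2 -> \bar R}) :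
  sigma_finite setT (m1 \x m2)%E.
Proof.
have [F FT Foo] := sigma_finiteT m1; have [G GT Goo] := sigma_finiteT m2.
exists (fun k => if unpickle k is Some (i, j) then F i `*` G j else set0).
  apply/esym/seteqP; split=> // -[x y] _.
  have [i _ Fx] : (\bigcup_i F i) x by rewrite -FT.
  have [j _ Gy] : (\bigcup_j G j) y by rewrite -GT.
  by exists (pickle (i, j)) => //; rewrite pickleK.
move=> k; case: unpickle => [[i j]|]; last by rewrite measure0.
have [mF Fi] := Foo i; have [mG Gj] := Goo j.
split; first exact: measurableX.
by rewrite product_measure1E// lte_mul_pinfty// ge0_fin_numE.
Qed.

(* The library instance covers products of finite measures only. *)
Definition sigma_finite_product {d1 d2} {T1 : measurableType d1}
    {T2 : measurableType d2} (m1 : {sigma_finite_measure set T1 -> \bar R})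
    (m2 : {sigma_finite_measure set T2 -> \bar R}) :
    {sigma_finite_measure set (T1 * T2)%type -> \bar R} :=
  HB.pack (m1 \x m2)%E (Measure_isSigmaFinite.Build _ _ _ (m1 \x m2)%E
    (sigma_finite_product_measure m1 m2)).

(** The last coordinate is peeled off each time, except in the final pair, where the second mean
    must be innermost to suit [likelihoodE]. *)
Lemma integral_lebesgue5 (f : R -> R -> R -> R -> R -> \bar R) :
  measurable_fun [set: R * R * R * R * R]
    (fun t => f t.1.1.1.1 t.1.1.1.2 t.1.1.2 t.1.2 t.2) ->
  (forall x y z u v, 0 <= f x y z u v)%E ->
  (\int[lebesgue5]_t f t.1.1.1.1 t.1.1.1.2 t.1.1.2 t.1.2 t.2 =
   \int[leb]_v \int[leb]_u \int[leb]_z \int[leb]_x \int[leb]_y f x y z u v)%E.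
Proof.
move=> mf f0.
pose m2 := sigma_finite_product leb leb.
pose m3 := sigma_finite_product m2 leb.
pose m4 := sigma_finite_product m3 leb.
rewrite [LHS](@fubini_tonelli2 _ _ _ mR R m4 leb _ mf (fun t => f0 _ _ _ _ _)).
apply: eq_integral => v _; rewrite /fubini_G.
have mf4 : measurable_fun [set: R * R * R * R]
    (fun t => f t.1.1.1 t.1.1.2 t.1.2 t.2 v).
  exact: (measurableT_comp mf (pair2_measurable v)).
rewrite [LHS](@fubini_tonelli2 _ _ _ mR R m3 leb _ mf4 (fun t => f0 _ _ _ _ _)).
apply: eq_integral => u _; rewrite /fubini_G.
have mf3 : measurable_fun [set: R * R * R] (fun t => f t.1.1 t.1.2 t.2 u v).
  exact: (measurableT_comp mf4 (pair2_measurable u)).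
rewrite [LHS](@fubini_tonelli2 _ _ _ mR R m2 leb _ mf3 (fun t => f0 _ _ _ _ _)).
apply: eq_integral => z _; rewrite /fubini_G.
have mf2 : measurable_fun [set: R * R] (fun t => f t.1 t.2 z u v).
  exact: (measurableT_comp mf3 (pair2_measurable z)).
exact: (@fubini_tonelli1 _ _ mR mR R leb leb _ mf2 (fun t => f0 _ _ _ _ _)).
Qed.
End lebesgue5.

Section posterior_marginal.
Context {R : realType} {n : nat} (x : 'I_n -> R * R) (a b : R).
Hypothesis n0 : (0 < n)%N.
Variable B : set R.
Hypothesis mB : measurable B.
Local Notation leb := (@lebesgue_measure R).

Definition scale_likelihood (s1 s2 rho : R) : R :=
  let r := Num.sqrt (1 - rho ^+ 2) in
  (2 * pi * (s1 * s2 * r)) ^- n * expR (- (quad_exponent x s1 s2 rho r / 2)) *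
  (s1 `^ (3 - a) * s2 `^ (2 - b) * (1 - rho ^+ 2) `^ (2 - b / 2))^-1 *
  \1_B (s1 ^+ 2 * s2 ^+ 2 * (1 - rho ^+ 2)).

Definition mean_likelihood (s1 s2 rho mu1 mu2 : R) : R :=
  let r := Num.sqrt (1 - rho ^+ 2) in
  expR (- (((mu1 - mean (fun j => (x j).1)) / (s1 / Num.sqrt n%:R)) ^+ 2 / 2)) *
  expR (- (((mu2 - (mean (fun j => (x j).2) -
    rho * s2 / s1 * (mean (fun j => (x j).1) - mu1))) /
     (s2 * r / Num.sqrt n%:R)) ^+ 2 / 2)).

(** Extension by 0 outside [param_space], as nested tests so that [meas] can treat one comparison at
    a time. *)
Definition on_params (s1 s2 rho v : R) : R :=
  if 0 < s1 then if 0 < s2 then if -1 < rho then if rho < 1 then v else 0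
  else 0 else 0 else 0.

(** The last factors are the masses of the Gaussian factors in [mu1] and [mu2], with
    [(normal_peak 1)^-1] for [sqrt (2 pi)]. *)
Definition scale_marginal (s1 s2 rho : R) : R :=
  scale_likelihood s1 s2 rho *
  (s1 / Num.sqrt n%:R / normal_peak 1 *
   (s2 * Num.sqrt (1 - rho ^+ 2) / Num.sqrt n%:R / normal_peak 1)).

Lemma posterior_weight_likelihood :
  posterior_weight a b x (@theta3 R @^-1` B) =
  (\int[lebesgue5]_t (on_params t.1.1.2 t.1.2 t.2
     (scale_likelihood t.1.1.2 t.1.2 t.2 *
      mean_likelihood t.1.1.2 t.1.2 t.2 t.1.1.1.1 t.1.1.1.2))%:E)%E.
Proof.
rewrite /posterior_weight [LHS]integral_mkcond.
apply: eq_integral => -[[[[mu1 mu2] s1] s2] rho] _ /=.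
rewrite patchE.
rewrite (_ : _ \in _ = [&& 0 < s1, 0 < s2, -1 < rho, rho < 1 &
    s1 ^+ 2 * s2 ^+ 2 * (1 - rho ^+ 2) \in B]); last first.
  apply/idP/idP; rewrite !inE/= det_Sigma.
    by move=> [[-> -> /andP[-> ->]] ?]; rewrite mem_set.
  by move=> /and5P[s10 s20 r1 r2 /set_mem BB]; split=> //; split=> //; rewrite r1 r2.
rewrite /on_params.
case: ltP => //= s10; case: ltP => //= s20; case: ltP => //= r1; case: ltP => //= r2.
rewrite likelihoodE ?r1 ?r2// /scale_likelihood /mean_likelihood /= indicE.
case: ifPn => _; last by rewrite mulr0 mul0r.
by rewrite mulr1; congr (_%:E); ring.
Qed.

Lemma scale_likelihood_ge0 s1 s2 rho : 0 < s1 -> 0 < s2 -> -1 < rho < 1 ->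
  0 <= scale_likelihood s1 s2 rho.
Proof.
move=> s10 s20 r1; rewrite /scale_likelihood !mulr_ge0 ?expR_ge0 ?indic_ge0//.
- by rewrite invr_ge0 exprn_ge0// mulr_ge0 ?mulr_ge0 ?pi_ge0 ?sqrtr_ge0// ltW.
- by rewrite invr_ge0 !mulr_ge0 ?powR_ge0.
Qed.

Lemma on_params_ge0 s1 s2 rho v :
  (0 < s1 -> 0 < s2 -> -1 < rho < 1 -> 0 <= v) -> 0 <= on_params s1 s2 rho v.
Proof.
rewrite /on_params => h.
do 4 (case: ifP => //); move=> r1 r2 s20 s10; apply: h => //.
by rewrite r1 r2.
Qed.

Lemma measurable_scale_likelihood :
  measurable_fun [set: R * R * R] (fun p => scale_likelihood p.1.1 p.1.2 p.2).
Proof.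
have mI : measurable_fun setT (\1_B : R -> R) by [].
by rewrite /scale_likelihood /quad_exponent /=; meas.
Qed.

Lemma posterior_weight_marginal :
  posterior_weight a b x (@theta3 R @^-1` B) =
  (\int[leb]_rho \int[leb]_s2 \int[leb]_s1
     (on_params s1 s2 rho (scale_marginal s1 s2 rho))%:E)%E.
Proof.
rewrite posterior_weight_likelihood.
pose f mu1 mu2 s1 s2 rho : \bar R := (on_params s1 s2 rho
  (scale_likelihood s1 s2 rho * mean_likelihood s1 s2 rho mu1 mu2))%:E.
have mf : measurable_fun [set: R * R * R * R * R]
    (fun t => f t.1.1.1.1 t.1.1.1.2 t.1.1.2 t.1.2 t.2).
  have mL := measurable_scale_likelihood.
  by rewrite /f /on_params /mean_likelihood /=; meas.
have f0 mu1 mu2 s1 s2 rho : (0 <= f mu1 mu2 s1 s2 rho)%E.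
  rewrite lee_fin; apply: on_params_ge0 => *.
  by rewrite mulr_ge0// ?scale_likelihood_ge0// /mean_likelihood mulr_ge0// expR_ge0.
rewrite [LHS](integral_lebesgue5 mf f0).
apply: eq_integral => rho _; apply: eq_integral => s2 _; apply: eq_integral => s1 _.
rewrite /f /on_params.
case: ltP => s10; last by rewrite integral0_eq// => *; rewrite integral0_eq.
case: ltP => s20; last by rewrite integral0_eq// => *; rewrite integral0_eq.
case: ltP => r1; last by rewrite integral0_eq// => *; rewrite integral0_eq.
case: ltP => r2; last by rewrite integral0_eq// => *; rewrite integral0_eq.
have L0 : 0 <= scale_likelihood s1 s2 rho by rewrite scale_likelihood_ge0// r1 r2.
have sn0 : 0 < Num.sqrt n%:R :> R by rewrite sqrtr_gt0 ltr0n.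
have sr0 : 0 < Num.sqrt (1 - rho ^+ 2) by rewrite sqrtr_gt0; nra.
rewrite /mean_likelihood /scale_marginal.
set L := scale_likelihood _ _ _ in L0 *.
set m1 := mean _; set m2 := mean _.
set c1 := s1 / Num.sqrt _; set c2 := s2 * _ / Num.sqrt _.
have c10 : 0 < c1 by rewrite divr_gt0.
have c20 : 0 < c2 by rewrite divr_gt0// mulr_gt0.
have p20 : 0 <= c2 / normal_peak 1 by rewrite divr_ge0 ?normal_peak_ge0// ltW.
transitivity (\int[leb]_mu1 ((L * (c2 / normal_peak 1))%:E *
    (expR (- (((mu1 - m1) / c1) ^+ 2 / 2)))%:E))%E.
  apply: eq_integral => mu1 _.
  transitivity (\int[leb]_mu2 ((L * expR (- (((mu1 - m1) / c1) ^+ 2 / 2)))%:E *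
      (expR (- (((mu2 - (m2 - rho * s2 / s1 * (m1 - mu1))) / c2) ^+ 2 / 2)))%:E))%E.
    by apply: eq_integral => mu2 _; rewrite -EFinM mulrA.
  rewrite ge0_integralZl; last 4 first.
  - by [].
  - by meas.
  - by move=> *; rewrite lee_fin expR_ge0.
  - by rewrite lee_fin mulr_ge0// expR_ge0.
  by rewrite integral_gauss// -!EFinM; congr (_%:E); ring.
rewrite ge0_integralZl; last 4 first.
- by [].
- by meas.
- by move=> *; rewrite lee_fin expR_ge0.
- by rewrite lee_fin mulr_ge0.
by rewrite integral_gauss// -EFinM; congr (_%:E); ring.
Qed.

End posterior_marginal.

Section posterior_exponents.
Context {R : realType}.

(** Here [q] is [(1 - rho ^+ 2) ^ (- 1/2)], so that [sigma2 = e * q]. All powers of [q] cancel: this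
    is what the exponent [2 - b / 2] in the prior achieves, and it leaves a pure Gaussian in the
    correlation coordinate. *)
Lemma marginal_powers (n : nat) (a b s1 sk y q : R) :
  0 < s1 -> 0 < sk -> 0 < y -> 0 < q ->
  let e := sk * y `^ (- 2^-1) in
  (s1 * e) ^- n *
    (s1 `^ (3 - a) * (e * q) `^ (2 - b) * (q ^- 2) `^ (2 - b / 2))^-1 *
    (s1 * e) * (sk * q * y `^ (- 2^-1 - 1)) * q ^- 3 =
  sk `^ (b - n%:R) * s1 `^ (a - 2 - n%:R) * y `^ ((n%:R - b) / 2 - 1).
Proof.
move=> s10 sk0 y0 q0 /=.
rewrite -[s1]lnK// -[sk]lnK// -[y]lnK// -[q]lnK//.
move: (ln s1) (ln sk) (ln y) (ln q) => u k l w.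
have pE z v : expR z `^ v = expR (v * z) :> R by rewrite powR_expR ?expR_gt0// expRK.
rewrite !(pE, =^~ expRD, =^~ expRM_natl, =^~ expRN).
by congr expR; field.
Qed.

Context {n : nat} (x : 'I_n -> R * R) (a b : R).
Hypothesis n0 : (0 < n)%N.
Hypothesis D0 : \det (scatter x) != 0.
Variable B : set R.

Local Notation x1 := (fun j => (x j).1).
Local Notation x2 := (fun j => (x j).2).
Local Notation s11 := (codev x1 x1).
Local Notation s12 := (codev x1 x2).
Local Notation D := (\det (scatter x)).
Local Notation sk := (Num.sqrt (D / s11)).

Definition marginal_cst : R :=
  (2 * pi) ^- n / Num.sqrt n%:R / normal_peak 1 / Num.sqrt n%:R / normal_peak 1
  / 2 * sk `^ (b - n%:R).

(* The integrand after sigma2 = c y^(-1/2) and rho = t / q, with the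
   Jacobians (c / 2) y^(-3/2) and q^(-3): it is a normal density in t. *)
Lemma scale_marginal_substituted (s1 y t : R) : 0 < s1 -> 0 < y ->
  let q := Num.sqrt (1 + t ^+ 2) in
  let c := sk / Num.sqrt (1 - (t / q) ^+ 2) in
  scale_marginal x a b B s1 (c * y `^ (- 2^-1)) (t / q) *
    (c / 2 * y `^ (- 2^-1 - 1)) * q ^- 3 =
  marginal_cst * s1 `^ (a - 2 - n%:R) * expR (- (s11 / s1 ^+ 2 / 2)) *
  chi2_ker (n%:R - b) y * \1_B (s1 ^+ 2 * (D / s11) / y) *
  expR (- (((t - s1 * s12 / s11 / (sk * y `^ (- 2^-1))) /
    (s1 / Num.sqrt s11)) ^+ 2 / 2)).
Proof.
move=> s10 y0 q.
have q0 : 0 < q by rewrite sqrtr_gt0 ltr_wpDr// sqr_ge0.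
have qN : q != 0 by rewrite gt_eqF.
have q2 : q ^+ 2 = 1 + t ^+ 2 by rewrite sqr_sqrtr// ltW// ltr_wpDr// sqr_ge0.
have rE2 : 1 - (t / q) ^+ 2 = q ^- 2.
  by rewrite expr_div_n q2; field; rewrite -q2 expf_neq0.
have rE : Num.sqrt (1 - (t / q) ^+ 2) = q^-1.
  by rewrite rE2 sqrtrV ?exprn_ge0// ?ltW// sqrtr_sqr gtr0_norm.
have s0 : 0 < s11 by exact: codev_gt0.
have Dp : 0 < D by rewrite lt_neqAle eq_sym D0 det_scatter_ge0.
have sk0 : 0 < sk by rewrite sqrtr_gt0 divr_gt0.
have sk2 : sk ^+ 2 = D / s11 by rewrite sqr_sqrtr// ltW// divr_gt0.
have ys : y `^ (- 2^-1) ^+ 2 = y^-1.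
  by rewrite -powR_mulrn ?powR_ge0// -powRrM mulNr mulVf// -powR_inv1 ?ltW.
have yp : 0 < y `^ (- 2^-1) by rewrite powR_gt0.
have e2 : y = D / s11 / (sk * y `^ (- 2^-1)) ^+ 2.
  rewrite exprMn ys sk2; field; by rewrite !gt_eqF.
have e0 : 0 < sk * y `^ (- 2^-1) by rewrite mulr_gt0.
have := @marginal_powers n a b s1 sk y q s10 sk0 y0 q0.
rewrite /scale_marginal /scale_likelihood rE rE2 invrK /marginal_cst.
have -> : sk * q * y `^ (- 2^-1) = sk * y `^ (- 2^-1) * q by rewrite mulrAC.
move: (sk * y `^ (- 2^-1)) e0 e2 => e e0 yE.
have eN : e != 0 by rewrite gt_eqF.
have sN : s11 != 0 by rewrite gt_eqF.
have s1N : s1 != 0 by rewrite gt_eqF.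
have e2 : e ^+ 2 = D / s11 / y by rewrite [in RHS]yE; field; rewrite D0 sN eN.
have -> : s1 ^+ 2 * (e * q) ^+ 2 / q ^+ 2 = s1 ^+ 2 * (D / s11) / y.
  by rewrite exprMn mulrA mulfK ?expf_neq0// e2 !mulrA.
(* The square is completed in [t]; the remainder [|S| / (s11 * e ^+ 2)] is exactly [y]. *)
have -> : expR (- (quad_exponent x s1 (e * q) (t / q) q^-1 / 2)) =
    expR (- (s11 / s1 ^+ 2 / 2)) * expR (- (2^-1 * y)) *
    expR (- (((t - s1 * s12 / s11 / e) / (s1 / Num.sqrt s11)) ^+ 2 / 2)).
  rewrite -!expRD; congr expR.
  rewrite !expr_div_n sqr_sqrtr ?(ltW s0)// yE det_scatterE /quad_exponent.
  by field; rewrite sN eN s1N qN.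
rewrite (_ : s1 * (e * q) / q = s1 * e); last by rewrite mulrA mulfK.
rewrite (_ : e * q / q = e); last by rewrite mulfK.
rewrite /chi2_ker y0 [(2 * pi * (s1 * e)) ^+ n]exprMn (invfM ((2 * pi) ^+ n)).
move: (expR _) (expR _) (expR _) (\1_B _) => E1 E2 E3 I.
move: ((2 * pi) ^- n) ((s1 * e) ^- n) (_ * (q ^- 2) `^ _)^-1
  (Num.sqrt n%:R)^-1 (normal_peak 1)^-1 (q ^- 3).
move=> c1 c2 P c3 c4 q3 h.
transitivity (c1 * c3 * c4 * c3 * c4 * 2^-1 * I * E1 * E2 * E3 *
  (c2 * P * (s1 * e) * (sk * q * y `^ (- 2^-1 - 1)) * q3)); first by ring.
by rewrite h; ring.
Qed.
End posterior_exponents.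

Section posterior_integral.
Context {R : realType} {n : nat} (x : 'I_n -> R * R) (a b : R).
Hypothesis n0 : (0 < n)%N.
Hypothesis D0 : \det (scatter x) != 0.
Variable B : set R.
Hypothesis mB : measurable B.
Local Notation leb := (@lebesgue_measure R).

Local Notation x1 := (fun j => (x j).1).
Local Notation x2 := (fun j => (x j).2).
Local Notation s11 := (codev x1 x1).
Local Notation D := (\det (scatter x)).
Local Notation sk := (Num.sqrt (D / s11)).
Local Notation M := (scale_marginal x a b B).

Let mM : measurable_fun [set: R * R * R] (fun p => M p.1.1 p.1.2 p.2).
Proof.
have mL := measurable_scale_likelihood x a b mB.
by rewrite /scale_marginal; meas.
Qed.

Let M_ge0 s1 s2 rho : 0 < s1 -> 0 < s2 -> -1 < rho < 1 -> 0 <= M s1 s2 rho.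
Proof.
move=> s10 s20 r1; apply: mulr_ge0; rewrite ?scale_likelihood_ge0//; apply: mulr_ge0.
  by rewrite !divr_ge0 ?sqrtr_ge0 ?normal_peak_ge0// ltW.
by rewrite !divr_ge0 ?mulr_ge0 ?sqrtr_ge0 ?normal_peak_ge0// ltW.
Qed.

Let s0 : 0 < s11. Proof. exact: codev_gt0. Qed.

Let sk0 : 0 < sk.
Proof. by rewrite sqrtr_gt0 divr_gt0// lt_neqAle eq_sym D0 det_scatter_ge0. Qed.

(** The integrand once [sigma2] is replaced by [y]; the scale [c] depends on [rho], so this
    substitution precedes the one in [rho]. *)
Let sub_s2 s1 rho y : R :=
  let c := sk / Num.sqrt (1 - rho ^+ 2) in
  if 0 < s1 then if -1 < rho then if rho < 1 then if 0 < y then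
    M s1 (c * y `^ (- 2^-1)) rho * (c / 2 * y `^ (- 2^-1 - 1))
  else 0 else 0 else 0 else 0.

Let m_sub_s2 : measurable_fun [set: R * R * R] (fun p => sub_s2 p.1.1 p.1.2 p.2).
Proof. by rewrite /sub_s2 /=; meas. Qed.

Let sub_s2_ge0 s1 rho y : 0 <= sub_s2 s1 rho y.
Proof.
rewrite /sub_s2; case: ltP => // s10; case: ltP => // r1; case: ltP => // r2.
case: ltP => // y0.
have q0 : 0 < Num.sqrt (1 - rho ^+ 2) by rewrite sqrtr_gt0; nra.
have c0 : 0 < sk / Num.sqrt (1 - rho ^+ 2) by rewrite divr_gt0.
apply: mulr_ge0; last by rewrite mulr_ge0 ?powR_ge0// divr_ge0// ltW.
apply: M_ge0; [by []|apply: mulr_gt0; [exact: c0|by rewrite powR_gt0]|by rewrite r1 r2].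
Qed.

Let integral_s2 s1 rho :
  (\int[leb]_s2 (on_params s1 s2 rho (M s1 s2 rho))%:E =
   \int[leb]_y (sub_s2 s1 rho y)%:E)%E.
Proof.
rewrite /on_params /sub_s2.
have [s10|s10] := ltP 0 s1; last by [].
have [r1|r1] := ltP (-1) rho; last by apply: eq_integral => y _; case: ltP.
have [r2|r2] := ltP rho 1; last by apply: eq_integral => y _; case: ltP.
have q0 : 0 < Num.sqrt (1 - rho ^+ 2) by rewrite sqrtr_gt0; nra.
set c := sk / _; have c0 : 0 < c by rewrite divr_gt0.
pose f s2 : \bar R := (if 0 < s2 then M s1 s2 rho else 0)%:E.
have mf : measurable_fun setT f by rewrite /f; meas.
have f0 s2 : (0 <= f s2)%E by rewrite /f; case: ltP => // s20; rewrite lee_fin M_ge0// r1 r2.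
transitivity (\int[leb]_s2 (if (0 < s2)%R then f s2 else 0))%E.
  by apply: eq_integral => s2 _; rewrite /f; case: ltP.
rewrite [LHS](ge0_integral_inv_sqrt c0 mf f0); apply: eq_integral => y _.
by case: ltP => // y0; rewrite /f mulr_gt0 ?powR_gt0.
Qed.

Let marginal s1 y : R :=
  if 0 < s1 then
    marginal_cst x b * s1 `^ (a - 2 - n%:R) * expR (- (s11 / s1 ^+ 2 / 2)) *
    chi2_ker (n%:R - b) y * \1_B (s1 ^+ 2 * (D / s11) / y) *
    (s1 / Num.sqrt s11 / normal_peak 1)
  else 0.

Let marginal_cst_gt0 : 0 < marginal_cst x b.
Proof.
rewrite /marginal_cst mulr_gt0 ?powR_gt0// !divr_gt0 ?normal_peak_gt0 ?sqrtr_gt0 ?ltr0n//.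
by rewrite invr_gt0 exprn_gt0// mulr_gt0// pi_gt0.
Qed.

Let mI : measurable_fun setT (\1_B : R -> R). Proof. by []. Qed.

Let I0 z : 0 <= \1_B z :> R. Proof. by rewrite indicE ler0n. Qed.

Let mker m : measurable_fun setT (@chi2_ker R m). Proof. exact: measurable_chi2_ker. Qed.

Let m_marginal : measurable_fun [set: R * R] (fun p => marginal p.1 p.2).
Proof. by have mk := mker (n%:R - b); rewrite /marginal; meas. Qed.

Let marginal_ge0 s1 y : 0 <= marginal s1 y.
Proof.
rewrite /marginal; case: ltP => // s10.
have s1_ge0 := ltW s10; move: (marginal_cst x b) (ltW marginal_cst_gt0) => k k0.
repeat apply: mulr_ge0; rewrite ?invr_ge0 ?sqrtr_ge0 ?normal_peak_ge0
  ?powR_ge0 ?expR_ge0 ?chi2_ker_ge0 ?I0//.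
Qed.

Let integral_rho s1 y :
  (\int[leb]_rho (sub_s2 s1 rho y)%:E = (marginal s1 y)%:E)%E.
Proof.
rewrite /marginal; have [s10|s10] := ltP 0 s1; last first.
  by rewrite integral0_eq// => rho _; rewrite /sub_s2 ltNge s10.
have [y0|y0] := ltP 0 y; last first.
  rewrite /chi2_ker ltNge y0/= mulr0 !mul0r integral0_eq// => rho _.
  by rewrite /sub_s2 s10 (ltNge 0 y) y0; case: (-1 < rho); case: (rho < 1).
transitivity (\int[leb]_(rho in `](-1)%R, 1%R[) (sub_s2 s1 rho y)%:E)%E.
  rewrite [RHS]integral_mkcond; apply: eq_integral => rho _; rewrite patchE.
  rewrite mem_setE in_itv/=; case: ifPn => // /negP h.
  rewrite /sub_s2 s10; case: ltP => // r1; case: ltP => // r2.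
  by exfalso; apply: h; rewrite r1 r2.
rewrite [LHS]ge0_integral_div_sqrt; last 2 first.
- by meas.
- by move=> rho; rewrite lee_fin sub_s2_ge0.
set c0 := marginal_cst x b * _ * _ * _ * _.
have c00 : 0 <= c0.
  rewrite /c0; move: (marginal_cst x b) (ltW marginal_cst_gt0) => k k0.
  by repeat apply: mulr_ge0; rewrite ?powR_ge0 ?expR_ge0 ?chi2_ker_ge0 ?I0.
set g := s1 / _.
have g0 : 0 < g by rewrite divr_gt0// sqrtr_gt0.
(* [s12] now enters only through the location of the Gaussian, hence disappears on integration. *)
transitivity (\int[leb]_t (c0%:E *
  (expR (- (((t - s1 * codev x1 x2 / s11 / (sk * y `^ (- 2^-1))) / g) ^+ 2 / 2)))%:E))%E.
  apply: eq_integral => t _; rewrite -!EFinM.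
  have q0 : 0 < Num.sqrt (1 + t ^+ 2) by rewrite sqrtr_gt0 ltr_wpDr// sqr_ge0.
  have : `|t / Num.sqrt (1 + t ^+ 2)| < 1.
    rewrite -(@ltr_pXn2r _ 2)// ?nnegrE// real_normK ?num_real// expr1n.
    rewrite expr_div_n sqr_sqrtr; last by rewrite addr_ge0// sqr_ge0.
    by rewrite ltr_pdivrMr ?mul1r ?ltrDr// ltr_wpDr// sqr_ge0.
  rewrite ltr_norml => /andP[t1 t2].
  by congr (_%:E); rewrite /sub_s2 s10 t1 t2 y0 -scale_marginal_substituted.
rewrite ge0_integralZl; last 4 first.
- by [].
- by meas.
- by move=> *; rewrite lee_fin expR_ge0.
- by rewrite lee_fin.
by rewrite integral_gauss// -EFinM.
Qed.

Definition posterior_cst : R :=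
  marginal_cst x b * Num.sqrt s11 `^ (a - 1 - n%:R) / normal_peak 1 / 2.

Lemma posterior_cst_gt0 : 0 < posterior_cst.
Proof.
apply: divr_gt0 => //; apply: divr_gt0; last by rewrite normal_peak_gt0.
by apply: mulr_gt0 => //; rewrite powR_gt0// sqrtr_gt0.
Qed.

(** The substitution is [u = s11 / s1 ^+ 2], under which the argument of [\1_B] becomes
    [D / (u * y)]. *)
Let marginal_substituted u y : 0 < u ->
  marginal (Num.sqrt s11 * u `^ (- 2^-1)) y *
    (Num.sqrt s11 / 2 * u `^ (- 2^-1 - 1)) =
  posterior_cst *
    (\1_B (D / (u * y)) * chi2_ker (n%:R - a) u * chi2_ker (n%:R - b) y).
Proof.
move=> u0; have sd0 : 0 < Num.sqrt s11 by rewrite sqrtr_gt0.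
have sd2 : Num.sqrt s11 ^+ 2 = s11 by rewrite sqr_sqrtr// ltW.
have us : u `^ (- 2^-1) ^+ 2 = u^-1.
  by rewrite -powR_mulrn ?powR_ge0// -powRrM mulNr mulVf// -powR_inv1 ?ltW.
have uN : u != 0 by rewrite gt_eqF.
have sN : s11 != 0 by rewrite gt_eqF.
rewrite /marginal mulr_gt0 ?powR_gt0// exprMn sd2 us [chi2_ker (n%:R - a) u]/chi2_ker u0.
have -> : s11 / u * (D / s11) / y = D / (u * y).
  by rewrite invfM; move: y^-1 => v; field; rewrite uN sN.
have -> : s11 / (s11 / u) / 2 = 2^-1 * u by field; rewrite uN sN.
have e : (Num.sqrt s11 * u `^ (- 2^-1)) `^ (a - 2 - n%:R) *
    u `^ (- 2^-1) * (Num.sqrt s11 * u `^ (- 2^-1 - 1)) =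
    Num.sqrt s11 `^ (a - 1 - n%:R) * u `^ ((n%:R - a) / 2 - 1).
  rewrite -[Num.sqrt s11]lnK// -[u]lnK//.
  move: (ln (Num.sqrt s11)) (ln u) => k l.
  have pE z v : expR z `^ v = expR (v * z) :> R.
    by rewrite powR_expR ?expR_gt0// expRK.
  rewrite !(pE, =^~ expRD); congr expR; by field.
rewrite [Num.sqrt s11 * u `^ (- 2^-1) / _]mulrAC divff ?gt_eqF// mul1r.
rewrite /posterior_cst; move: e.
move: (expR _) (chi2_ker _ _) (\1_B _) (normal_peak 1)^-1 => E1 E2 I c2 e.
transitivity (marginal_cst x b * c2 / 2 * E1 * E2 * I *
 ((Num.sqrt s11 * u `^ (- 2^-1)) `^ (a - 2 - n%:R) *
    u `^ (- 2^-1) * (Num.sqrt s11 * u `^ (- 2^-1 - 1)))); first by ring.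
by rewrite e; ring.
Qed.

(** The integrals are taken in the order [sigma2], [rho], [sigma1], since each substitution involves
    the variables that are still outside. *)
Lemma posterior_weight_chi2 :
  posterior_weight a b x (@theta3 R @^-1` B) =
  (posterior_cst%:E * \int[leb]_u \int[leb]_y
    (\1_B (D / (u * y)) * chi2_ker (n%:R - a) u * chi2_ker (n%:R - b) y)%:E)%E.
Proof.
rewrite (posterior_weight_marginal x a b n0 mB).
have on_ge0 s1 s2 rho : 0 <= on_params s1 s2 rho (M s1 s2 rho).
  by apply: on_params_ge0 => *; exact: M_ge0.
have m_on : measurable_fun [set: R * R * R]
    (fun p => on_params p.1.1 p.1.2 p.2 (M p.1.1 p.1.2 p.2)).
  by rewrite /on_params; meas.
transitivity (\int[leb]_rho \int[leb]_s1 \int[leb]_y (sub_s2 s1 rho y)%:E)%E.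
  apply: eq_integral => rho _.
  rewrite [LHS](integral_swap leb leb (F := fun s2 s1 =>
    (on_params s1 s2 rho (M s1 s2 rho))%:E)); last 2 first.
  - by meas.
  - by move=> s2 s1; rewrite lee_fin.
  by apply: eq_integral => s1 _; exact: integral_s2.
rewrite [LHS](integral_swap leb leb (F := fun rho s1 =>
  \int[leb]_y (sub_s2 s1 rho y)%:E)%E); last 2 first.
- apply: (@measurable_integral _ _ (R * R)%type leb
    (fun p y => (sub_s2 p.2 p.1 y)%:E)); first by meas.
  by move=> *; rewrite lee_fin sub_s2_ge0.
- by move=> rho s1; apply: integral_ge0 => y _; rewrite lee_fin sub_s2_ge0.
transitivity (\int[leb]_s1 (if (0 < s1)%R then \int[leb]_y (marginal s1 y)%:E else 0))%E.
  apply: eq_integral => s1 _.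
  rewrite [LHS](integral_swap leb leb (F := fun rho y => (sub_s2 s1 rho y)%:E)); last 2 first.
  - by meas.
  - by move=> rho y; rewrite lee_fin sub_s2_ge0.
  case: ltP => s10; last first.
    by rewrite integral0_eq// => y _; rewrite integral_rho /marginal ltNge s10.
  by apply: eq_integral => y _; exact: integral_rho.
rewrite [LHS](@ge0_integral_inv_sqrt _ (Num.sqrt s11)); last 3 first.
- by rewrite sqrtr_gt0.
- apply: (@measurable_integral _ _ R leb (fun s1 y => (marginal s1 y)%:E)); first by meas.
  by move=> *; rewrite lee_fin.
- by move=> s1; apply: integral_ge0 => y _; rewrite lee_fin.
have mka := mker (n%:R - a); have mkb := mker (n%:R - b).
have mT : measurable_fun [set: R * R] (fun p => (\1_B (D / (p.1 * p.2)) *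
    chi2_ker (n%:R - a) p.1 * chi2_ker (n%:R - b) p.2)%:E).
  by meas.
have T0 u y : (0 <= (\1_B (D / (u * y)) *
    chi2_ker (n%:R - a) u * chi2_ker (n%:R - b) y)%:E)%E.
  by rewrite lee_fin !mulr_ge0 ?I0 ?chi2_ker_ge0.
rewrite -[RHS]ge0_integralZl; last 4 first.
- by [].
- exact: (@measurable_integral _ _ R leb (fun u y => (\1_B (D / (u * y)) *
    chi2_ker (n%:R - a) u * chi2_ker (n%:R - b) y)%:E)).
- by move=> u _; apply: integral_ge0.
- by rewrite lee_fin ltW// posterior_cst_gt0.
apply: eq_integral => u _; rewrite -[RHS]ge0_integralZl; last 4 first.
- by [].
- by meas.
- by move=> y _.
- by rewrite lee_fin ltW// posterior_cst_gt0.
case: ltP => u0; last first.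
  by rewrite integral0_eq// => y _;
    rewrite [chi2_ker (n%:R - a) u]/chi2_ker ltNge u0/= mulr0 mul0r mule0.
rewrite -ge0_integralZr; last 4 first.
- by [].
- by meas.
- by move=> y _; rewrite lee_fin.
- by rewrite lee_fin mulr_ge0 ?powR_ge0// divr_ge0// sqrtr_ge0.
by apply: eq_integral => y _; rewrite -!EFinM marginal_substituted.
Qed.

End posterior_integral.

Section posterior_law.
Context {R : realType} {n : nat} {d : measure_display} {T : measurableType d}
  (Q : probability T R) (a b : R) (X Y : {RV Q >-> R}).
Hypotheses (n0 : (0 < n)%N) (hX : is_chi2 (n%:R - a) X) (hY : is_chi2 (n%:R - b) Y).
Hypothesis XY : forall A B : set R, measurable A -> measurable B ->
  Q (X @^-1` A `&` Y @^-1` B) = (Q (X @^-1` A) * Q (Y @^-1` B))%E.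
Local Notation leb := (@lebesgue_measure R).

(** It matters only that [k] is positive and the same for all [B]: it cancels in the normalized
    posterior. *)
Lemma probability_div_product_chi2 (D : R) : exists2 k : R, 0 < k &
  forall B : set R, measurable B ->
    (\int[leb]_u \int[leb]_y
      (\1_B (D / (u * y)) * chi2_ker (n%:R - a) u * chi2_ker (n%:R - b) y)%:E =
    k%:E * Q [set w | B (D / (X w * Y w))%R])%E.
Proof.
have [ka [ka0 _] Ea] := integral_chi2 hX.
have [kb [kb0 _] Eb] := integral_chi2 hY.
exists (ka * kb)^-1; first by rewrite invr_gt0 mulr_gt0.
move=> B mB.
have mI : measurable_fun setT (\1_B : R -> R) by [].
have I0 z : 0 <= \1_B z :> R by rewrite indicE ler0n.
have mX : measurable_fun setT X by exact: measurable_funP.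
have mY : measurable_fun setT Y by exact: measurable_funP.
have mka := @measurable_chi2_ker R (n%:R - a).
have mkb := @measurable_chi2_ker R (n%:R - b).
rewrite (@integral_indic_preimage R d T Q (fun w => D / (X w * Y w)) B); last 2 first.
- by meas.
- by [].
rewrite (integral_independence (X := X) (Y := Y)
  (f := fun p => (\1_B (D / (p.1 * p.2)))%:E) XY); last 2 first.
- by meas.
- by move=> p; rewrite lee_fin.
pose h u : \bar R := (\int[leb]_y
  (\1_B (D / (u * y)) * chi2_ker (n%:R - b) y)%:E)%E.
have h0 u : (0 <= h u)%E.
  by apply: integral_ge0 => y _; rewrite lee_fin mulr_ge0// chi2_ker_ge0.
have mh : measurable_fun setT h.
  apply: (@measurable_integral _ _ R leb (fun u y =>
    (\1_B (D / (u * y)) * chi2_ker (n%:R - b) y)%:E)); first by meas.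
  by move=> *; rewrite lee_fin mulr_ge0// chi2_ker_ge0.
have hE u : (\int[Q]_v (\1_B (D / (u * Y v)))%:E = kb%:E * h u)%E.
  rewrite (Eb (fun y => (\1_B (D / (u * y)))%:E)); last 2 first.
  - by meas.
  - by move=> y; rewrite lee_fin.
  by congr (_ * _)%E; apply: eq_integral => y _; rewrite -EFinM.
transitivity ((ka * kb)^-1%:E * \int[Q]_w (kb%:E * h (X w)))%E; last first.
  by congr (_ * _)%E; apply: eq_integral => w _; rewrite hE.
rewrite (Ea (fun u => kb%:E * h u)%E); last 2 first.
- by meas.
- by move=> u; rewrite mule_ge0// lee_fin ltW.
have -> : (\int[leb]_u (kb%:E * h u * (chi2_ker (n%:R - a) u)%:E) =
    kb%:E * \int[leb]_u (h u * (chi2_ker (n%:R - a) u)%:E))%E.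
  rewrite -ge0_integralZl; last 4 first.
  - by [].
  - by meas.
  - by move=> u _; rewrite mule_ge0// lee_fin chi2_ker_ge0.
  - by rewrite lee_fin ltW.
  by apply: eq_integral => u _; rewrite muleA.
rewrite !muleA -!EFinM -mulrA mulVf ?mulf_neq0 ?gt_eqF// mul1e.
apply: eq_integral => u _; rewrite /h -ge0_integralZr; last 4 first.
- by [].
- by meas.
- by move=> y _; rewrite lee_fin mulr_ge0// chi2_ker_ge0.
- by rewrite lee_fin chi2_ker_ge0.
by apply: eq_integral => y _; rewrite -EFinM mulrAC.
Qed.

Context (x : 'I_n -> R * R).
Hypothesis D0 : \det (scatter x) != 0.
Local Notation D := (\det (scatter x)).

(** The total weight is the case [B = setT], so properness and the normalizing constant come from
    one formula. *)
Lemma posterior_weight_law : exists2 k : R, 0 < k &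
  posterior_weight a b x setT = k%:E /\
  forall B : set R, measurable B -> posterior_weight a b x (@theta3 R @^-1` B) =
    (k%:E * Q [set w | B (D / (X w * Y w))%R])%E.
Proof.
have [k k0 E] := probability_div_product_chi2 D.
have kE B : measurable B -> posterior_weight a b x (@theta3 R @^-1` B) =
    ((posterior_cst x a b * k)%:E * Q [set w | B (D / (X w * Y w))%R])%E.
  by move=> mB; rewrite posterior_weight_chi2// E// muleA EFinM.
exists (posterior_cst x a b * k); first by rewrite mulr_gt0// posterior_cst_gt0.
split=> //; rewrite -[setT](@preimage_setT _ _ (@theta3 R)) kE//.
by rewrite (_ : [set w | _] = setT) ?probability_setT ?mule1.
Qed.

Lemma posterior_weight_proper : posterior_proper a b x.
Proof.
by have [k k0 [E _]] := posterior_weight_law; rewrite /posterior_proper E lte_fin k0 ltry.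
Qed.

Lemma posterior_theta3 (B : set R) : measurable B ->
  posterior a b x (@theta3 R @^-1` B) = Q [set w | B (D / (X w * Y w))].
Proof.
move=> mB; have [k k0 [E EB]] := posterior_weight_law.
rewrite /posterior E EB//= muleC muleA -EFinM mulVf ?mul1e//.
by rewrite gt_eqF.
Qed.

End posterior_law.

(** * Coverage *)

Section independence.
Context {R : realType} {d : measure_display} {T : measurableType d}
  (P : probability T R).

Lemma independent_pair (I : finType) (X : I -> {RV P >-> R}) (i j : I) :
  mutually_independent X -> i != j ->
  forall A B : set R, measurable A -> measurable B ->
    P (X i @^-1` A `&` X j @^-1` B) = (P (X i @^-1` A) * P (X j @^-1` B))%E.
Proof.
move=> indep ij A B mA mB; have ji : j != i by rewrite eq_sym.
pose C k : set R := if k == i then A else if k == j then B else setT.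
have mC k : measurable (C k) by rewrite /C; case: ifP => // _; case: ifP.
have := indep C mC.
rewrite (bigD1 i)//= (bigD1 j)//= big1 ?mule1 /C ?eqxx ?(negbTE ji); last first.
  move=> k /andP[/negbTE -> /negbTE ->].
  by rewrite preimage_setT probability_setT.
move=> <-; congr (P _); apply/seteqP; split=> w /=.
  by move=> [Ai Bj] k; case: eqP => [->//|_]; case: eqP => [->|].
by move=> h; split; [have := h i|have := h j]; rewrite ?eqxx ?(negbTE ji).
Qed.

Definition product_RV (X Y : {RV P >-> R}) : {RV P >-> R} :=
  HB.pack (fun w => X w * Y w) (isMeasurableFun.Build _ _ _ _ (fun w => X w * Y w)
    (measurable_funM (measurable_funP X) (measurable_funP Y))).

End independence.

Section sampling_law.
Context {R : realType} {n : nat} {d d' : measure_display}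
  {T : measurableType d} {Omega : measurableType d'}
  (Q : probability T R) (P : probability Omega R) (Z1 Z2 : {RV Q >-> R}).
Hypotheses (hn : (3 <= n)%N) (hZ1 : is_chi2 (n%:R - 1) Z1) (hZ2 : is_chi2 (n%:R - 2) Z2).
Hypothesis Z12 : forall A B : set R, measurable A -> measurable B ->
  Q (Z1 @^-1` A `&` Z2 @^-1` B) = (Q (Z1 @^-1` A) * Q (Z2 @^-1` B))%E.
Context (mu1 mu2 s1 s2 rho : R) (X : 'I_n -> {RV P >-> (R * R)%type}).
Hypotheses (s10 : 0 < s1) (s20 : 0 < s2) (rho1 : -1 < rho < 1).
Hypothesis sample : binormal_sample (mu1, mu2, s1, s2, rho) X.

Local Notation theta := (\det (Sigma s1 s2 rho)).

Lemma det_Sigma_gt0 : 0 < theta.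
Proof.
case/andP: rho1 => r1 r2; rewrite det_Sigma !mulr_gt0 ?exprn_gt0//; nra.
Qed.

Lemma measurable_det_scatter :
  measurable_fun setT (fun w => \det (scatter (X ^~ w))).
Proof.
have mX1 j : measurable_fun setT (fun w => (X j w).1).
  by apply: measurableT_comp; [exact: measurable_fst|exact: measurable_funP].
have mX2 j : measurable_fun setT (fun w => (X j w).2).
  by apply: measurableT_comp; [exact: measurable_snd|exact: measurable_funP].
have mc (y z : 'I_n -> Omega -> R) :
    (forall j, measurable_fun setT (y j)) -> (forall j, measurable_fun setT (z j)) ->
    measurable_fun setT (fun w => codev (y ^~ w) (z ^~ w)).
  move=> my mz; rewrite /codev /mean; apply: measurable_sum => j.
  apply: measurable_funM; (apply: measurable_funB; first by []);
    apply: measurable_funM => //; exact: measurable_sum.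
rewrite (_ : (fun w => _) = (fun w =>
  codev (fun j => (X j w).1) (fun j => (X j w).1) *
  codev (fun j => (X j w).2) (fun j => (X j w).2) -
  codev (fun j => (X j w).1) (fun j => (X j w).2) ^+ 2)); last first.
  by apply/funext => w; exact: det_scatterE.
have c11 := mc _ _ mX1 mX1; have c22 := mc _ _ mX2 mX2; have c12 := mc _ _ mX1 mX2.
by apply: measurable_funB; [exact: measurable_funM|exact: measurable_funX].
Qed.

(** Both probabilities reduce to the same iterated normal integral, with [n - 1] and [n - 2]
    squares. *)
Lemma det_scatter_law (S : set R) : measurable S ->
  P [set w | S (\det (scatter (X ^~ w)) / theta)] = Q [set w | S (Z1 w * Z2 w)].
Proof.
move=> mS; have mD := measurable_det_scatter.
pose g (z : R) : \bar R := (\1_S z)%:E.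
have mI : measurable_fun setT (\1_S : R -> R) by [].
have mg : measurable_fun setT g by rewrite /g; meas.
have g0 z : (0 <= g z)%E by rewrite lee_fin indicE ler0n.
transitivity (\int[P]_w g (\det (scatter (X ^~ w)) / theta)%R)%E.
  refine (@integral_indic_preimage _ _ _ P (fun w => \det (scatter (X ^~ w)) / theta) S _ mS).
  exact: measurable_funM.
transitivity (\int[Q]_w g (Z1 w * Z2 w)%R)%E; last first.
  apply/esym/(@integral_indic_preimage _ _ _ Q (fun w => Z1 w * Z2 w) S) => //.
  by apply: measurable_funM; exact: measurable_funP.
have [m nE] : exists m, n = m.+3 by exists (n - 3)%N; rewrite -addn3 subnK.
rewrite (integral_det_scatter s10 s20 rho1 sample nE mg g0).
apply/esym/(integral_product_sumsq hZ1 hZ2 Z12) => //; rewrite nE.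
- by rewrite -addn1 natrD; ring.
- by rewrite -addn2 natrD; ring.
Qed.

Lemma det_scatter_neq0 : {ae P, forall w, \det (scatter (X ^~ w)) != 0}.
Proof.
have mD := measurable_det_scatter.
exists [set w | \det (scatter (X ^~ w)) = 0]; split.
- by rewrite -[X in measurable X]setTI; exact: (mD measurableT [set 0] (measurable_set1 0)).
- have t0 := det_Sigma_gt0.
  have -> : [set w | \det (scatter (X ^~ w)) = 0] =
      [set w | [set (0 : R)] (\det (scatter (X ^~ w)) / theta)].
    apply/seteqP; split=> w /= => [->|/eqP]; first by rewrite mul0r.
    by rewrite mulf_eq0 invr_eq0 (gt_eqF t0) orbF => /eqP.
  by rewrite det_scatter_law//; exact: (product_chi2_eq hZ1 hZ2 Z12).
- by move=> w /= /negP; rewrite negbK => /eqP.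
Qed.

End sampling_law.

Section coverage.
Context {R : realType} {d : measure_display} {T : measurableType d}
  (Q : probability T R).
Implicit Types X Y : {RV Q >-> R}.

Let independent X Y := forall A B : set R, measurable A -> measurable B ->
  Q (X @^-1` A `&` Y @^-1` B) = (Q (X @^-1` A) * Q (Y @^-1` B))%E.

Lemma product_chi2_law (i j : nat) (p q : R) X Y X' Y' (S : set R) :
  p = i.+1%:R -> q = j.+1%:R ->
  is_chi2 p X -> is_chi2 q Y -> independent X Y ->
  is_chi2 p X' -> is_chi2 q Y' -> independent X' Y' -> measurable S ->
  Q [set w | S (X w * Y w)] = Q [set w | S (X' w * Y' w)].
Proof.
move=> pE qE hX hY XY hX' hY' XY' mS.
pose g (z : R) : \bar R := (\1_S z)%:E.
have mI : measurable_fun setT (\1_S : R -> R) by [].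
have mg : measurable_fun setT g by rewrite /g; meas.
have g0 z : (0 <= g z)%E by rewrite lee_fin indicE ler0n.
transitivity (\int[Q]_w g (X w * Y w)%R)%E.
  apply: (@integral_indic_preimage _ _ _ Q (fun w => X w * Y w) S) => //.
  by apply: measurable_funM; exact: measurable_funP.
transitivity (\int[Q]_w g (X' w * Y' w)%R)%E; last first.
  apply/esym/(@integral_indic_preimage _ _ _ Q (fun w => X' w * Y' w) S) => //.
  by apply: measurable_funM; exact: measurable_funP.
by rewrite (integral_product_sumsq hX hY XY pE qE mg g0)
  (integral_product_sumsq hX' hY' XY' pE qE mg g0).
Qed.

Lemma probability_gtE Y (y : R) :
  Q [set w | y < Y w] = (1 - Q [set w | (Y w <= y)%R])%E.
Proof.
have mY : measurable_fun setT Y by exact: measurable_funP.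
rewrite -probability_setC; last first.
  by rewrite -[X in measurable X]setTI; exact: (mY measurableT _ (measurable_itv `]-oo, y])).
by congr (Q _); apply/seteqP; split=> w /=; rewrite ltNge => /negP.
Qed.

Section two_products.
Variables (p q p' q' : R) (X Y X' Y' : {RV Q >-> R}).
Hypotheses (hX : is_chi2 p X) (hY : is_chi2 q Y) (XY : independent X Y).
Hypotheses (hX' : is_chi2 p' X') (hY' : is_chi2 q' Y') (XY' : independent X' Y').

Let Z := product_RV X Y.
Let Z' := product_RV X' Y'.

Let Z_le0 : Q [set w | Z w <= 0] = 0%E.
Proof. exact: (product_chi2_le0 hX hY). Qed.
Let Z_eq y : Q [set w | Z w = y] = 0%E.
Proof. exact: (product_chi2_eq hX hY XY y). Qed.
Let Z_itv y1 y2 : 0 < y1 -> y1 < y2 -> (0 < Q [set w | (y1 < Z w <= y2)%R])%E.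
Proof. exact: (product_chi2_itv_gt0 hX hY XY). Qed.

Lemma chi2_quantile_gt0 alpha : 0 < alpha < 1 ->
  0 < quantile Q (fun w => X w * Y w) alpha.
Proof. exact: (quantile_gt0 Z_le0 Z_eq). Qed.

Lemma chi2_quantile_inv alpha D : 0 < alpha < 1 -> 0 <= D ->
  quantile Q (fun w => D / (X w * Y w)) (1 - alpha) =
  D / quantile Q (fun w => X w * Y w) alpha.
Proof. by move=> alpha01 D0; exact: (quantile_inv Z_le0 Z_eq Z_itv alpha01 D0). Qed.

Lemma chi2_quantile_gt alpha : 0 < alpha < 1 ->
  Q [set w | quantile Q (fun w => X w * Y w) alpha < X w * Y w] = (1 - alpha)%:E.
Proof.
move=> alpha01; have := quantile_cdf Z_le0 Z_eq alpha01.
by have := probability_gtE Z (quantile Q Z alpha) => -> ->; rewrite -EFinB.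
Qed.

(** Each [y > 0] is the quantile of its own level, so the coverage hypothesis says that the tails
    agree at [y]; below 0 both products have no mass. Equality in law then transfers the moments. *)
Lemma eq_product_chi2_moments :
  0 < p -> 0 < q -> 0 < p' -> 0 < q' ->
  (forall alpha, 0 < alpha < 1 ->
    Q [set w | quantile Q (fun w => X w * Y w) alpha < X' w * Y' w] =
    (1 - alpha)%:E) ->
  p * q = p' * q' /\ p + q = p' + q'.
Proof.
move=> p0 q0 p'0 q'0 cov.
have mZ : measurable_fun setT Z by exact: measurable_funP.
have mle y : measurable [set w | Z w <= y].
  by rewrite -[X in measurable X]setTI; exact: (mZ measurableT _ (measurable_itv `]-oo, y])).
have mle' y : measurable [set w | Z' w <= y].
  have mZ' : measurable_fun setT Z' by exact: measurable_funP.
  by rewrite -[X in measurable X]setTI; exact: (mZ' measurableT _ (measurable_itv `]-oo, y])).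
have mitv y1 y2 : measurable [set w | y1 < Z w <= y2].
  by rewrite -[X in measurable X]setTI; exact: (mZ measurableT _ (measurable_itv `]y1, y2])).
have tails y : Q [set w | y < Z w] = Q [set w | y < Z' w].
  have [y0|y0] := leP y 0.
    rewrite !probability_gtE; congr (1 - _)%E.
    transitivity (0%E : \bar R); [|apply/esym]; apply/eqP; rewrite eq_le measure_ge0 andbT.
      rewrite -Z_le0; apply: le_measure; rewrite ?inE//.
      by move=> w /= /le_trans; apply.
    rewrite -(product_chi2_le0 hX' hY').
    apply: (@le_measure _ _ _ Q _ [set w | Z' w <= 0]); rewrite ?inE//.
    by move=> w /= /le_trans; apply.
  (* The level lies strictly between 0 and 1 because [Z] charges []y / 2, y]] and []y, y + 1]]. *)
  pose alpha := fine (Q [set w | Z w <= y]).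
  have aE : Q [set w | Z w <= y] = alpha%:E by rewrite fineK// fin_num_measure.
  have a0 : 0 < alpha.
    rewrite -lte_fin -aE; have y20 : 0 < y / 2 by rewrite divr_gt0.
    have y2y : y / 2 < y by lra.
    apply: lt_le_trans (Z_itv y20 y2y) _; apply: le_measure; rewrite ?inE//.
    by move=> w /= /andP[].
  have a1 : alpha < 1.
    rewrite -lte_fin -aE; have yy1 : y < y + 1 by rewrite ltrDl.
    have := Z_itv y0 yy1; rewrite !ltNge; apply: contra => h1.
    have mgt : measurable [set w | y < Z w].
      rewrite (_ : [set w | y < Z w] = ~` [set w | Z w <= y]); first exact: measurableC.
      by apply/seteqP; split=> w /=; rewrite ltNge => /negP.
    apply: (@le_trans _ _ (Q [set w | y < Z w])).
      by apply: le_measure; rewrite ?inE// => w /= /andP[].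
    rewrite probability_gtE; move: h1; rewrite aE !lee_fin => h1.
    by rewrite subr_le0.
  have alpha01 : 0 < alpha < 1 by rewrite a0 a1.
  have yE : y = quantile Q Z alpha by exact: (quantile_unique Z_le0 Z_eq Z_itv alpha01 y0 aE).
  rewrite probability_gtE aE -EFinB -(cov alpha alpha01).
  by congr (Q _); apply/seteqP; split=> w /=; rewrite -yE.
have mn := @normr_measurable R setT.
have E1 : p * q = p' * q'.
  apply: EFin_inj; rewrite -(moment1_product hX hY XY p0 q0) -(moment1_product hX' hY' XY' p'0 q'0).
  apply: (@distribution_eq _ _ _ Q Z Z' (fun z => `|z|%:E) tails); first by meas.
  by move=> z; rewrite lee_fin.
have E2 : p * (p + 2) * (q * (q + 2)) = p' * (p' + 2) * (q' * (q' + 2)).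
  apply: EFin_inj; rewrite -(moment2_product hX hY XY p0 q0) -(moment2_product hX' hY' XY' p'0 q'0).
  apply: (@distribution_eq _ _ _ Q Z Z' (fun z => (`|z| ^+ 2)%:E) tails); first by meas.
  by move=> z; rewrite lee_fin sqr_ge0.
split=> //.
have pq0 : p * q != 0 by rewrite gt_eqF ?mulr_gt0.
(* Dividing the second moment by the first leaves the sum as the only unknown. *)
have : p * q * (p * q + 2 * (p + q) + 4) = p * q * (p' * q' + 2 * (p' + q') + 4).
  rewrite {3}E1; transitivity (p * (p + 2) * (q * (q + 2))); first by ring.
  by rewrite E2; ring.
move=> /(mulfI pq0); rewrite E1 => h.
by lra.
Qed.

End two_products.
End coverage.

Unset Implicit Arguments.

Theorem theorem6 (R : realType) (n : nat) (a b : R)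
    (hn : (3 <= n)%N) (ha : a < n%:R) (hb : b < n%:R)
    (d : measure_display) (T : measurableType d) (Q : probability T R)
    (chi_n1 chi_n2 chis_a chis_b : {RV Q >-> R})
    (hchi_n1 : is_chi2 (n%:R - 1) chi_n1)
    (hchi_n2 : is_chi2 (n%:R - 2) chi_n2)
    (hchis_a : is_chi2 (n%:R - a) chis_a)
    (hchis_b : is_chi2 (n%:R - b) chis_b)
    (hindep : mutually_independent
                (fun i : 'I_4 => tnth [tuple chi_n1; chi_n2; chis_a; chis_b] i)) :
  let theta3_star (x : 'I_n -> R * R) (w : T) : R :=
    \det (scatter x) / (chis_a w * chis_b w) in
  let coverage (alpha : R) : \bar R :=
    Q [set w | quantile Q (fun v => chis_a v * chis_b v) alpha
               < chi_n1 w * chi_n2 w] in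
  [/\ (forall x : 'I_n -> R * R, \det (scatter x) != 0 ->
         posterior_proper a b x /\
         forall B : set R, measurable B ->
           posterior a b x (theta3 @^-1` B) = Q (theta3_star x @^-1` B)),
      (forall mu1 mu2 s1 s2 rho : R, 0 < s1 -> 0 < s2 -> -1 < rho < 1 ->
         forall (d' : measure_display) (Omega : measurableType d')
           (P : probability Omega R) (X : 'I_n -> {RV P >-> (R * R)%type}),
         binormal_sample (mu1, mu2, s1, s2, rho) X ->
         {ae P, forall w, \det (scatter (X ^~ w)) != 0} /\
         forall alpha : R, 0 < alpha < 1 ->
           P [set w | theta3 (mu1, mu2, s1, s2, rho)
                      < quantile Q (theta3_star (X ^~ w)) (1 - alpha)]
           = coverage alpha)
    & (forall alpha : R, 0 < alpha < 1 -> coverage alpha = (1 - alpha)%:E) <->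
      (a = 1 /\ b = 2) \/ (a = 2 /\ b = 1)].
Proof.
move=> theta3_star coverage.
have n0 : (0 < n)%N by exact: leq_trans hn.
have Z12 : forall A B : set R, measurable A -> measurable B ->
    Q (chi_n1 @^-1` A `&` chi_n2 @^-1` B) = (Q (chi_n1 @^-1` A) * Q (chi_n2 @^-1` B))%E.
  exact: (@independent_pair _ _ _ _ _ _ (@Ordinal 4 0 isT) (@Ordinal 4 1 isT) hindep).
have Yab : forall A B : set R, measurable A -> measurable B ->
    Q (chis_a @^-1` A `&` chis_b @^-1` B) = (Q (chis_a @^-1` A) * Q (chis_b @^-1` B))%E.
  exact: (@independent_pair _ _ _ _ _ _ (@Ordinal 4 2 isT) (@Ordinal 4 3 isT) hindep).
have Yba : forall A B : set R, measurable A -> measurable B ->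
    Q (chis_b @^-1` A `&` chis_a @^-1` B) = (Q (chis_b @^-1` A) * Q (chis_a @^-1` B))%E.
  exact: (@independent_pair _ _ _ _ _ _ (@Ordinal 4 3 isT) (@Ordinal 4 2 isT) hindep).
split.
- move=> x D0; split.
    exact: (posterior_weight_proper n0 hchis_a hchis_b Yab D0).
  by move=> B mB; exact: (posterior_theta3 n0 hchis_a hchis_b Yab D0 mB).
- move=> mu1 mu2 s1 s2 rho s10 s20 rho1 d' Omega P X sample; split.
    exact: (det_scatter_neq0 hn hchi_n1 hchi_n2 Z12 s10 s20 rho1 sample).
  move=> alpha alpha01; rewrite /coverage.
  have := chi2_quantile_gt0 hchis_a hchis_b Yab alpha01.
  set q := quantile _ _ _ => q0.
  transitivity (Q [set w | `]q, +oo[%classic (chi_n1 w * chi_n2 w)]); last first.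
    by congr (Q _); apply/seteqP; split=> w /=; rewrite in_itv/= andbT.
  rewrite -(det_scatter_law hn hchi_n1 hchi_n2 Z12 s10 s20 rho1 sample)//.
  congr (P _); apply/funext => w; apply/propext; rewrite /= in_itv/= andbT.
  (* This holds for every sample point, singular scatter matrices included, so the two events
     coincide exactly. *)
  have -> : quantile Q (theta3_star (X ^~ w)) (1 - alpha) = \det (scatter (X ^~ w)) / q.
    apply: (chi2_quantile_inv hchis_a hchis_b Yab alpha01).
    exact: det_scatter_ge0.
  by rewrite ltr_pdivlMr// ltr_pdivlMr ?det_Sigma_gt0// mulrC.
- have n3 : (3 : R) <= n%:R by rewrite ler_nat.
  have [m nE] : exists m, n = m.+3 by exists (n - 3)%N; rewrite -addn3 subnK.
  have n1E : n%:R - 1 = m.+2%:R :> R by rewrite nE -[m.+3]addn1 natrD addrK.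
  have n2E : n%:R - 2 = m.+1%:R :> R by rewrite nE -[m.+3]addn2 natrD addrK.
  split=> [cov|].
    have na0 : 0 < n%:R - a by rewrite subr_gt0.
    have nb0 : 0 < n%:R - b by rewrite subr_gt0.
    have n10 : 0 < n%:R - 1 :> R by lra.
    have n20 : 0 < n%:R - 2 :> R by lra.
    have [mul add] := eq_product_chi2_moments hchis_a hchis_b Yab hchi_n1 hchi_n2 Z12
      na0 nb0 n10 n20 cov.
    (* The sum gives [b = 3 - a]; in the product all terms with [n] then cancel. *)
    have : (a - 1) * (a - 2) = 0.
      have bE : b = 3 - a by lra.
      move: mul; rewrite bE => mul; lra.
    move=> /eqP; rewrite mulf_eq0 !subr_eq0 => /orP[]/eqP aE; [left|right]; split=> //; lra.
  case=> -[aE bE] alpha alpha01; rewrite -(chi2_quantile_gt hchis_a hchis_b Yab alpha01);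
    rewrite /coverage; move: (quantile _ _ _) => q; apply/esym.
    rewrite aE bE in hchis_a hchis_b.
    have := @product_chi2_law _ _ _ _ _ _ _ _ _ _ _ _
      `]q, +oo[%classic n1E n2E hchis_a hchis_b Yab
      hchi_n1 hchi_n2 Z12 (measurable_itv _).
    by congr (Q _ = Q _); apply/seteqP; split=> w /=; rewrite in_itv/= andbT.
  (* For [(2, 1)] the degrees of freedom match after exchanging the two starred factors. *)
  rewrite aE bE in hchis_a hchis_b.
  have := @product_chi2_law _ _ _ _ _ _ _ _ _ _ _ _
      `]q, +oo[%classic n1E n2E hchis_b hchis_a Yba
      hchi_n1 hchi_n2 Z12 (measurable_itv _).
  by congr (Q _ = Q _); apply/seteqP; split=> w /=; rewrite in_itv/= andbT mulrC.
Qed.
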